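(* Let $0<\alpha<1$, let $\{B(t):t\in[0,1]\}$ be a fractional Brownian motion of Hurst index $\alpha$, and let \[ \mathcal R=\left\{t\in[0,1]:\ B(t)=\max_{s\in[0,t]}B(s)\right\} \] be the set of record times of $B$. Then, almost surely, $\dim_{\mathcal H}\mathcal R=\overline{\dim}_{\mathcal M}\mathcal R=\alpha$.
   Context: A process $\{B(t):t\ge0\}$ is a fractional Brownian motion of Hurst index $\alpha\in(0,1)$ if $B$ is a Gaussian process with stationary increments, $B(0)=0$, $t^{-\alpha}B(t)$ is standard normal for every $t>0$, and almost surely $t\mapsto B(t)$ is continuous; its covariance is $\mathbb E(B(t)B(s))=\frac12(|t|^{2\alpha}+|s|^{2\alpha}-|t-s|^{2\alpha})$. Here it is restricted to $[0,1]$. $\dim_{\mathcal H}$ is Hausdorff dimension. $\overline{\dim}_{\mathcal M}$ is the upper Minkowski (upper box) dimension: for an integer $M\ge2$, $\overline{\dim}_{\mathcal M}A=\limsup_{n\to\infty}\frac{\log N_n(A,M)}{n\log M}$, where $N_n(A,M)$ is the number of intervals $[pM^{-n},(p+1)M^{-n})$, $p\in\{0,\dots,M^n-1\}$, that intersect $A$ (the value does not depend on $M$). *)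

(* Defs.v *)
From HB Require Import structures.
From mathcomp Require Import all_boot all_order all_algebra.
From mathcomp Require Import all_classical all_reals all_analysis.

Set Implicit Arguments.
Unset Strict Implicit.
Unset Printing Implicit Defensive.

Import Order.TTheory GRing.Theory Num.Theory.
Import numFieldNormedType.Exports.

Local Open Scope classical_set_scope.
Local Open Scope ring_scope.

Section fractional_brownian_motion.
Context (d : measure_display) (T : measurableType d) (R : realType).
Variable P : probability T R.

(* [normal_prob m 0] is a uniform law in the library, so the degenerate normal
   law of variance 0 has to be given separately as a Dirac mass. *)
Definition gaussian_variable (X : T -> R) : Prop :=
  exists m s : R, 0 <= s /\
    forall A : set R, measurable A ->
      P (X @^-1` A) = if s == 0 then \d_m A else normal_prob m s A.

(* A process indexed by D is given by a family of random variables indexed by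
   all of R, of which only the members with index in D are ever constrained. *)
Definition gaussian_process (D : set R) (X : R -> {RV P >-> R}) : Prop :=
  forall (n : nat) (t c : 'I_n -> R), (forall i, D (t i)) ->
    gaussian_variable (fun w => \sum_(i < n) c i * X (t i) w).

Definition same_finite_dim_laws (D : set R) (X Y : R -> T -> R) : Prop :=
  forall (n : nat) (t : n.-tuple R), (forall i, D (tnth t i)) ->
  forall A : set (n.-tuple R), measurable A ->
    P ((fun w => [tuple X (tnth t i) w | i < n]) @^-1` A) =
    P ((fun w => [tuple Y (tnth t i) w | i < n]) @^-1` A).

(* For D an interval with least element 0. *)
Definition stationary_increments (D : set R) (X : R -> {RV P >-> R}) : Prop :=
  forall h : R, D h ->
    same_finite_dim_laws [set t | D t /\ D (t + h)]
      (fun t w => X (t + h) w - X h w) (fun t w => X t w - X 0 w).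

Record fractional_brownian_motion (D : set R) (alpha : R)
    (B : R -> {RV P >-> R}) : Prop := FractionalBrownianMotion {
  fbm_gaussian : gaussian_process D B;
  fbm_stationary : stationary_increments D B;
  fbm_zero : {ae P, forall w, B 0 w = 0};
  fbm_normal : forall t : R, D t -> 0 < t ->
    forall A : set R, measurable A ->
      P ((fun w => t `^ (- alpha) * B t w) @^-1` A) = normal_prob 0 1 A;
  fbm_continuous : {ae P, forall w, {within D, continuous (fun t => B t w)}}
}.

End fractional_brownian_motion.

Section dimensions.
Context (R : realType).

Definition diameter (A : set R) : \bar R :=
  ereal_sup [set `|x - y|%:E | x in A & y in A].

(* The empty members of a cover have diameter -oo here; they are left out of
   the sum, and a singleton counts for 1 when s = 0. *)
Definition hausdorff_premeasure (s delta : R) (A : set R) : \bar R :=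
  ereal_inf [set (\sum_(0 <= i <oo | U i != set0) (diameter (U i) `^ s))%E
            | U in [set U : nat -> set R |
                A `<=` \bigcup_i U i /\
                forall i, (diameter (U i) <= delta%:E)%E]].

Definition hausdorff_measure (s : R) (A : set R) : \bar R :=
  ereal_sup [set hausdorff_premeasure s delta A | delta in [set x | 0 < x]].

Definition hausdorff_dim (A : set R) : \bar R :=
  ereal_inf [set s%:E | s in [set s : R |
                          0 <= s /\ hausdorff_measure s A = 0%E]].

Definition box_count (M n : nat) (A : set R) : nat :=
  #|[set p : 'I_(M ^ n) |
      `[< A `&` `[p%:R / M%:R ^+ n, p.+1%:R / M%:R ^+ n[ !=set0 >] ]%SET|.

(* [ln 0 = 0]: meant for A meeting [0, 1[; the term n = 0 is junk. *)
Definition upper_minkowski_dim (M : nat) (A : set R) : \bar R :=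
  limn_esup (fun n => (ln (box_count M n A)%:R / (n%:R * ln M%:R))%:E).

End dimensions.

Definition is_max (R : realType) (A : set R) (m : R) : Prop :=
  A m /\ ubound A m.

Definition record_times (R : realType) (f : R -> R) : set R :=
  [set t | `[0, 1]%classic t /\ is_max (f @` `[0, t]) (f t)].

(* Main.v *)
Require Import Defs.
From HB Require Import structures.
From mathcomp Require Import all_boot all_order all_algebra.
From mathcomp Require Import all_classical all_reals all_analysis.
From mathcomp Require Import measurable_realfun ring lra.

Set Implicit Arguments.
Unset Strict Implicit.
Unset Printing Implicit Defensive.

Import Order.TTheory GRing.Theory Num.Theory.
Import numFieldNormedType.Exports.

Local Open Scope classical_set_scope.
Local Open Scope ring_scope.

(** Let [L = M ^ - n] and let a grid of mesh [h = M ^ - m] refine the boxes of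
    level [n], with [m] about [(1 + eps) n].

    Upper bound.  Paths are Hoelder continuous of every exponent below [alpha],
    by chaining over the grids ([fbm_grid_incr_ae], [chain_point]).  So, when a
    box contains a record time [r], the grid point just below [r] is a near
    record: up to [delta = L ^ alpha / 4], it dominates the grid points at
    distance at least [L] to its left ([box_count_records]).  It remains to
    count near records.  Grid points that exceed by [delta] all those at distance
    at least [L] to their left are few, for a deterministic reason: each of them
    raises the maximum over such a window by [delta], and these rises telescope
    ([count_gap_records]), so that their mean number is at most [L / h] times
    the mean of the maximum of the path, divided by [delta]
    ([mean_running_max]).  Finally the probability of a near record is not much
    larger than that of a record by the margin [delta] ([gaussian_shift]).  To
    see this, let [Z] be the normalised increment over the window.  All the
    differences between the value at the grid point and the values compared with
    it have covariance at least [L ^ alpha / 2] with [Z], because the variance of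
    increments grows with their length ([fbm_cov_incr]); raising [Z] by
    [1], conditionally on the part of the path that is independent of [Z],
    turns a near record into a record by the margin, and costs a factor
    exponential in the size of [Z], hence a small power of [M ^ n] outside an
    event of negligible probability.  Altogether, the mean number of near
    records is at most [M ^ ((alpha + 3 eps) n)] up to a constant
    ([near_record_count_bound]); the inequality of Markov and the
    Borel-Cantelli lemma bound the box counts eventually, almost surely.

    Lower bound.  Every value between [0] and the maximum of the path is first
    reached at a record time ([record_values]), so that the path maps the record
    times onto an interval.  The interval is not reduced to a point: at the times
    of a geometric sequence of small ratio, the normalised process is nearly
    uncorrelated, hence unlikely to be nonpositive throughout ([fbm_pos_ae]).
    A Hoelder map of exponent [beta] onto an interval forces the Hausdorff
    dimension of its source to be at least [beta] ([hausdorff_dim_ge]), and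
    the Hausdorff dimension is at most the upper Minkowski dimension.

    Independence is obtained from zero covariance in a Gaussian space by testing
    on cosines, and passing to bounded pointwise limits of their linear
    combinations ([trig_closure_mean], [trig_closure_ge]). *)

(** * Integrals against normal laws *)

Section normal_law.
Context {R : realType}.
Notation mu := (@lebesgue_measure R).
Notation stdn := (@normal_prob R 0 1).

Lemma integral_normal_prob (m s : R) (f : R -> \bar R) :
  (forall x, 0 <= f x)%E -> measurable_fun [set: R] f ->
  (\int[normal_prob m s]_x f x = \int[mu]_x (f x * (normal_pdf m s x)%:E))%E.
Proof.
move=> f0 mf.
rewrite -(Radon_Nikodym_SigmaFinite.change_of_variables
  (normal_prob_dominates m s))//=.
apply: ae_eq_integral => //.
- apply: emeasurable_funM => //; apply: (measurable_int mu).
  by apply: Radon_Nikodym_SigmaFinite.f_integrable; exact: normal_prob_dominates.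
- apply: emeasurable_funM => //=; apply/measurableT_comp => //=.
  exact: measurable_normal_pdf.
apply: ae_eqe_mul2l => /=.
apply: integral_ae_eq => //=.
- by apply: Radon_Nikodym_SigmaFinite.f_integrable; exact: normal_prob_dominates.
- by apply/measurableT_comp => //; exact: measurable_normal_pdf.
move=> E _ mE.
rewrite -Radon_Nikodym_SigmaFinite.f_integral//.
exact: normal_prob_dominates.
Qed.

Lemma ge0_integral_affine (m s : R) (G : R -> R) : 0 < s -> continuous G ->
  (forall x, 0 <= G x) ->
  (\int[mu]_x (G x)%:E = \int[mu]_x (G (m + s * x) * s)%:E)%E.
Proof.
move=> s0 cG G0.
have dF (x : R) : is_derive x (1:R) (fun x : R => m + s * x) s.
  have -> : (fun x : R => m + s * x) = cst m + s *: (id : R -> R) by apply/funext.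
  have h : is_derive x 1 (cst m + s *: (id : R -> R)) (0 + s *: (1 : R)).
    by apply: is_deriveD.
  by apply: is_derive_eq; rewrite add0r /GRing.scale/= mulr1.
have F'E : (fun x : R => m + s * x)^`()%classic = cst s.
  by apply/funext => x; rewrite derive1E; exact: derive_val.
rewrite (@increasing_ge0_integration_by_substitutionT _ (fun x => m + s * x) G)//.
- by apply: eq_integral => x _; rewrite F'E.
- by move=> x y xy; rewrite ltrD2l ltr_pM2l.
- by rewrite F'E => ?; exact: cvg_cst.
- by rewrite F'E; exact: is_cvg_cst.
- by rewrite F'E; exact: is_cvg_cst.
- apply/cvgrNyPle => A; exists (s^-1 * (A - m)); split; first exact: num_real.
  by move=> x xA; rewrite -lerBrDl -ler_pdivlMl// ltW.
- apply/cvgryPge => A; exists (s^-1 * (A - m)); split; first exact: num_real.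
  by move=> x xA; rewrite -lerBlDl -ler_pdivrMl// ltW.
Qed.

Lemma normal_pdf_affine (m s x : R) : 0 < s ->
  normal_pdf m s (m + s * x) * s = normal_pdf 0 1 x.
Proof.
move=> s0; have s1 : s != 0 by rewrite gt_eqF.
rewrite !normal_pdfE ?oner_eq0// /normal_peak /normal_fun mulrAC.
rewrite -mulrnAr sqrtrM ?sqr_ge0// sqrtr_sqr gtr0_norm// invfM.
rewrite [_ / _ * s]mulrAC mulVf// mul1r expr1n -mulrnAr mul1r.
by congr (_ * expR _); field.
Qed.

Lemma measurable_normal_pdf' (m s : R) :
  measurable_fun [set: R] (fun x => (normal_pdf m s x)%:E).
Proof. by apply/measurable_EFinP; exact: measurable_normal_pdf. Qed.

Lemma normal_prob_affine (m s : R) (f : R -> R) : 0 < s -> continuous f ->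
  (forall x, 0 <= f x) ->
  (\int[normal_prob m s]_x (f x)%:E = \int[stdn]_x (f (m + s * x))%:E)%E.
Proof.
move=> s0 cf f0.
have s1 : s != 0 by rewrite gt_eqF.
have cfs : continuous (fun x => f (m + s * x)).
  move=> x; apply: continuous_comp; last exact: cf.
  by apply: cvgD; [exact: cvg_cst|apply: cvgM; [exact: cvg_cst|exact: cvg_id]].
have ge0 (g : R -> R) : (forall x, 0 <= g x) -> forall x, (0 <= (g x)%:E)%E.
  by move=> g0 x; rewrite lee_fin.
have mE (g : R -> R) : continuous g -> measurable_fun [set: R] (EFin \o g).
  by move=> cg; apply/measurable_EFinP; exact: continuous_measurable_fun.
rewrite (integral_normal_prob m s (ge0 _ f0) (mE _ cf)).
rewrite (integral_normal_prob 0 1 (ge0 _ (fun x => f0 _)) (mE _ cfs)).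
under eq_integral do rewrite -EFinM.
rewrite (@ge0_integral_affine m s (fun x => f x * normal_pdf m s x))//.
- apply: eq_integral => x _ /=; rewrite -EFinM -(normal_pdf_affine m x s0).
  by congr EFin; rewrite mulrA.
- by move=> x; apply: cvgM; [exact: cf|exact: continuous_normal_pdf].
- by move=> x; rewrite mulr_ge0// normal_pdf_ge0.
Qed.

Lemma stdn_opp (f : R -> \bar R) : measurable_fun [set: R] f ->
  (forall x, 0 <= f x)%E ->
  (\int[stdn]_x f (- x)%R = \int[stdn]_x f x)%E.
Proof.
move=> mf f0.
have pdfN x : normal_pdf 0 1 (- x) = normal_pdf 0 1 x :> R.
  by rewrite !normal_pdfE ?oner_eq0// /normal_fun !subr0 sqrrN.
have mfN : measurable_fun [set: R] (fun x : R => f (- x)).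
  by apply: measurableT_comp => //.
rewrite !integral_normal_prob//.
pose g x := (f x * (normal_pdf 0 1 x)%:E)%E.
have mg : measurable_fun [set: R] g.
  by apply: emeasurable_funM => //; exact: measurable_normal_pdf'.
transitivity (\int[mu]_x g (- x)%R)%E.
  by apply: eq_integral => x _; rewrite /g pdfN.
transitivity (\int[pushforward mu (-%R : _ -> measurableTypeR R)]_y g y)%E.
  rewrite ge0_integral_pushforward//= => y _.
  by rewrite /g mule_ge0// lee_fin normal_pdf_ge0.
by apply: eq_measure_integral => A mA _; rewrite -[RHS]lebesgue_measureN.
Qed.

(** The exponential tilt of a normal density is a translate of it. *)
Lemma stdn_expR (t : R) :
  (\int[stdn]_x (expR (t * x))%:E = (expR (t ^+ 2 / 2))%:E)%E.
Proof.
rewrite integral_normal_prob; last 2 first.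
- by move=> x; rewrite lee_fin expR_ge0.
- apply/measurable_EFinP; apply: measurableT_comp => //.
transitivity (\int[mu]_x ((expR (t ^+ 2 / 2))%:E * (normal_pdf t 1 x)%:E))%E.
  apply: eq_integral => x _; rewrite -!EFinM; congr EFin.
  rewrite !normal_pdfE ?oner_eq0// /normal_fun mulrCA [RHS]mulrCA -!expRD.
  congr (_ * expR _); rewrite expr1n; lra.
rewrite ge0_integralZl//; first by rewrite integral_normal_pdf mule1.
- exact: measurable_normal_pdf'.
- by move=> x _; rewrite lee_fin normal_pdf_ge0.
Qed.

Lemma normal_peak1_le : @normal_peak R 1 <= 2^-1.
Proof.
rewrite /normal_peak expr1n mul1r lef_pV2 ?posrE ?ltr0n//; last first.
  by rewrite sqrtr_gt0 pmulrn_lgt0// pi_gt0.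
rewrite -(ger0_norm (ler0n R 2)) -sqrtr_sqr ler_sqrt; last first.
  by rewrite mulrn_wge0// pi_ge0.
by have := pi_ge2 R; rewrite -[pi *+ 2]mulr_natr; lra.
Qed.

(** The density is at most [1 / 2]. *)
Lemma stdn_small (eta : R) : 0 <= eta ->
  (stdn [set x | (`|x| <= eta)%R] <= eta%:E)%E.
Proof.
move=> eta0.
have -> : [set x : R | `|x| <= eta] = `[- eta, eta]%classic.
  by apply/seteqP; split => x /=; rewrite in_itv/= ler_norml.
apply: (@le_trans _ _ (\int[mu]_(x in `[(- eta)%R, eta]) (2^-1)%:E)%E).
  apply: ge0_le_integral => //=.
  - by move=> x _; rewrite lee_fin normal_pdf_ge0.
  - by apply/measurable_funTS/measurableT_comp => //; exact: measurable_normal_pdf.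
  - move=> x _; rewrite lee_fin; apply: (@le_trans _ _ (normal_peak 1)).
      by apply: normal_pdf_ub; rewrite oner_eq0.
    exact: normal_peak1_le.
rewrite integral_cst//= lebesgue_measure_itv/= lte_fin.
case: ifPn => _; last by rewrite mule0 lee_fin.
rewrite -EFinB -EFinM lee_fin; lra.
Qed.

(** Over the bounded range of cells considered, the density of the normal law
    changes by a bounded factor from a cell to the next but one. *)
Lemma stdn_cell (k : R) (K : nat) : k <= K%:R ->
  (stdn `[k, (k + 1)%R[ <= (expR (3 * K%:R + 6))%:E * stdn `[(k + 2)%R, (k + 3)%R[)%E.
Proof.
move=> kK.
have len (a : R) : mu `[a, a + 1[%classic = 1%E.
  by rewrite lebesgue_measure_itv/= lte_fin ltrDl ltr01 -EFinB addrAC subrr add0r.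
have pdf_le x y : k <= x < k + 1 -> k + 2 <= y < k + 3 ->
    normal_pdf 0 1 x <= expR (3 * K%:R + 6) * normal_pdf 0 1 y.
  move=> xk yk; rewrite !normal_pdfE ?oner_eq0// mulrCA.
  rewrite ler_pM2l ?normal_peak_gt0 ?oner_eq0// /normal_fun -expRD ler_expR.
  (* [y ^ 2 - x ^ 2] is at most [(K + 3) ^ 2 - K ^ 2] *)
  rewrite !subr0 expr1n; have K0 : 0 <= K%:R :> R by []; nra.
have H y : k + 2 <= y < k + 3 ->
    (stdn `[k, (k + 1)%R[ <= (expR (3 * K%:R + 6) * normal_pdf 0 1 y)%:E)%E.
  move=> yk.
  apply: (@le_trans _ _ (\int[mu]_(x in `[k, (k + 1)%R[)
      (expR (3 * K%:R + 6) * normal_pdf 0 1 y)%:E)%E).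
    apply: ge0_le_integral => //=.
    - by move=> x _; rewrite lee_fin normal_pdf_ge0.
    - by apply/measurable_funTS/measurableT_comp => //; exact: measurable_normal_pdf.
    - by move=> x; rewrite in_itv/= => xk; rewrite lee_fin pdf_le.
  by rewrite integral_cst//= len mule1.
have -> : ((expR (3 * K%:R + 6))%:E * stdn `[(k + 2)%R, (k + 3)%R[ =
    \int[mu]_(y in `[(k + 2)%R, (k + 3)%R[)
      ((expR (3 * K%:R + 6))%:E * (normal_pdf 0 1 y)%:E))%E.
  rewrite ge0_integralZl//=.
  - by apply/measurable_funTS/measurableT_comp => //; exact: measurable_normal_pdf.
  - by move=> x _; rewrite lee_fin normal_pdf_ge0.
apply: (@le_trans _ _ (\int[mu]_(x in `[(k + 2)%R, (k + 3)%R[) stdn `[k, (k + 1)%R[)%E).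
  have -> : k + 3 = (k + 2) + 1 by lra.
  by rewrite integral_cst//= len mule1.
apply: ge0_le_integral => //=.
apply: measurable_funTS; apply: emeasurable_funM => //.
by apply: measurableT_comp => //; exact: measurable_normal_pdf.
Qed.

End normal_law.

Section convolution.
Context {R : realType}.
Notation mu := (@lebesgue_measure R).
Notation stdn := (@normal_prob R 0 1).

(** Completing the square in [x]: the joint density of [x] and of [u = a x + b y]
    is the density of [u] times the conditional density of [x]. *)
Lemma normal_pdf_conv (a b x u : R) : 0 < b ->
  let c := Num.sqrt (a ^+ 2 + b ^+ 2) in
  normal_pdf (a * x) b u * normal_pdf 0 1 x =
  normal_pdf 0 c u * normal_pdf (a * u / c ^+ 2) (b / c) x.
Proof.
move=> b0 c.
have c2 : c ^+ 2 = a ^+ 2 + b ^+ 2.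
  by rewrite sqr_sqrtr// addr_ge0 ?sqr_ge0.
have c0 : 0 < c by rewrite sqrtr_gt0 ltr_wpDl ?sqr_ge0 ?exprn_gt0.
have cN : c != 0 by rewrite gt_eqF.
have bN : b != 0 by rewrite gt_eqF.
have peak (s : R) : 0 < s -> normal_peak s = s^-1 * normal_peak 1.
  move=> s0; rewrite /normal_peak expr1n mul1r -mulrnAr sqrtrM ?sqr_ge0//.
  by rewrite sqrtr_sqr gtr0_norm// invfM.
rewrite !normal_pdfE ?oner_eq0 ?gt_eqF ?divr_gt0// /normal_fun.
rewrite (peak b)// (peak c)// (peak (b / c)) ?divr_gt0//.
set p := normal_peak 1.
have -> : b^-1 * p * expR (- (u - a * x) ^+ 2 / (b ^+ 2 *+ 2)) *
   (p * expR (- (x - 0) ^+ 2 / (1 ^+ 2 *+ 2))) = b^-1 * p * p *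
   (expR (- (u - a * x) ^+ 2 / (b ^+ 2 *+ 2)) * expR (- (x - 0) ^+ 2 / (1 ^+ 2 *+ 2))).
  by ring.
have -> : forall e1 e2 : R, c^-1 * p * e1 * ((b / c)^-1 * p * e2) = b^-1 * p * p * (e1 * e2).
  by move=> e1 e2; field; rewrite cN bN.
rewrite -!expRD; congr (_ * expR _).
rewrite expr1n !subr0.
have -> : c ^+ 2 *+ 2 = (a ^+ 2 + b ^+ 2) *+ 2 by rewrite c2.
have -> : (b / c) ^+ 2 = b ^+ 2 / (a ^+ 2 + b ^+ 2) by rewrite expr_div_n c2.
rewrite c2; field.
by rewrite bN -c2 expf_neq0.
Qed.

(** Independent centered normal variables add up to a normal variable, by
    exchanging the integrals and integrating [normal_pdf_conv] in [x]. *)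
Lemma stdn_conv (a b : R) (f : R -> R) : 0 < b -> continuous f ->
  (forall x, 0 <= f x) ->
  (\int[stdn]_x \int[stdn]_y (f (a * x + b * y))%:E =
   \int[stdn]_z (f (Num.sqrt (a ^+ 2 + b ^+ 2) * z))%:E)%E.
Proof.
move=> b0 cf f0; set c := Num.sqrt _.
have c0 : 0 < c by rewrite sqrtr_gt0 ltr_wpDl ?sqr_ge0 ?exprn_gt0.
have bN : b != 0 by rewrite gt_eqF.
have mf : measurable_fun [set: R] f by exact: continuous_measurable_fun.
have ge0 x : (0 <= (f x)%:E)%E by rewrite lee_fin.
have mEf : measurable_fun [set: R] (EFin \o f) by exact/measurable_EFinP.
pose K (z : measurableTypeR R * measurableTypeR R) : \bar R :=
  (f z.2 * (normal_pdf (a * z.1) b z.2 * normal_pdf 0 1 z.1))%:E.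
have K0 z : (0 <= K z)%E.
  by rewrite /K lee_fin !mulr_ge0// normal_pdf_ge0.
have mK : measurable_fun setT K.
  apply/measurable_EFinP; rewrite /K; apply: measurable_funM.
    by apply: measurableT_comp => //; exact: measurable_snd.
  apply: measurable_funM.
    rewrite [X in measurable_fun _ X](_ : _ = (fun z => normal_peak b *
      expR (- (z.2 - a * z.1) ^+ 2 / (b ^+ 2 *+ 2)))); last first.
      by apply/funext => z; rewrite normal_pdfE.
    apply: measurable_funM => //; apply: measurableT_comp => //.
    apply: measurable_funM => //; apply: measurableT_comp => //.
    apply: measurable_funX; apply: measurable_funB; first exact: measurable_snd.
    by apply: measurable_funM => //; exact: measurable_fst.
  by apply: measurableT_comp; [exact: measurable_normal_pdf|exact: measurable_fst].
transitivity (\int[mu]_x \int[mu]_u K (x, u))%E.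
  rewrite integral_normal_prob; last 2 first.
  - by move=> x; exact: integral_ge0.
  - apply: (@measurable_fun_fubini_tonelli_F _ _ _ _ _ stdn
      (fun z : measurableTypeR R * measurableTypeR R =>
        (f (a * z.1 + b * z.2))%:E)).
    + apply/measurable_EFinP; apply: measurableT_comp => //.
      by apply: measurable_funD; apply: measurable_funM => //.
    + by move=> z; rewrite lee_fin.
  apply: eq_integral => x _.
  rewrite -(@normal_prob_affine _ (a * x) b f b0 cf f0).
  rewrite integral_normal_prob// -ge0_integralZr//=; last 3 first.
  - by apply: emeasurable_funM => //; exact: measurable_normal_pdf'.
  - by move=> u _; rewrite mule_ge0// lee_fin normal_pdf_ge0.
  - by rewrite lee_fin normal_pdf_ge0.
  by apply: eq_integral => u _; rewrite /K/= mulrA !EFinM.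
rewrite (@fubini_tonelli _ _ _ _ _ mu mu K mK K0).
transitivity (\int[normal_prob 0 c]_z (f z)%:E)%E; last first.
  rewrite normal_prob_affine//.
  by apply: eq_integral => z _; rewrite add0r.
rewrite integral_normal_prob//; apply: eq_integral => u _.
transitivity (\int[mu]_x ((f u)%:E * (normal_pdf 0 c u)%:E *
    (normal_pdf (a * u / c ^+ 2) (b / c) x)%:E))%E.
  by apply: eq_integral => x _; rewrite /K/= normal_pdf_conv// !EFinM muleA.
rewrite ge0_integralZl//=.
- by rewrite integral_normal_pdf mule1.
- exact: measurable_normal_pdf'.
- by move=> x _; rewrite lee_fin normal_pdf_ge0.
- by rewrite mule_ge0// lee_fin normal_pdf_ge0.
Qed.

End convolution.

(** * Means over a probability space *)

Section mean.
Context d (T : measurableType d) (R : realType) (Q : probability T R).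
Implicit Types f g : T -> R.

Definition integ f := Q.-integrable [set: T] (EFin \o f).
Definition mean f := \int[Q]_w f w.

Lemma integ_meas f : integ f -> measurable_fun [set: T] f.
Proof. by move=> /integrableP[/measurable_EFinP]. Qed.

Lemma integ_lin a f g : integ f -> integ g -> integ (fun w => a * f w + g w).
Proof.
move=> If Ig; rewrite /integ.
rewrite [X in _.-integrable _ X](_ : _ = (fun w => a%:E * (f w)%:E + (g w)%:E)%E).
  by apply: integrableD => //; exact: integrableZl.
by apply/funext => w.
Qed.

Lemma integ_bounded f (C : R) : measurable_fun [set: T] f ->
  (forall w, `|f w| <= C) -> integ f.
Proof.
move=> mf fC; apply: measurable_bounded_integrable => //.
  by rewrite (le_lt_trans (probability_le1 Q _))// ltry.
exists C; split; first exact: num_real.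
by move=> M CM w _ /=; rewrite (le_trans (fC w))// ltW.
Qed.

Lemma integ_cst c : integ (cst c).
Proof. by apply: (@integ_bounded _ `|c|). Qed.

Lemma mean_cst c : mean (fun=> c) = c.
Proof. by rewrite /mean /Rintegral integral_cst//= probability_setT mule1. Qed.

Lemma integZ a f : integ f -> integ (fun w => a * f w).
Proof.
move=> If; have := integ_lin a If (integ_cst 0).
by under eq_fun do rewrite addr0.
Qed.

Lemma meanZ a f : integ f -> mean (fun w => a * f w) = a * mean f.
Proof. by move=> If; rewrite /mean RintegralZl. Qed.

Lemma mean_lin a f g : integ f -> integ g ->
  mean (fun w => a * f w + g w) = a * mean f + mean g.
Proof. by move=> If Ig; rewrite -meanZ// /mean RintegralD//; exact: integZ. Qed.

Lemma integD f g : integ f -> integ g -> integ (fun w => f w + g w).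
Proof.
by move=> If Ig; have := integ_lin 1 If Ig; under eq_fun do rewrite mul1r.
Qed.

Lemma meanD f g : integ f -> integ g ->
  mean (fun w => f w + g w) = mean f + mean g.
Proof. by move=> If Ig; rewrite /mean RintegralD. Qed.

Lemma mean_sum (I : Type) (s : seq I) (f : I -> T -> R) :
  (forall i, integ (f i)) ->
  integ (fun w => \sum_(i <- s) f i w) /\
  mean (fun w => \sum_(i <- s) f i w) = \sum_(i <- s) mean (f i).
Proof.
move=> If; elim: s => [|i s [IHi IHm]].
  under eq_fun do rewrite big_nil.
  by rewrite big_nil mean_cst; split => //; exact: integ_cst.
under eq_fun do rewrite big_cons.
by rewrite big_cons meanD// IHm; split => //; exact: integD.
Qed.

Lemma le_mean f g : integ f -> integ g -> (forall w, f w <= g w) ->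
  mean f <= mean g.
Proof. by move=> If Ig fg; exact: le_Rintegral. Qed.

Lemma integ_le f g : measurable_fun [set: T] f -> integ g ->
  (forall w, `|f w| <= g w) -> integ f.
Proof.
move=> mf Ig fg; apply: le_integrable Ig => //.
  exact/measurable_EFinP.
by move=> w _ /=; rewrite lee_fin (le_trans (fg w))// ler_norm.
Qed.

Lemma ge0_integ f r : measurable_fun [set: T] f -> (forall w, 0 <= f w) ->
  (\int[Q]_w (f w)%:E = r%:E)%E -> integ f /\ mean f = r.
Proof.
move=> mf f0 fr; split; last by rewrite /mean /Rintegral fr.
apply/integrableP; split; first exact/measurable_EFinP.
rewrite (eq_integral (fun w => (f w)%:E)); first by rewrite fr ltry.
by move=> w _ /=; rewrite ger0_norm.
Qed.

Lemma mean_integralE f : integ f -> (\int[Q]_w (f w)%:E = (mean f)%:E)%E.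
Proof. by move=> If; rewrite /mean /Rintegral fineK//; exact: integrable_fin_num. Qed.

Lemma mean_indic (A : set T) : measurable A -> ((mean (\1_A))%:E = Q A)%E.
Proof.
move=> mA; rewrite -mean_integralE; first by rewrite integral_indic// setIT.
by apply: (@integ_bounded _ 1) => // w; rewrite indicE; case: (_ \in _); rewrite ?normr1 ?normr0.
Qed.

(** Dominated convergence, for uniformly bounded sequences. *)
Lemma mean_cvg (u : nat -> T -> R) (C : R) f :
  (forall n, measurable_fun [set: T] (u n)) -> (forall n w, `|u n w| <= C) ->
  (forall w, u ^~ w @ \oo --> f w) -> mean (u n) @[n --> \oo] --> mean f.
Proof.
move=> mu uC uf.
have mf : measurable_fun [set: T] f.
  by apply: (measurable_fun_cvg (h := u)) => // w _; exact: uf.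
have [] := @dominated_convergence _ _ _ Q setT measurableT
  (fun n w => (u n w)%:E) (EFin \o f) (cst C%:E).
- by move=> n; exact/measurable_EFinP.
- exact/measurable_EFinP.
- by apply: aeW => w _; apply: cvg_EFin; [exact: nearW|exact: uf].
- exact: integ_cst.
- by apply: aeW => w n _ /=; rewrite lee_fin.
move=> If _ h; rewrite /mean /Rintegral.
by apply: fine_cvg; rewrite fineK//; exact: integrable_fin_num.
Qed.

End mean.

(** * Characteristic function and moments of normal laws *)

Section normal_characteristic.
Context {R : realType}.
Notation stdn := (@normal_prob R 0 1).

(** The characteristic function of the standard normal law, which is real. *)
Definition normal_char (s : R) := mean stdn (fun x => cos (s * x)).

Lemma continuous_cos_affine (a b : R) : continuous (fun x : R => cos (a * x + b)).
Proof.
move=> x; apply: continuous_comp; last exact: continuous_cos.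
by apply: cvgD; [apply: cvgM; [exact: cvg_cst|exact: cvg_id]|exact: cvg_cst].
Qed.

Lemma integ_cos_affine (a b : R) : integ stdn (fun x => cos (a * x + b)).
Proof.
apply: (@integ_bounded _ _ _ _ _ 1) => [|x]; last exact: cos_max.
by apply: continuous_measurable_fun; exact: continuous_cos_affine.
Qed.

Lemma cosD1_ge0 (x : R) : 0 <= 1 + cos x.
Proof. by have := cos_geN1 x; lra. Qed.

Lemma integral_cosD1 (a b : R) :
  (\int[stdn]_x (1 + cos (a * x + b))%:E =
   (1 + mean stdn (fun x => cos (a * x + b)))%:E)%E.
Proof.
rewrite mean_integralE; first by rewrite meanD ?mean_cst//;
  [exact: integ_cst|exact: integ_cos_affine].
by apply: integD; [exact: integ_cst|exact: integ_cos_affine].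
Qed.

(** The term in [sin (s * x)] of the addition formula vanishes by symmetry of the
    normal law. *)
Lemma mean_cos_affine (s p : R) :
  mean stdn (fun x => cos (s * x + p)) = normal_char s * cos p.
Proof.
have sym : mean stdn (fun x => cos (s * x + p)) =
           mean stdn (fun x => cos (s * x - p)).
  apply: (addrI 1); apply: EFin_inj; rewrite -!integral_cosD1.
  rewrite -stdn_opp; last 2 first.
  - apply/measurable_EFinP; apply: measurable_funD => //.
    by apply: continuous_measurable_fun; exact: continuous_cos_affine.
  - by move=> x; rewrite lee_fin cosD1_ge0.
  apply: eq_integral => x _; congr (_ + _)%:E.
  by rewrite -cosN; congr cos; ring.
have -> : mean stdn (fun x => cos (s * x + p)) =
    2^-1 * (mean stdn (fun x => cos (s * x + p)) +
            mean stdn (fun x => cos (s * x - p))) by rewrite -sym; field.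
rewrite -meanD; [|exact: integ_cos_affine..].
rewrite -meanZ; last by apply: integD; exact: integ_cos_affine.
rewrite /normal_char [RHS]mulrC -meanZ; last first.
  by have := integ_cos_affine s 0; under eq_fun do rewrite addr0.
by congr mean; apply/funext => x; rewrite cosD cosB; field.
Qed.

Lemma normal_charN (s : R) : normal_char (- s) = normal_char s.
Proof.
by rewrite /normal_char; congr mean; apply/funext => x; rewrite mulNr cosN.
Qed.

(** All that is used of the formula [normal_char s = expR (- s ^ 2 / 2)]: sums of
    variances become products.  It is [stdn_conv] for the function [1 + cos],
    which is nonnegative. *)
Lemma normal_charM (a b : R) : 0 <= b ->
  normal_char (Num.sqrt (a ^+ 2 + b ^+ 2)) = normal_char a * normal_char b.
Proof.
rewrite le_eqVlt => /predU1P[<-|b0].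
  have -> : normal_char 0 = 1.
    rewrite /normal_char -[RHS](@mean_cst _ _ _ stdn 1).
    by congr mean; apply/funext => x; rewrite mul0r cos0.
  rewrite expr0n addr0 sqrtr_sqr mulr1.
  by have [_|_] := ger0P a; rewrite ?normal_charN.
have cc : continuous (fun x : R => 1 + cos x).
  by move=> x; apply: cvgD; [exact: cvg_cst|exact: continuous_cos].
have := stdn_conv a b0 cc cosD1_ge0.
have -> : (\int[stdn]_z (1 + cos (Num.sqrt (a ^+ 2 + b ^+ 2) * z))%:E)%E =
    (1 + normal_char (Num.sqrt (a ^+ 2 + b ^+ 2)))%:E.
  set c := Num.sqrt _.
  transitivity (\int[stdn]_z (1 + cos (c * z + 0))%:E)%E.
    by apply: eq_integral => z _; rewrite addr0.
  by rewrite integral_cosD1 mean_cos_affine cos0 mulr1.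
move=> h; apply: (addrI 1); apply: EFin_inj; rewrite -h.
transitivity (\int[stdn]_x (1 + normal_char b * cos (a * x + 0))%:E)%E.
  apply: eq_integral => x _; rewrite addr0.
  transitivity (\int[stdn]_y (1 + cos (b * y + a * x))%:E)%E.
    by apply: eq_integral => y _; rewrite addrC [b * y + _]addrC addrC.
  by rewrite integral_cosD1 mean_cos_affine.
have Ic := integZ (normal_char b) (integ_cos_affine a 0).
rewrite mean_integralE; last by apply: integD => //; exact: integ_cst.
rewrite meanD//; last exact: integ_cst.
rewrite mean_cst meanZ; last exact: integ_cos_affine.
by rewrite mean_cos_affine cos0 mulr1 mulrC.
Qed.

End normal_characteristic.

Section second_moment.
Context {R : realType}.
Notation stdn := (@normal_prob R 0 1).

Lemma sqr_le_expR (x : R) : x ^+ 2 <= 4 * (expR (1 * x) + expR (- 1 * x)).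
Proof.
wlog x0 : x / 0 <= x.
  move=> h; have [|x0] := leP 0 x; first exact: h.
  have := h (- x); rewrite sqrrN mul1r !mulN1r opprK mul1r addrC; apply.
  by rewrite oppr_ge0 ltW.
have h : 1 + x / 2 <= expR (x / 2) by exact: expR_ge1Dx.
have -> : expR (1 * x) = expR (x / 2) ^+ 2.
  by rewrite mul1r -expRM_natl; congr expR; field.
have e0 : 0 <= expR (- 1 * x) by exact: expR_ge0.
have : (1 + x / 2) ^+ 2 <= expR (x / 2) ^+ 2.
  by rewrite ler_sqr// ?nnegrE ?expR_ge0//; lra.
nra.
Qed.

Lemma integ_stdn_expR (t : R) : integ stdn (fun x => expR (t * x)).
Proof.
have := @ge0_integ _ _ _ stdn (fun x => expR (t * x)) (expR (t ^+ 2 / 2)).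
case.
- apply: continuous_measurable_fun => x.
  apply: continuous_comp; last exact: continuous_expR.
  by apply: cvgM; [exact: cvg_cst|exact: cvg_id].
- by move=> x; exact: expR_ge0.
- exact: stdn_expR.
- by [].
Qed.

Lemma measurable_sqr : measurable_fun [set: R] (fun x : R => x ^+ 2).
Proof. exact: measurable_funX. Qed.

Lemma integ_stdn_sqr : integ stdn (fun x => x ^+ 2).
Proof.
have := @integ_le _ _ _ stdn (fun x => x ^+ 2) (fun x => 4 * (expR (1 * x) + expR (- 1 * x))).
apply.
- exact: measurable_sqr.
- by apply: integZ; apply: integD; exact: integ_stdn_expR.
- by move=> x; rewrite ger0_norm ?sqr_ge0// sqr_le_expR.
Qed.

(** The second moment of the standard normal law; covariances are only used up
    to this factor, so that its value [1] need not be computed. *)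
Definition normal_var : R := mean stdn (fun x => x ^+ 2).

(** Otherwise all the mass would be near [0], against [stdn_small]. *)
Lemma normal_var_gt0 : 0 < normal_var.
Proof.
have aux (u : R) : u <= 2^-1 -> 0 < - 4^-1 * u + 4^-1 by lra.
have aux2 (u : R) : 2^-1 < u -> 4^-1 <= u ^+ 2 by nra.
have small : (stdn [set x | (`|x| <= 2^-1)%R] <= 2^-1%:E)%E.
  by apply: stdn_small; rewrite invr_ge0.
pose A : set R := [set x | `|x| <= 2^-1].
have mA : measurable A.
  have -> : A = `[- 2^-1, 2^-1]%classic.
    by apply/seteqP; split => x; rewrite /A /= in_itv/= ler_norml.
  exact: measurable_itv.
have IA : integ stdn (\1_A : R -> R).
  apply: (@integ_bounded _ _ _ _ _ 1) => // x.
  by rewrite indicE; case: (_ \in _); rewrite ?normr1 ?normr0.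
have mA1 : mean stdn (\1_A : R -> R) <= 2^-1.
  by rewrite -lee_fin mean_indic.
apply: (@lt_le_trans _ _ (mean stdn (fun x => - 4^-1 * \1_A x + 4^-1))).
  rewrite mean_lin//; last exact: integ_cst.
  by rewrite mean_cst aux.
apply: le_mean.
- by apply: integ_lin => //; exact: integ_cst.
- exact: integ_stdn_sqr.
- move=> x; rewrite indicE; have [|xA] := boolP (x \in A).
    by move=> _; rewrite mulr1 addNr sqr_ge0.
  rewrite mulr0 add0r -[x ^+ 2]ger0_norm ?sqr_ge0// normrX.
  by apply: aux2; rewrite ltNge; apply: contra xA => h; rewrite inE.
Qed.

Lemma stdn_sqr_affine (m s : R) :
  integ stdn (fun x => (m + s * x) ^+ 2) /\
  mean stdn (fun x => (m + s * x) ^+ 2) = m ^+ 2 + normal_var * s ^+ 2.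
Proof.
have Iid : integ stdn (fun x => x).
  have := @integ_le _ _ _ stdn (fun x => x) (fun x => x ^+ 2 + 1); apply.
  - exact: measurable_id.
  - by apply: integD; [exact: integ_stdn_sqr|exact: integ_cst].
  - by move=> x; rewrite ler_norml; apply/andP; split; nra.
have Isq (a b : R) : integ stdn (fun x => a * x ^+ 2 + (b * x + m ^+ 2)).
  apply: integ_lin; first exact: integ_stdn_sqr.
  by apply: integ_lin => //; exact: integ_cst.
have E (a b : R) : mean stdn (fun x => a * x ^+ 2 + (b * x + m ^+ 2)) =
    a * normal_var + (b * mean stdn (fun x => x) + m ^+ 2).
  rewrite mean_lin ?mean_lin ?mean_cst//; try exact: integ_cst.
    exact: integ_stdn_sqr.
  by apply: integ_lin => //; exact: integ_cst.
have m0 : mean stdn (fun x => x) = 0.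
  have : mean stdn (fun x => (1 + x) ^+ 2) = mean stdn (fun x => (1 - x) ^+ 2).
    rewrite /mean /Rintegral; congr fine.
    rewrite -stdn_opp//.
    + apply/measurable_EFinP; apply: measurable_funX; exact: measurable_funD.
    + by move=> x; rewrite lee_fin sqr_ge0.
  have sqE (b : R) : (fun x : R => (1 + b * x) ^+ 2) =
      (fun x => b ^+ 2 * x ^+ 2 + ((b *+ 2) * x + 1 )).
    by apply/funext => x; ring.
  have Isq1 (a b : R) : mean stdn (fun x => a * x ^+ 2 + (b * x + 1)) =
    a * normal_var + (b * mean stdn (fun x => x) + 1).
    rewrite mean_lin ?mean_lin ?mean_cst//; try exact: integ_cst.
      exact: integ_stdn_sqr.
    by apply: integ_lin => //; exact: integ_cst.
  have -> : (fun x : R => (1 + x) ^+ 2) = (fun x => 1 * x ^+ 2 + (2 * x + 1)).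
    by apply/funext => x; ring.
  have -> : (fun x : R => (1 - x) ^+ 2) = (fun x => 1 * x ^+ 2 + (- 2 * x + 1)).
    by apply/funext => x; ring.
  by rewrite !Isq1; lra.
have -> : (fun x : R => (m + s * x) ^+ 2) =
    (fun x => s ^+ 2 * x ^+ 2 + ((m * s *+ 2) * x + m ^+ 2)).
  by apply/funext => x; ring.
by split; [exact: Isq|rewrite E m0; ring].
Qed.

End second_moment.

Section gaussian_variables.
Context d (T : measurableType d) (R : realType) (P : probability T R).
Notation stdn := (@normal_prob R 0 1).
Implicit Types X Y : T -> R.

(** Here [s] is the standard deviation; [s = 0] stands for a constant variable. *)
Definition normal_law X (m s : R) := [/\ measurable_fun [set: T] X, 0 <= s &
  forall A : set R, measurable A ->
    P (X @^-1` A) = if s == 0 then \d_m A else normal_prob m s A].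

Lemma normal_law_integral X m s (f : R -> R) : normal_law X m s ->
  continuous f -> (forall x, 0 <= f x) ->
  (\int[P]_w (f (X w))%:E = \int[stdn]_x (f (m + s * x))%:E)%E.
Proof.
move=> [mX s0 law] cf f0.
have mf : measurable_fun [set: R] (EFin \o f).
  by apply/measurable_EFinP; exact: continuous_measurable_fun.
pose X' : T -> measurableTypeR R := X.
have -> : (\int[P]_w (f (X w))%:E = \int[pushforward P X']_x (f x)%:E)%E.
  by rewrite ge0_integral_pushforward//= => y _; rewrite lee_fin.
have [s1|sN] := eqVneq s 0.
  transitivity (\int[\d_(m : measurableTypeR R)]_x (f x)%:E)%E.
    by apply: eq_measure_integral => A mA _; have := law A mA; rewrite s1 eqxx.
  rewrite integral_dirac//= diracE in_setT mul1e s1.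
  rewrite (eq_integral (fun=> (f m)%:E)); last by move=> x _; rewrite mul0r addr0.
  by rewrite integral_cst//= probability_setT mule1.
rewrite -normal_prob_affine//; last by rewrite lt_neqAle eq_sym sN.
by apply: eq_measure_integral => A mA _; have := law A mA; rewrite (negbTE sN).
Qed.

Lemma normal_law_mean X m s (f : R -> R) : normal_law X m s ->
  continuous f -> (forall x, 0 <= f x) ->
  integ stdn (fun x => f (m + s * x)) ->
  integ P (fun w => f (X w)) /\
  mean P (fun w => f (X w)) = mean stdn (fun x => f (m + s * x)).
Proof.
move=> law cf f0 If; have [mX _ _] := law; apply: ge0_integ.
- by apply: measurableT_comp => //; exact: continuous_measurable_fun.
- by move=> w; exact: f0.
- by rewrite (normal_law_integral law)// mean_integralE.
Qed.

Lemma normal_law_expR X s t : normal_law X 0 s ->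
  integ P (fun w => expR (t * X w)) /\
  mean P (fun w => expR (t * X w)) = expR ((t * s) ^+ 2 / 2).
Proof.
move=> law.
have ce : continuous (fun x : R => expR (t * x)).
  move=> x; apply: continuous_comp; last exact: continuous_expR.
  by apply: cvgM; [exact: cvg_cst|exact: cvg_id].
have E : (fun x : R => expR (t * (0 + s * x))) = (fun x => expR (t * s * x)).
  by apply/funext => x; rewrite add0r mulrA.
have [] := normal_law_mean law ce (fun x => expR_ge0 _).
  by rewrite E; exact: integ_stdn_expR.
move=> Ie ->; split => //; rewrite E.
by apply: EFin_inj; rewrite -stdn_expR mean_integralE//; exact: integ_stdn_expR.
Qed.

Lemma normal_law_sqr X m s (a : R) : normal_law X m s ->
  integ P (fun w => (a + X w) ^+ 2) /\
  mean P (fun w => (a + X w) ^+ 2) = (a + m) ^+ 2 + normal_var * s ^+ 2.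
Proof.
move=> law.
have cs : continuous (fun x : R => (a + x) ^+ 2).
  move=> x; apply: (@continuous_comp _ _ _ (fun x => a + x) (fun y => y ^+ 2)); last exact: exprn_continuous.
  by apply: cvgD; [exact: cvg_cst|exact: cvg_id].
have [I <-] := stdn_sqr_affine (a + m) s.
have E : (fun x : R => (a + (m + s * x)) ^+ 2) = (fun x => (a + m + s * x) ^+ 2).
  by apply/funext => x; rewrite addrA.
have [] := normal_law_mean law cs (fun x => sqr_ge0 _).
  by rewrite E.
by move=> ? ->; rewrite E.
Qed.

Lemma normal_law_cos X s p : normal_law X 0 s ->
  mean P (fun w => cos (X w + p)) = normal_char s * cos p.
Proof.
move=> law; have [mX _ _] := law.
have cc : continuous (fun x : R => 1 + cos (x + p)).
  move=> x; apply: cvgD; first exact: cvg_cst.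
  apply: continuous_comp; last exact: continuous_cos.
  by apply: cvgD; [exact: cvg_id|exact: cvg_cst].
have E : (fun x : R => 1 + cos (0 + s * x + p)) = (fun x => 1 + cos (s * x + p)).
  by apply/funext => x; rewrite add0r.
have IX : integ P (fun w => cos (X w + p)).
  apply: (@integ_bounded _ _ _ _ _ 1) => [|w]; last exact: cos_max.
  apply: measurableT_comp; last exact: measurable_funD.
  by apply: continuous_measurable_fun; exact: continuous_cos.
have [|_] := normal_law_mean law cc (fun x => cosD1_ge0 _).
  by rewrite E; apply: integD; [exact: integ_cst|exact: integ_cos_affine].
rewrite E !meanD ?mean_cst ?mean_cos_affine//; try exact: integ_cst.
- by move/addrI.
- exact: integ_cos_affine.
Qed.

End gaussian_variables.

(** * Gaussian spaces: zero covariance and independence *)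

Lemma cosM_sum {R : realType} (a b : R) :
  cos a * cos b = 2^-1 * (cos (a + b) + cos (a - b)).
Proof. by rewrite cosD cosB; field. Qed.

Section gaussian_space.
Context d (T : measurableType d) (R : realType) (P : probability T R).
Implicit Types X Y Z : T -> R.

(** A Gaussian Hilbert space, without the closure: a vector space of centered
    normal variables. *)
Record gaussian_space (H : set (T -> R)) : Prop := GaussianSpace {
  gs_lin : forall a X Y, H X -> H Y -> H (fun w => a * X w + Y w);
  gs_law : forall X, H X -> exists s, normal_law P X 0 s }.

(** The covariance of centered variables, normalised so that the covariance of a
    standard normal variable with itself is [1]. *)
Definition cov X Y := mean P (fun w => X w * Y w) / normal_var.

Lemma covC X Y : cov X Y = cov Y X.
Proof. by rewrite /cov; congr (mean _ _ / _); apply/funext => w; rewrite mulrC. Qed.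

Lemma normal_law_cov X s : normal_law P X 0 s -> cov X X = s ^+ 2.
Proof.
move=> /(normal_law_sqr 0)[_].
have -> : (fun w => (0 + X w) ^+ 2) = (fun w => X w * X w).
  by apply/funext => w; rewrite add0r expr2.
rewrite /cov addr0 expr0n add0r => ->.
by rewrite mulrAC divff ?mul1r// gt_eqF// normal_var_gt0.
Qed.

Variables (H : set (T -> R)) (gsH : gaussian_space H).

Lemma gs_meas X : H X -> measurable_fun [set: T] X.
Proof. by move=> /(gs_law gsH)[s []]. Qed.

Lemma gsZ a X : H X -> H (fun w => a * X w).
Proof.
move=> HX; have := gs_lin gsH (a - 1) HX HX.
by under eq_fun do rewrite mulrBl mul1r subrK.
Qed.

Lemma gsD X Y : H X -> H Y -> H (fun w => X w + Y w).
Proof.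
by move=> HX HY; have := gs_lin gsH 1 HX HY; under eq_fun do rewrite mul1r.
Qed.

Lemma gsB X Y : H X -> H Y -> H (fun w => X w - Y w).
Proof.
move=> HX HY; have := gs_lin gsH (-1) HY HX.
by under eq_fun do rewrite mulN1r addrC.
Qed.

Lemma gs_sqr_integ X : H X -> integ P (fun w => X w ^+ 2).
Proof.
move=> /(gs_law gsH)[s /(normal_law_sqr 0)[+ _]].
by under eq_fun do rewrite add0r.
Qed.

(** Polarisation. *)
Lemma gs_mul_integ X Y : H X -> H Y -> integ P (fun w => X w * Y w).
Proof.
move=> HX HY.
have IX := gs_sqr_integ HX; have IY := gs_sqr_integ HY.
have IXY := gs_sqr_integ (gsD HX HY).
have := integ_lin 2^-1 IXY (integ_lin (- 2^-1) IX (integZ (- 2^-1) IY)).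
rewrite (_ : (fun w => _) = (fun w => X w * Y w))//.
by apply/funext => w; field.
Qed.

Lemma cov_linl a X Y Z : H X -> H Y -> H Z ->
  cov (fun w => a * X w + Y w) Z = a * cov X Z + cov Y Z.
Proof.
move=> HX HY HZ; rewrite /cov.
rewrite (_ : (fun w => _) = (fun w => a * (X w * Z w) + Y w * Z w)); last first.
  by apply/funext => w; ring.
by rewrite mean_lin; [rewrite mulrDl mulrA|exact: gs_mul_integ..].
Qed.

Lemma covDl X Y Z : H X -> H Y -> H Z ->
  cov (fun w => X w + Y w) Z = cov X Z + cov Y Z.
Proof.
move=> HX HY HZ; rewrite -[cov X Z]mul1r -cov_linl//.
by congr cov; apply/funext => w; rewrite mul1r.
Qed.

Lemma covBl X Y Z : H X -> H Y -> H Z ->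
  cov (fun w => X w - Y w) Z = cov X Z - cov Y Z.
Proof.
move=> HX HY HZ; rewrite addrC -mulN1r -cov_linl//.
by congr cov; apply/funext => w; rewrite mulN1r addrC.
Qed.

Lemma covZl a X Z : H X -> H Z -> cov (fun w => a * X w) Z = a * cov X Z.
Proof.
move=> HX HZ; rewrite /cov.
rewrite (_ : (fun w => _) = (fun w => a * (X w * Z w))); last first.
  by apply/funext => w; rewrite mulrA.
by rewrite meanZ; [rewrite mulrA|exact: gs_mul_integ].
Qed.

Lemma cov_ge0 X : H X -> 0 <= cov X X.
Proof.
by move=> /(gs_law gsH)[s /normal_law_cov ->]; exact: sqr_ge0.
Qed.

Lemma gs_sd_law X : H X -> normal_law P X 0 (Num.sqrt (cov X X)).
Proof.
move=> /(gs_law gsH)[s law]; rewrite (normal_law_cov law) sqrtr_sqr.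
by have [_ s0 _] := law; rewrite ger0_norm.
Qed.

Lemma gs_mean_cos X p : H X ->
  mean P (fun w => cos (X w + p)) = normal_char (Num.sqrt (cov X X)) * cos p.
Proof. by move=> HX; exact/normal_law_cos/gs_sd_law. Qed.

(** Uncorrelated Gaussian variables are independent, tested on trigonometric
    functions: the sum and the difference have the same variance, and the
    characteristic function is multiplicative in the variance. *)
Lemma gs_mean_cosM X Y p q : H X -> H Y -> cov X Y = 0 ->
  mean P (fun w => cos (X w + p) * cos (Y w + q)) =
  mean P (fun w => cos (X w + p)) * mean P (fun w => cos (Y w + q)).
Proof.
move=> HX HY XY0.
have HD := gsD HX HY; have HB := gsB HX HY.
have sq0 : Num.sqrt (cov X X + cov Y Y) =
    Num.sqrt (Num.sqrt (cov X X) ^+ 2 + Num.sqrt (cov Y Y) ^+ 2).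
  by rewrite !sqr_sqrtr// cov_ge0.
have vD : cov (fun w => X w + Y w) (fun w => X w + Y w) = cov X X + cov Y Y.
  rewrite covDl// covC covDl// [cov Y (fun w => X w + Y w)]covC covDl//.
  by rewrite [cov Y X]covC XY0; ring.
have vB : cov (fun w => X w - Y w) (fun w => X w - Y w) = cov X X + cov Y Y.
  rewrite covBl// covC covBl// [cov Y (fun w => X w - Y w)]covC covBl//.
  by rewrite [cov Y X]covC XY0; ring.
have Icos Z r : H Z -> integ P (fun w => cos (Z w + r)).
  move=> HZ; apply: (@integ_bounded _ _ _ _ _ 1) => [|w]; last exact: cos_max.
  apply: measurableT_comp; last by apply: measurable_funD => //; exact: gs_meas.
  by apply: continuous_measurable_fun; exact: continuous_cos.
rewrite (_ : (fun w => _) = (fun w => 2^-1 * (cos (X w + Y w + (p + q)) +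
    cos (X w - Y w + (p - q))))); last first.
  apply/funext => w.
  have -> : X w + Y w + (p + q) = (X w + p) + (Y w + q) by ring.
  have -> : X w - Y w + (p - q) = (X w + p) - (Y w + q) by ring.
  by rewrite cosM_sum.
rewrite meanZ; last by apply: integD; exact: Icos.
rewrite meanD; [|exact: Icos..].
rewrite (gs_mean_cos _ HD) (gs_mean_cos _ HB) vD vB !gs_mean_cos//.
rewrite sq0 normal_charM ?sqrtr_ge0// (cosD p q) (cosB p q).
have aux (a b c e f : R) :
  2^-1 * (a * b * (c * e - f) + a * b * (c * e + f)) = a * c * (b * e) by field.
exact: aux.
Qed.

(** Closing the trigonometric functions of the members of [G] under linear
    combinations and bounded pointwise limits gives an algebra, as products of
    cosines are sums of cosines. *)
Inductive trig_closure (G : set (T -> R)) : (T -> R) -> Prop :=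
| trig_cos X p : G X -> trig_closure G (fun w => cos (X w + p))
| trig_lin a f g : trig_closure G f -> trig_closure G g ->
    trig_closure G (fun w => a * f w + g w)
| trig_lim (u : nat -> T -> R) C f : (forall n, trig_closure G (u n)) ->
    (forall n w, `|u n w| <= C) -> (forall w, u ^~ w @ \oo --> f w) ->
    trig_closure G f.

Lemma trig_closure_bounded G f : trig_closure G f ->
  exists C, forall w, `|f w| <= C.
Proof.
elim=> [X p _|a {}f g _ [C fC] _ [C' gC']|u C {}f _ _ uC uf].
- by exists 1 => w; exact: cos_max.
- exists (`|a| * C + C') => w; rewrite (le_trans (ler_normD _ _))// normrM.
  by rewrite lerD// ler_wpM2l.
- exists C => w; apply: (cvgr_to_le (cvg_norm (uf w))).
  by apply: nearW => n; exact: uC.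
Qed.

Lemma trig_closure_meas G f : G `<=` H -> trig_closure G f ->
  measurable_fun [set: T] f.
Proof.
move=> GH; elim=> [X p GX|a {}f g _ mf _ mg|u C {}f _ mu uC uf].
- apply: measurableT_comp.
    by apply: continuous_measurable_fun; exact: continuous_cos.
  by apply: measurable_funD => //; apply: gs_meas; exact: GH.
- by apply: measurable_funD => //; exact: measurable_funM.
- by apply: (measurable_fun_cvg (h := u)) => // w _; exact: uf.
Qed.

Lemma trig_closure_integ G f : G `<=` H -> trig_closure G f -> integ P f.
Proof.
move=> GH cf; have [C fC] := trig_closure_bounded cf.
by apply: integ_bounded fC; exact: trig_closure_meas cf.
Qed.

Lemma trig_closureM G f g :
  (forall X Y, G X -> G Y -> G (fun w => X w + Y w)) ->
  (forall X Y, G X -> G Y -> G (fun w => X w - Y w)) ->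
  trig_closure G f -> trig_closure G g -> trig_closure G (fun w => f w * g w).
Proof.
move=> GD GB cf; elim: cf g => {f}.
- move=> X p GX g; elim=> {g}.
  + move=> Y q GY.
    rewrite (_ : (fun w => _) = (fun w => 2^-1 * cos (X w + Y w + (p + q)) +
       (2^-1 * cos (X w - Y w + (p - q)) + 0 * cos (X w + p)))); last first.
      apply/funext => w.
      have -> : X w + Y w + (p + q) = (X w + p) + (Y w + q) by ring.
      have -> : X w - Y w + (p - q) = (X w + p) - (Y w + q) by ring.
      by rewrite cosM_sum; ring.
    apply: trig_lin; first by apply: trig_cos; exact: GD.
    rewrite (_ : (fun w => _) = (fun w => 2^-1 * cos (X w - Y w + (p - q)) +
       (-1 * cos (X w + p) + cos (X w + p)))); last first.
      by apply/funext => w; ring.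
    apply: trig_lin; first by apply: trig_cos; exact: GB.
    by apply: trig_lin; exact: trig_cos.
  + move=> a f g _ cf _ cg.
    rewrite (_ : (fun w => _) = (fun w => a * (cos (X w + p) * f w) +
      cos (X w + p) * g w)); first exact: trig_lin.
    by apply/funext => w; ring.
  + move=> u C f _ cu uC uf; apply: (@trig_lim _ _ C _ cu) => w.
      by move=> w'; rewrite normrM -[leRHS]mul1r ler_pM// ?cos_max//.
    by apply: cvgM; [exact: cvg_cst|exact: uf].
- move=> a f g cf hf cg hg h ch.
  rewrite (_ : (fun w => _) = (fun w => a * (f w * h w) + g w * h w)).
    by apply: trig_lin; [exact: hf|exact: hg].
  by apply/funext => w; ring.
- move=> u C f cu hu uC uf g cg; have [C' gC'] := trig_closure_bounded cg.
  apply: (@trig_lim _ _ (C * C') _ (fun n => hu n _ cg)) => [n w|w].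
    by rewrite normrM ler_pM.
  by apply: cvgM; [exact: uf|exact: cvg_cst].
Qed.

(** Extending [gs_mean_cosM] by linearity and dominated convergence: orthogonal
    sets of Gaussian variables are independent. *)
Lemma trig_closure_mean G G' f g : G `<=` H -> G' `<=` H ->
  (forall X Y, G X -> G' Y -> cov X Y = 0) ->
  trig_closure G f -> trig_closure G' g ->
  mean P (fun w => f w * g w) = mean P f * mean P g.
Proof.
move=> GH GH' ort cf cg; elim: cf => {f}.
- move=> X p GX; have cX : trig_closure G (fun w => cos (X w + p)) by exact: trig_cos.
  have IX := trig_closure_integ GH cX; have mX := integ_meas IX.
  elim: cg => {g}.
  + by move=> Y q GY; apply: gs_mean_cosM; [exact: GH|exact: GH'|exact: ort].
  + move=> a f g cf hf cg hg.
    have If := trig_closure_integ GH' cf; have Ig := trig_closure_integ GH' cg.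
    have IM h : trig_closure G' h -> integ P (fun w => cos (X w + p) * h w).
      move=> ch; have [C hC] := trig_closure_bounded ch.
      apply: (@integ_bounded _ _ _ _ _ C) => [|w].
        by apply: measurable_funM => //; exact: trig_closure_meas ch.
      by rewrite normrM -[leRHS]mul1r ler_pM// cos_max.
    rewrite (_ : (fun w => _) = (fun w => a * (cos (X w + p) * f w) +
      cos (X w + p) * g w)); last by apply/funext => w; ring.
    by rewrite !mean_lin ?hf ?hg//; [ring|exact: IM..].
  + move=> u C f cu hu uC uf.
    have h1 : mean P (fun w => cos (X w + p) * u n w) @[n --> \oo] -->
        mean P (fun w => cos (X w + p) * f w).
      apply: (@mean_cvg _ _ _ P (fun n w => cos (X w + p) * u n w) C).
      * by move=> n; apply: measurable_funM => //; exact: trig_closure_meas (cu n).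
      * by move=> n w; rewrite normrM -[leRHS]mul1r ler_pM// cos_max.
      * by move=> w; apply: cvgM; [exact: cvg_cst|exact: uf].
    have h2 : mean P (fun w => cos (X w + p)) * mean P (u n) @[n --> \oo] -->
        mean P (fun w => cos (X w + p)) * mean P f.
      apply: cvgM; first exact: cvg_cst.
      by apply: (mean_cvg _ uC uf) => n; exact: trig_closure_meas (cu n).
    by move: h1; rewrite (funext hu) => h1; exact: (cvg_unique _ h1 h2).
- move=> a f f' cf hf cf' hf'.
  have If := trig_closure_integ GH cf; have If' := trig_closure_integ GH cf'.
  have IM h : trig_closure G h -> integ P (fun w => h w * g w).
    move=> ch; have [C hC] := trig_closure_bounded ch.
    have [C' gC'] := trig_closure_bounded cg.
    apply: (@integ_bounded _ _ _ _ _ (C * C')) => [|w].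
      by apply: measurable_funM; [exact: trig_closure_meas ch|exact: trig_closure_meas cg].
    by rewrite normrM ler_pM.
  rewrite (_ : (fun w => _) = (fun w => a * (f w * g w) + f' w * g w)); last first.
    by apply/funext => w; ring.
  by rewrite !mean_lin ?hf ?hf'//; [ring|exact: IM..].
- move=> u C f cu hu uC uf; have [C' gC'] := trig_closure_bounded cg.
  have h1 : mean P (fun w => u n w * g w) @[n --> \oo] -->
      mean P (fun w => f w * g w).
    apply: (@mean_cvg _ _ _ P (fun n w => u n w * g w) (C * C')).
    * by move=> n; apply: measurable_funM;
        [exact: trig_closure_meas (cu n)|exact: trig_closure_meas cg].
    * by move=> n w; rewrite normrM ler_pM.
    * by move=> w; apply: cvgM; [exact: uf|exact: cvg_cst].
  have h2 : mean P (u n) * mean P g @[n --> \oo] --> mean P f * mean P g.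
    apply: cvgM; last exact: cvg_cst.
    by apply: (mean_cvg _ uC uf) => n; exact: trig_closure_meas (cu n).
  by move: h1; rewrite (funext hu) => h1; exact: (cvg_unique _ h1 h2).
Qed.

End gaussian_space.

(** * Indicators as limits of trigonometric polynomials *)

Section indicators.
Context {R : realType}.

Lemma bernoulli_ge (y : R) n : -1 <= y -> 1 + n%:R * y <= (1 + y) ^+ n.
Proof.
move=> y1; elim: n => [|n IH]; first by rewrite mul0r addr0 expr0.
rewrite exprS; have y10 : 0 <= 1 + y by lra.
apply: le_trans (ler_wpM2l y10 IH).
rewrite -natr1; have n0 : 0 <= n%:R :> R by []; nra.
Qed.

(** Polynomials converging on [[0, 1]] to the indicator of [[0, 1/2]]. *)
Definition poly_step (k : nat) (x : R) := (1 - x ^+ (k.+1).*2 / k.+1%:R) ^+ (4 ^ k.+1).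

Let ratio k (x : R) : 0 <= x <= 1 -> 0 <= x ^+ (k.+1).*2 / k.+1%:R <= 1.
Proof.
move=> /andP[x0 x1]; rewrite divr_ge0 ?exprn_ge0//= ler_pdivrMr ?ltr0n// mul1r.
by rewrite (le_trans (exprn_ile1 _ x0 x1))// ler1n.
Qed.

Lemma poly_step_itv k (x : R) : 0 <= x <= 1 -> 0 <= poly_step k x <= 1.
Proof.
move=> /(ratio k) /andP[r0 r1].
by rewrite /poly_step exprn_ge0 ?exprn_ile1 ?subr_ge0// lerBlDr lerDl.
Qed.

(** With [y = x ^ (2 k) / k] and [N = 4 ^ k], the inequality of Bernoulli gives
    [(1 - y) ^ N >= 1 - N y] and [(1 - y) ^ N <= 1 / (1 + y) ^ N <= 1 / (N y)],
    where [N y = (2 x) ^ (2 k) / k] is at most [1 / k] for [x <= 1 / 2], and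
    tends to infinity for [x > 1 / 2]. *)
Lemma cvg_poly_step (x : R) : 0 <= x <= 1 ->
  poly_step k x @[k --> \oo] --> ((x <= 2^-1)%R%:R : R).
Proof.
move=> x01; have /andP[x0 x1] := x01.
have h4 k : (4 : R) ^+ k = 2 ^+ k.*2.
  by rewrite -muln2 mulnC exprM; congr (_ ^+ _); ring.
have [xh|xh] := leP x 2^-1.
  have lb k : 1 - harmonic k <= poly_step k x.
    have /andP[r0 r1] := ratio k x01.
    have := @bernoulli_ge (- (x ^+ (k.+1).*2 / k.+1%:R)) (4 ^ k.+1).
    rewrite lerN2 => /(_ r1); apply: le_trans.
    rewrite mulrN lerD2l lerN2 /harmonic/= mulrA ler_pdivrMr ?ltr0n// mulVf//.
    rewrite natrX h4 -exprMn exprn_ile1//.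
    - by rewrite mulr_ge0.
    - by move: xh; lra.
  have h1 : (1 - harmonic k : R) @[k --> \oo] --> (1 : R).
    rewrite -[X in _ --> X]subr0; apply: cvgB; first exact: cvg_cst.
    exact: cvg_harmonic.
  apply: squeeze_cvgr h1 (cvg_cst (1 : R)); apply: nearW => k.
  by rewrite lb /=; have /andP[] := poly_step_itv k x01.
pose r := 2 * x - 1; have r0 : 0 < r by rewrite /r; move: xh; lra.
have ub k : poly_step k x <= (r ^+ 2)^-1 * harmonic k.
  have /andP[y0 y1] := ratio k x01.
  set y := x ^+ (k.+1).*2 / k.+1%:R in y0 y1.
  have Ny : k.+1%:R * r ^+ 2 <= (4 ^ k.+1)%:R * y.
    rewrite /y mulrA ler_pdivlMr ?ltr0n// natrX h4 -exprMn.
    have -> : 2 * x = 1 + r by rewrite /r; ring.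
    rewrite -muln2 exprM.
    have -> : k.+1%:R * r ^+ 2 * k.+1%:R = (k.+1%:R * r) ^+ 2 by ring.
    rewrite ler_sqr ?nnegrE; last 2 first.
    - by rewrite mulr_ge0// ltW.
    - by rewrite exprn_ge0//; lra.
    apply: le_trans (@bernoulli_ge r k.+1 _); last by lra.
    by rewrite lerDr.
  have p : poly_step k x * (k.+1%:R * r ^+ 2) <= 1.
    have /andP[s0 s1] := poly_step_itv k x01.
    apply: (@le_trans _ _ (poly_step k x * (1 + y) ^+ (4 ^ k.+1))).
      rewrite ler_wpM2l// (le_trans Ny)//.
      apply: le_trans (@bernoulli_ge y _ _); last by lra.
      by rewrite lerDr.
    rewrite /poly_step -/y -exprMn exprn_ile1//; nra.
  rewrite /harmonic/= -invfM -[leRHS]mul1r ler_pdivlMr.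
    by rewrite [r ^+ 2 * _]mulrC.
  by rewrite mulr_gt0 ?exprn_gt0.
have h0 : ((r ^+ 2)^-1 * harmonic k : R) @[k --> \oo] --> (0 : R).
  rewrite -[X in _ --> X](mulr0 (r ^+ 2)^-1); apply: cvgM; first exact: cvg_cst.
  exact: cvg_harmonic.
apply: squeeze_cvgr (cvg_cst (0 : R)) h0; apply: nearW => k.
by rewrite ub /=; have /andP[->] := poly_step_itv k x01.
Qed.

End indicators.

Section trig_closure_indicator.
Context d (T : measurableType d) (R : realType) (G : set (T -> R)).
Hypothesis Glin : forall a X Y, G X -> G Y -> G (fun w => a * X w + Y w).

Let GZ a X : G X -> G (fun w => a * X w).
Proof.
move=> GX; have := Glin (a - 1) GX GX.
by under eq_fun do rewrite mulrBl mul1r subrK.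
Qed.

Let GD X Y : G X -> G Y -> G (fun w => X w + Y w).
Proof. by move=> GX GY; have := Glin 1 GX GY; under eq_fun do rewrite mul1r. Qed.

Let GB X Y : G X -> G Y -> G (fun w => X w - Y w).
Proof.
move=> GX GY; have := Glin (-1) GY GX.
by under eq_fun do rewrite mulN1r addrC.
Qed.

Lemma trig_closureMG f g : trig_closure G f -> trig_closure G g ->
  trig_closure G (fun w => f w * g w).
Proof. exact: trig_closureM. Qed.

Variables (X0 : T -> R) (GX0 : G X0).

Lemma trig_closure_cst c : trig_closure G (fun=> c).
Proof.
have one : trig_closure G (fun=> 1).
  have := trig_cos 0 (GZ 0 GX0).
  by under eq_fun do rewrite mul0r addr0 cos0.
have := trig_lin (c - 1) one one.
by under eq_fun do rewrite mulr1 subrK.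
Qed.

Lemma trig_closureX f n : trig_closure G f -> trig_closure G (fun w => f w ^+ n).
Proof.
move=> cf; elim: n => [|n IH].
  by under eq_fun do rewrite expr0; exact: trig_closure_cst.
by under eq_fun do rewrite exprS; exact: trig_closureMG.
Qed.

Lemma trig_closure_prod (I : Type) (s : seq I) (f : I -> T -> R) :
  (forall i, trig_closure G (f i)) ->
  trig_closure G (fun w => \prod_(i <- s) f i w).
Proof.
move=> cf; elim: s => [|i s IH].
  by under eq_fun do rewrite big_nil; exact: trig_closure_cst.
by under eq_fun do rewrite big_cons; exact: trig_closureMG.
Qed.

(** The affine map [u |-> 1 / 2 + (c - u) / 4] sends [[- 1, 1]] into [[0, 1]] and
    the threshold [c] to the threshold [1 / 2] of [poly_step]. *)
Lemma trig_closure_poly_step k f c : trig_closure G f ->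
  trig_closure G (fun w => poly_step k (2^-1 + (c - f w) / 4)).
Proof.
move=> cf; rewrite /poly_step; apply: trig_closureX.
set p := (k.+1).*2.
have cg : trig_closure G (fun w => 2^-1 + (c - f w) / 4).
  have := trig_lin (- 4^-1) cf (trig_closure_cst (2^-1 + c / 4)).
  rewrite (_ : (fun w => _) = (fun w => 2^-1 + (c - f w) / 4))//.
  by apply/funext => w; field.
have := trig_lin (- k.+1%:R^-1) (trig_closureX p cg) (trig_closure_cst 1).
rewrite (_ : (fun w => _) = (fun w => 1 - (2^-1 + (c - f w) / 4) ^+ p / k.+1%:R))//.
by apply/funext => w; rewrite addrC mulNr [_^-1 * _]mulrC.
Qed.

Lemma trig_closure_threshold f c : trig_closure G f -> (forall w, `|f w| <= 1) ->
  `|c| <= 1 -> trig_closure G (fun w => (c <= f w)%R%:R).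
Proof.
move=> cf f1 c1.
have itv w : 0 <= 2^-1 + (c - f w) / 4 <= 1.
  by have := f1 w; move: c1; rewrite !ler_norml => /andP[? ?] /andP[? ?]; lra.
apply: (@trig_lim _ _ _ _ (fun k w => poly_step k (2^-1 + (c - f w) / 4)) 1).
- by move=> k; exact: trig_closure_poly_step.
- by move=> k w; have /andP[? ?] := poly_step_itv k (itv w); rewrite ger0_norm.
- move=> w; rewrite (_ : (c <= f w) = (2^-1 + (c - f w) / 4 <= 2^-1)).
    exact: cvg_poly_step.
  by apply/idP/idP; lra.
Qed.

(** Thresholds of bounded functions suffice: as [sin] increases on
    [[- pi / 2, pi / 2]], comparing [X w] with [a] amounts to comparing the sines
    of [X w / k] and [a / k], for [k] large. *)
Lemma trig_closure_ge X a : G X -> trig_closure G (fun w => (a <= X w)%R%:R).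
Proof.
move=> GX.
pose u k w : R := (sin (a / k.+1%:R) <= sin (X w / k.+1%:R))%R%:R.
apply: (@trig_lim _ _ _ _ u 1).
- move=> k; apply: trig_closure_threshold.
  + rewrite (_ : (fun w => _) = (fun w => cos (k.+1%:R^-1 * X w + - (pi / 2)))).
      by apply: trig_cos; exact: GZ.
    by apply/funext => w; rewrite cosBpihalf mulrC.
  + by move=> w; exact: sin_max.
  + exact: sin_max.
- by move=> k w; rewrite /u; case: (sin _ <= _); rewrite ?normr1 ?normr0.
- move=> w; apply: cvg_near_cst.
  have small (b : R) : \forall k \near \oo, b / k.+1%:R \in `[- (pi / 2), pi / 2].
    near=> k; rewrite in_itv/= -ler_norml normrM normfV [`|_.+1%:R|]ger0_norm//.
    rewrite ler_pdivrMr ?ltr0n// mulrC -ler_pdivrMr ?divr_gt0 ?pi_gt0//.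
    rewrite (@le_trans _ _ k%:R) ?ler_nat//.
    by near: k; exact: nbhs_infty_ger.
  near=> k; rewrite /u !leNgt ltr_sin.
  + by rewrite ltr_pM2r// invr_gt0.
  + by near: k; exact: small.
  + by near: k; exact: small.
Unshelve. all: by end_near. Qed.

End trig_closure_indicator.

(** * Shifting a Gaussian vector *)

Section bool_indicators.
Context d (T : measurableType d) (R : realType) (P : probability T R).

Lemma bool_indicE (b : T -> bool) :
  (fun w => (b w)%:R) = \1_[set w | b w] :> (T -> R).
Proof.
apply/funext => w; rewrite indicE; congr (nat_of_bool _)%:R.
by apply/idP/idP; rewrite inE.
Qed.

Lemma integ_bool (b : T -> bool) : measurable [set w | b w] ->
  integ P (fun w => (b w)%:R).
Proof.
move=> mb; apply: (@integ_bounded _ _ _ _ _ 1) => [|w].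
  by rewrite bool_indicE; exact: measurable_indic.
by case: (b w); rewrite ?normr1 ?normr0.
Qed.

Lemma mean_bool (b : T -> bool) : measurable [set w | b w] ->
  ((mean P (fun w => (b w)%:R))%:E = P [set w | b w])%E.
Proof. by move=> mb; rewrite bool_indicE mean_indic. Qed.

Lemma measurable_ge (f : T -> R) y : measurable_fun [set: T] f ->
  measurable [set w | y <= f w].
Proof.
move=> mf; have := mf measurableT `[y, +oo[%classic (measurable_itv _).
rewrite setTI; congr measurable; apply/seteqP.
by split => w /=; rewrite in_itv/= andbT.
Qed.

Lemma measurable_all_ge (I : finType) (Y : I -> T -> R) y :
  (forall i, measurable_fun [set: T] (Y i)) ->
  measurable [set w | [forall i, y <= Y i w]].
Proof.
move=> mY.
rewrite (_ : [set w | _] = \bigcap_(i in [set: I]) [set w | y <= Y i w]).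
  by apply: fin_bigcap_measurable => // i _; exact: measurable_ge.
apply/seteqP; split => w /=; first by move=> /forallP h i _; exact: h.
by move=> h; apply/forallP => i; exact: h.
Qed.

End bool_indicators.

Section gaussian_shift.
Context d (T : measurableType d) (R : realType) (P : probability T R).
Variables (H : set (T -> R)) (gsH : gaussian_space P H).

(** The exponential Markov inequality, in which [theta] is left free. *)
Lemma normal_law_tail X s (theta y : R) : normal_law P X 0 s -> 0 <= theta ->
  mean P (fun w => (y <= `|X w|)%R%:R) <=
  expR (- theta * y) * (2 * expR ((theta * s) ^+ 2 / 2)).
Proof.
move=> law t0; have [mX _ _] := law.
have [I1 E1] := normal_law_expR theta law.
have [I2 E2] := normal_law_expR (- theta) law.
have -> : expR (- theta * y) * (2 * expR ((theta * s) ^+ 2 / 2)) =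
    mean P (fun w => expR (- theta * y) * (expR (theta * X w) + expR (- theta * X w))).
  rewrite meanZ; last exact: integD.
  rewrite meanD// E1 E2; congr (_ * _).
  by rewrite mulNr sqrrN; ring.
apply: le_mean.
- apply: integ_bool; apply: measurable_ge.
  exact: measurableT_comp.
- by apply: integZ; exact: integD.
- move=> w; have [yX|_] := leP y `|X w|; last first.
    by rewrite mulr_ge0 ?expR_ge0// addr_ge0 ?expR_ge0.
  rewrite mulrDr -!expRD.
  have [X0|X0] := leP 0 (X w).
    rewrite ger0_norm// in yX.
    apply: (@le_trans _ _ (expR (- theta * y + theta * X w))).
      by rewrite -[leLHS]expR0 ler_expR; nra.
    by rewrite lerDl expR_ge0.
  rewrite ltr0_norm// in yX.
  apply: (@le_trans _ _ (expR (- theta * y + - theta * X w))).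
    by rewrite -[leLHS]expR0 ler_expR; nra.
  by rewrite lerDr expR_ge0.
Qed.

Variables (Z : T -> R) (HZ : H Z) (varZ : cov P Z Z = 1).

Let GZ : set (T -> R) := [set X | exists a, X = (fun w => a * Z w)].
Let GW : set (T -> R) := [set X | H X /\ cov P X Z = 0].

Let GZH : GZ `<=` H.
Proof. by move=> _ [a ->]; exact: gsZ gsH _ _ HZ. Qed.

Let GWH : GW `<=` H. Proof. by move=> X []. Qed.

Let GZlin a X Y : GZ X -> GZ Y -> GZ (fun w => a * X w + Y w).
Proof.
move=> [b ->] [c ->]; exists (a * b + c).
by apply/funext => w; ring.
Qed.

Let GWlin a X Y : GW X -> GW Y -> GW (fun w => a * X w + Y w).
Proof.
move=> [HX X0] [HY Y0]; split; first exact: gs_lin gsH a _ _ HX HY.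
by rewrite (cov_linl gsH)// X0 Y0 mulr0 addr0.
Qed.

Let GZGW X Y : GZ X -> GW Y -> cov P X Y = 0.
Proof.
by move=> [a ->] [HY Y0]; rewrite (covZl gsH)// covC Y0 mulr0.
Qed.

Let GZZ : GZ Z. Proof. by exists 1; apply/funext => w; rewrite mul1r. Qed.

(* the indicator of [k <= Z w < k + 1], as a member of the closure of [GZ] *)
Let cell (k : R) w : R := (k <= Z w)%R%:R - (k + 1 <= Z w)%R%:R.

Let lawZ : normal_law P Z 0 1.
Proof. by have := gs_sd_law gsH HZ; rewrite varZ sqrtr1. Qed.

Let cellE k : cell k = \1_(Z @^-1` `[k, k + 1[) :> (T -> R).
Proof.
apply/funext => w; rewrite indicE /cell.
rewrite (_ : (w \in _) = (k <= Z w) && ~~ (k + 1 <= Z w)).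
  case: (leP (k + 1) (Z w)) => [h|_]; last by rewrite subr0 andbT.
  by rewrite andbF (le_trans _ h) ?subrr// lerDl.
by rewrite -ltNge; apply/idP/idP; rewrite inE /preimage/= in_itv.
Qed.

Let mean_cell (k : R) (K : nat) : k <= K%:R ->
  mean P (cell k) <= expR (3 * K%:R + 6) * mean P (cell (k + 2)).
Proof.
move=> kK; have [mZ _ law] := lawZ.
have mcell (l : R) : measurable (Z @^-1` `[l, l + 1[).
  by rewrite -[X in measurable X]setTI; exact: mZ.
rewrite !cellE -lee_fin EFinM !mean_indic//.
rewrite !law// oner_eq0 (_ : k + 2 + 1 = k + 3); last by ring.
exact: stdn_cell.
Qed.

Variables (I : finType) (Y : I -> T -> R) (rho : R).
Hypotheses (HY : forall i, H (Y i)) (rho0 : 0 < rho)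
  (covY : forall i, rho <= cov P (Y i) Z).

Let c i := cov P (Y i) Z.
(* [Y i - c i * Z] is the part of [Y i] that is independent of [Z]; [tail k] is
   necessary for [- rho / 2 <= Y i] if [Z < k + 1], and sufficient for
   [rho / 2 <= Y i] if [k + 2 <= Z] *)
Let tail (k : R) w : R :=
  \prod_i ((- (rho / 2) - c i * (k + 1) <= Y i w - c i * Z w)%R%:R).

Let HW i : GW (fun w => Y i w - c i * Z w).
Proof.
have HcZ : H (fun w => c i * Z w) by exact: gsZ gsH _ _ HZ.
split; first exact: gsB gsH _ _ (HY i) HcZ.
by rewrite (covBl gsH)// (covZl gsH)// varZ mulr1 subrr.
Qed.

Let GW0 : GW (fun w => 0 * Z w).
Proof.
by split; [exact: gsZ gsH _ _ HZ|rewrite (covZl gsH)// mul0r].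
Qed.

Let trig_cell k : trig_closure GZ (cell k).
Proof.
have := trig_lin (-1) (trig_closure_ge GZlin GZZ (k + 1) GZZ)
  (trig_closure_ge GZlin GZZ k GZZ).
by rewrite (_ : (fun w => _) = cell k)//; apply/funext => w; rewrite mulN1r addrC.
Qed.

Let trig_tail k : trig_closure GW (tail k).
Proof.
apply: (trig_closure_prod GWlin GW0) => i.
exact: (trig_closure_ge GWlin GW0 _ (HW i)).
Qed.

Let mean_cell_tail k l :
  mean P (fun w => cell k w * tail l w) = mean P (cell k) * mean P (tail l).
Proof. exact: (trig_closure_mean gsH GZH GWH GZGW (trig_cell k) (trig_tail l)). Qed.

Let sum_cell (a : R) N w : \sum_(j < N) cell (a + j%:R) w =
  (a <= Z w)%R%:R - (a + N%:R <= Z w)%R%:R.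
Proof.
elim: N => [|N IH]; first by rewrite big_ord0 addr0 subrr.
rewrite big_ord_recr/= IH /cell (_ : a + N%:R + 1 = a + N.+1%:R); first by ring.
by rewrite -natr1 addrA.
Qed.

Let cell01 k w : cell k w = 0 \/ cell k w = 1 /\ k <= Z w < k + 1.
Proof.
rewrite /cell; case: (leP (k + 1) (Z w)) => [h|h].
  by left; rewrite (le_trans _ h) ?subrr// lerDl.
by case: (leP k (Z w)) => [h'|h']; [right|left]; rewrite subr0.
Qed.

Let tail01 k w : tail k w = 0 \/
  tail k w = 1 /\ forall i, - (rho / 2) - c i * (k + 1) <= Y i w - c i * Z w.
Proof.
have [h|] := boolP [forall i, - (rho / 2) - c i * (k + 1) <= Y i w - c i * Z w].
  right; split; last exact/forallP.
  by rewrite /tail big1// => i _; rewrite (forallP h).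
rewrite negb_forall => /existsP[i hi]; left; rewrite /tail.
by rewrite (bigD1 i)//= (negbTE hi) mul0r.
Qed.

(** Moving the Gaussian vector [Y] by its covariances with [Z] turns the event
    that no [Y i] is below [- rho / 2] into the event that all are above
    [rho / 2].  Conditionally on [Y - c Z], which is independent of [Z], both
    events say that [Z] is large, with thresholds differing by at most [1], and
    the density of [Z] does not vary much over such distances. *)
Lemma gaussian_shift (K : nat) :
  mean P (fun w => [forall i, - (rho / 2) <= Y i w]%:R) <=
  mean P (fun w => (K%:R <= `|Z w|)%R%:R) +
  expR (3 * K%:R + 6) * mean P (fun w => [forall i, rho / 2 <= Y i w]%:R).
Proof.
have mY i : measurable_fun [set: T] (Y i) by exact: gs_meas gsH _ (HY i).
have mZ : measurable_fun [set: T] Z by exact: gs_meas gsH _ HZ.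
pose k j : R := - K%:R + j%:R.
pose S w := \sum_(j < (K + K)%N) cell (k j) w * tail (k j) w.
have Icell l l' : integ P (fun w => cell l w * tail l' w).
  apply: (@integ_bounded _ _ _ _ _ 1) => [|w].
    apply: measurable_funM.
      exact: (trig_closure_meas gsH GZH (trig_cell l)).
    exact: (trig_closure_meas gsH GWH (trig_tail l')).
  case: (cell01 l w) => [->|[-> _]]; first by rewrite mul0r normr0.
  by case: (tail01 l' w) => [->|[-> _]]; rewrite ?mulr1 ?mulr0 ?normr0 ?normr1.
have IS (s : seq nat) (a b : nat -> R) :
    integ P (fun w => \sum_(j <- s) cell (a j) w * tail (b j) w) /\
    mean P (fun w => \sum_(j <- s) cell (a j) w * tail (b j) w) =
    \sum_(j <- s) mean P (cell (a j)) * mean P (tail (b j)).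
  elim: s => [|j s [IHi IHm]].
    under eq_fun do rewrite big_nil; rewrite big_nil mean_cst.
    by split => //; exact: integ_cst.
  under eq_fun do rewrite big_cons; rewrite big_cons meanD// IHm.
  by rewrite mean_cell_tail; split => //; exact: integD.
have ISo := IS (index_iota 0 (K + K)) k k.
have ISs := IS (index_iota 0 (K + K)) (fun j => k j + 2) k.
have IF y : integ P (fun w => [forall i, y <= Y i w]%:R).
  by apply: integ_bool; exact: measurable_all_ge.
have Itail : integ P (fun w => (K%:R <= `|Z w|)%R%:R).
  by apply: integ_bool; apply: measurable_ge; exact: measurableT_comp.
apply: (@le_trans _ _ (mean P (fun w => (K%:R <= `|Z w|)%R%:R +
    \sum_(0 <= j < K + K) cell (k j) w * tail (k j) w))).
  apply: le_mean => //; first by apply: integD => //; exact: (proj1 ISo).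
  move=> w; have [/forallP h|_] := boolP [forall i, - (rho / 2) <= Y i w]; last first.
    rewrite addr_ge0 ?ler0n// sumr_ge0// => j _.
    case: (cell01 (k j) w) => [->|[-> _]]; first by rewrite mul0r.
    by case: (tail01 (k j) w) => [->|[-> _]]; rewrite ?mulr1 ?mulr0.
  have -> : \sum_(0 <= j < K + K) cell (k j) w * tail (k j) w =
      \sum_(j < (K + K)%N) cell (- K%:R + j%:R) w.
    rewrite big_mkord; apply: eq_bigr => j _ /=; rewrite -/(k j).
    case: (cell01 (k j) w) => [->|[-> /andP[_ hk]]]; first by rewrite mul0r.
    case: (tail01 (k j) w) => [|[-> _]]; last by rewrite mulr1.
    move=> t0; have : tail (k j) w = 1.
      rewrite /tail big1// => i _.
      have ci0 : 0 < c i by exact: lt_le_trans (covY i).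
      have hi := h i.
      by rewrite (_ : (_ <= _) = true)//; nra.
    by move->; rewrite mulr1.
  rewrite sum_cell (_ : - K%:R + (K + K)%:R = K%:R); last by rewrite natrD; ring.
  have [//|KZ] := leP K%:R `|Z w|.
    rewrite lerDl subr_ge0 ler_nat; case: (leP K%:R (Z w)) => // KZw.
    rewrite (_ : (- K%:R <= Z w) = true)//; apply/idP.
    by apply: le_trans KZw; apply: (@le_trans _ _ 0); rewrite ?oppr_le0.
  by move: KZ; rewrite ltr_norml => /andP[h1 h2]; rewrite (ltW h1) [K%:R <= Z w]leNgt h2/= subr0 add0r.
rewrite meanD//; last exact: (proj1 ISo).
rewrite lerD2l (proj2 ISo).
apply: (@le_trans _ _ (expR (3 * K%:R + 6) *
    mean P (fun w => \sum_(0 <= j < K + K) cell (k j + 2) w * tail (k j) w))).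
  rewrite (proj2 ISs) mulr_sumr; apply: ler_sum_nat => j /andP[_ jK].
  rewrite mulrA ler_wpM2r//.
    apply: Rintegral_ge0 => w _.
    by case: (tail01 (k j) w) => [->|[-> _]].
  by apply: mean_cell; rewrite /k addrC lerBlDr -natrD ler_nat ltnW.
rewrite ler_wpM2l ?expR_ge0//; apply: le_mean => //; first exact: (proj1 ISs).
move=> w.
have [F|F] := boolP [forall i, rho / 2 <= Y i w].
  apply: (@le_trans _ _ (\sum_(j < (K + K)%N) cell (- K%:R + 2 + j%:R) w)).
    rewrite big_mkord; apply: ler_sum => j _.
    rewrite /k addrAC.
    case: (cell01 (- K%:R + 2 + j%:R) w) => [->|[-> _]]; first by rewrite mul0r.
    by case: (tail01 (- K%:R + j%:R) w) => [->|[-> _]]; rewrite ?mulr1 ?mulr0.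
  have le1 (b b' : bool) : b%:R - b'%:R <= 1 :> R by case: b; case: b' => /=; lra.
  by rewrite sum_cell; exact: le1.
rewrite big1// => j _.
case: (cell01 (k j + 2) w) => [->|[-> /andP[hk _]]]; first by rewrite mul0r.
case: (tail01 (k j) w) => [->|[_ ht]]; first by rewrite mulr0.
case/negP: F; apply/forallP => i; have := ht i.
have ci : rho <= c i by exact: covY.
have c0 : 0 <= c i by rewrite (le_trans (ltW rho0)).
have : 0 <= c i * (Z w - (k j + 2)) by rewrite mulr_ge0// subr_ge0.
by move: (k j) (c i) (Z w) (Y i w) ci => k' c' z y ci; lra.
Qed.

End gaussian_shift.

(** * Fractional Brownian motion as a Gaussian space *)

Section fbm_gaussian.
Context d (T : measurableType d) (R : realType) (P : probability T R).
Variables (alpha : R) (halpha : 0 < alpha < 1) (B : R -> {RV P >-> R}).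
Hypothesis hB : fractional_brownian_motion `[0, 1] alpha B.

Lemma normal_law_integ X m s : normal_law P X m s -> integ P X /\ mean P X = m.
Proof.
move=> law; have [I0 E0] := normal_law_sqr 0 law.
have [I1 E1] := normal_law_sqr 1 law.
have XE : X = (fun w => 2^-1 * (1 + X w) ^+ 2 + (- 2^-1 * (0 + X w) ^+ 2 + (- 2^-1))).
  by apply/funext => w; field.
have I2 : integ P (fun w => - 2^-1 * (0 + X w) ^+ 2 + (- 2^-1)).
  by apply: integ_lin => //; exact: integ_cst.
rewrite XE; split; first exact: integ_lin.
rewrite mean_lin// E1 mean_lin ?E0 ?mean_cst//; last exact: integ_cst.
by field.
Qed.

Lemma normal_lawZ0 (X : T -> R) a : measurable_fun [set: T] X -> a != 0 ->
  normal_law P (fun w => a * X w) 0 1 ->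
  mean P X = 0 /\ mean P (fun w => X w * X w) = a ^- 2 * normal_var.
Proof.
move=> mX a0 law.
have [I E] := normal_law_integ law.
have XE : X = (fun w => a^-1 * (a * X w)).
  by apply/funext => w; rewrite mulrA mulVf ?mul1r.
split; first by rewrite XE meanZ// E mulr0.
have [I2] := normal_law_sqr 0 law.
rewrite !addr0 expr0n add0r expr1n mulr1 => E2.
rewrite (_ : (fun w => X w * X w) = (fun w => a ^- 2 * (0 + a * X w) ^+ 2)).
  by rewrite meanZ// E2.
by apply/funext => w; rewrite add0r; field.
Qed.

Definition unit_itv : set R := `[0, 1]%classic.

Lemma mean_ae_eq (f g : T -> R) : measurable_fun [set: T] f ->
  measurable_fun [set: T] g -> {ae P, forall w, f w = g w} -> mean P f = mean P g.
Proof.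
move=> mf mg fg; rewrite /mean /Rintegral; congr fine.
apply: ae_eq_integral => //; try exact/measurable_EFinP.
by apply: filterS fg => w e _ /=; rewrite e.
Qed.

Let mB t : measurable_fun [set: T] (B t).
Proof. exact: measurable_funPT. Qed.

Lemma fbm_mean t : 0 <= t <= 1 -> mean P (B t) = 0 /\
  mean P (fun w => B t w * B t w) = t `^ (alpha *+ 2) * normal_var.
Proof.
move=> /andP[t0 t1].
have a0 : alpha *+ 2 != 0 by rewrite mulrn_eq0/= gt_eqF//; case/andP: halpha.
move: t0; rewrite le_eqVlt => /predU1P[<-|t0].
  have z := fbm_zero hB; split.
    rewrite (mean_ae_eq (g := cst 0)) ?mean_cst//; exact: mB.
  rewrite powR0// mul0r (mean_ae_eq (g := cst 0)) ?mean_cst//.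
    by apply: measurable_funM; exact: mB.
  by apply: filterS z => w ->; rewrite mul0r.
have law : normal_law P (fun w => t `^ (- alpha) * B t w) 0 1.
  split => //.
    by apply: measurable_funM => //; exact: mB.
  move=> A mA; rewrite oner_eq0; apply: (fbm_normal hB) => //.
  by rewrite /= in_itv/= (ltW t0).
have p0 : t `^ (- alpha) != 0 by rewrite gt_eqF// powR_gt0.
have [-> ->] := normal_lawZ0 (@mB t) p0 law; split => //.
congr (_ * _); rewrite -exprVn -powRN opprK -powR_mulrn ?powR_ge0//.
by rewrite -powRrM; congr (_ `^ _); rewrite mulr_natr.
Qed.

Definition fbm_span : set (T -> R) := [set X | exists n (t c : 'I_n -> R),
  (forall i, unit_itv (t i)) /\ X = (fun w => \sum_(i < n) c i * B (t i) w)].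

Lemma fbm_span_mean X : fbm_span X -> mean P X = 0.
Proof.
move=> [n [t [c [tu ->]]]].
have IB s : unit_itv s -> integ P (B s) /\ mean P (B s) = 0.
  rewrite /unit_itv/= in_itv/= => su; split; last by have [] := fbm_mean su.
  have su' : forall i : 'I_1, `[0, 1]%classic s by move=> _; rewrite /= in_itv.
  have [m [sg [sg0 law]]] := fbm_gaussian hB (fun=> 1) su'.
  have lB : normal_law P (B s) m sg.
    split => // A mA; have := law A mA.
    rewrite (_ : (fun w => _) = (B s : T -> R))//.
    by apply/funext => w; rewrite big_ord1 mul1r.
  by have [] := normal_law_integ lB.
suff : forall r : seq 'I_n, integ P (fun w => \sum_(i <- r) c i * B (t i) w) /\
    mean P (fun w => \sum_(i <- r) c i * B (t i) w) = 0.
  by move=> /(_ (index_enum _))[].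
elim=> [|i r [IHi IHm]].
  under eq_fun do rewrite big_nil.
  by rewrite mean_cst; split => //; exact: integ_cst.
under eq_fun do rewrite big_cons.
have [I E] := IB _ (tu i).
by rewrite mean_lin// E IHm mulr0 addr0; split => //; exact: integ_lin.
Qed.

Lemma fbm_gaussian_space : gaussian_space P fbm_span.
Proof.
split.
- move=> a _ _ [n [t [c [tu ->]]]] [m [t' [c' [tu' ->]]]].
  exists (n + m)%N, (fun i => match fintype.split i with inl j => t j | inr j => t' j end),
    (fun i => match fintype.split i with inl j => a * c j | inr j => c' j end); split.
    by move=> i; case: (fintype.split i).
  apply/funext => w; rewrite big_split_ord/= mulr_sumr; congr (_ + _).
    apply: eq_bigr => i _; have := unsplitK (inl i : 'I_n + 'I_m)%type => /= ->.
    by rewrite mulrA.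
  by apply: eq_bigr => i _; have := unsplitK (inr i : 'I_n + 'I_m)%type => /= ->.
- move=> X HX; have m0 := fbm_span_mean HX.
  case: HX m0 => n [t [c [tu ->]]] m0.
  have [m [s [s0 law]]] := fbm_gaussian hB c tu.
  have lX : normal_law P (fun w => \sum_(i < n) c i * B (t i) w) m s.
    split => //; apply: measurable_sum => i.
    by apply: measurable_funM => //; exact: mB.
  have [_ mE] := normal_law_integ lX.
  by exists s; rewrite -mE m0 in lX.
Qed.

Lemma fbm_spanB t : unit_itv t -> fbm_span (B t).
Proof.
move=> tu; exists 1%N, (fun=> t), (fun=> 1); split => //.
by apply/funext => w; rewrite big_ord1 mul1r.
Qed.

Let gs := fbm_gaussian_space.

Lemma fbm_span_incr s t : unit_itv s -> unit_itv t ->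
  fbm_span (fun w => B t w - B s w).
Proof. by move=> su tu; apply: (gsB gs); exact: fbm_spanB. Qed.

Lemma fbm_var t : unit_itv t -> cov P (B t) (B t) = t `^ (alpha *+ 2).
Proof.
rewrite /unit_itv/= in_itv/= => tu; rewrite /cov (fbm_mean tu).2 -mulrA divff ?mulr1//.
by rewrite gt_eqF// normal_var_gt0.
Qed.

(** Stationarity moves the increment to the interval [[0, t - s]]. *)
Lemma fbm_var_incr s t : 0 <= s -> s <= t -> t <= 1 ->
  cov P (fun w => B t w - B s w) (fun w => B t w - B s w) = (t - s) `^ (alpha *+ 2).
Proof.
move=> s0 st t1.
have U x : 0 <= x <= 1 -> unit_itv x by rewrite /unit_itv/= in_itv.
have us : unit_itv s by apply: U; rewrite s0 (le_trans st).
have ut : unit_itv t by apply: U; rewrite t1 (le_trans s0).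
have uts : unit_itv (t - s) by apply: U; rewrite subr_ge0 st/= lerBlDr; lra.
have u0 : unit_itv 0 by apply: U; rewrite lexx ler01.
have [sg law0] := gs_law gs (fbm_span_incr u0 uts).
have [m0 s00 l0] := law0.
have law : normal_law P (fun w => B t w - B s w) 0 sg.
  split => //; first by apply: measurable_funB; exact: mB.
  move=> A mA; rewrite -l0//.
  pose tt : 1.-tuple R := [tuple t - s].
  have tt0 : tnth tt ord0 = t - s by [].
  have H1 : forall i, [set x | `[0, 1]%classic x /\ `[0, 1]%classic (x + s)] (tnth tt i).
    by move=> i; rewrite (ord1 i) tt0; split => //; rewrite subrK.
  have H2 : measurable ((fun x : 1.-tuple R => tnth x ord0) @^-1` A).
    by have := @measurable_tnth _ R 1 ord0 measurableT A mA; rewrite setTI.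
  have := fbm_stationary hB us H1 H2.
  rewrite (_ : _ @^-1` (_ @^-1` A) = (fun w => B t w - B s w) @^-1` A); last first.
    by apply/seteqP; split => w; rewrite /preimage /= tnth_mktuple tt0 subrK.
  move=> ->; congr (P _).
  by apply/seteqP; split => w; rewrite /preimage /= tnth_mktuple tt0.
rewrite (normal_law_cov law) -(normal_law_cov law0).
rewrite -(fbm_var uts) /cov; congr (_ / _).
apply: mean_ae_eq.
- by apply: measurable_funM; apply: measurable_funB; exact: mB.
- by apply: measurable_funM; exact: mB.
- by apply: filterS (fbm_zero hB) => w ->; rewrite subr0.
Qed.

End fbm_gaussian.

(** * Positive values near time 0 *)

Section persistence.
Context d (T : measurableType d) (R : realType) (P : probability T R).
Variables (H : set (T -> R)) (gs : gaussian_space P H).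

Lemma covBB (X Y : T -> R) : H X -> H Y ->
  cov P (fun w => X w - Y w) (fun w => X w - Y w) =
  cov P X X + cov P Y Y - 2 * cov P X Y.
Proof.
move=> HX HY; have HB := gsB gs HX HY.
rewrite (covBl gs)// [cov P X _]covC [cov P Y _]covC !(covBl gs)// [cov P Y X]covC.
by ring.
Qed.

Lemma gs_sum (I : Type) (s : seq I) (Z : I -> T -> R) (X0 : T -> R) : H X0 ->
  (forall i, H (Z i)) -> H (fun w => \sum_(i <- s) Z i w).
Proof.
move=> HX0 HZ; elim: s => [|i s IH].
  have := gsZ gs 0 HX0; rewrite (_ : (fun w => _) = (fun w => \sum_(i <- [::]) Z i w))//.
  by apply/funext => w; rewrite big_nil mul0r.
by under eq_fun do rewrite big_cons; exact: gsD gs _ _ (HZ i) IH.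
Qed.

Lemma cov_suml (I : Type) (s : seq I) (Z : I -> T -> R) (Y : T -> R) : H Y ->
  (forall i, H (Z i)) ->
  cov P (fun w => \sum_(i <- s) Z i w) Y = \sum_(i <- s) cov P (Z i) Y.
Proof.
move=> HY HZ; elim: s => [|i s IH].
  rewrite big_nil -[LHS]/(mean P _ / _) (_ : (fun w => _) = (fun=> 0)).
    by rewrite mean_cst mul0r.
  by apply/funext => w; rewrite big_nil mul0r.
rewrite big_cons -IH -(covDl gs) //; last exact: gs_sum HY HZ.
by congr cov; apply/funext => w; rewrite big_cons.
Qed.

(** Many nearly uncorrelated standard normal variables are unlikely to be all
    nonpositive: their sum, of order [N] for [N^2] variables, would then be of
    order [N^2]. *)
Lemma all_nonpos_small (N : nat) (Z : 'I_(N ^ 2) -> T -> R) : (0 < N)%N ->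
  (forall i, H (Z i)) -> (forall i, cov P (Z i) (Z i) = 1) ->
  (forall i j, i != j -> cov P (Z i) (Z j) <= ((N ^ 2)%:R)^-1) ->
  N%:R * mean P (fun w => [forall i, Z i w <= 0]%:R) ^+ 2 <= 4 * normal_var + 2.
Proof.
move=> N0 HZ Z1 Zij; set p := mean _ _.
have N0r : 0 < N%:R :> R by rewrite ltr0n.
have v0 : 0 < normal_var :> R := normal_var_gt0.
pose G w := [forall i, Z i w <= 0].
have mZ i : measurable_fun [set: T] (Z i) by exact: gs_meas gs _ (HZ i).
have mG : measurable [set w | G w].
  have := @measurable_all_ge _ _ _ _ (fun i w => - Z i w) 0.
  rewrite (_ : [set w | _] = [set w | G w]).
    by apply => i; exact: measurableT_comp.
  by apply/seteqP; split => w /forallP h; apply/forallP => i; have := h i;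
    rewrite oppr_ge0.
have i0 : 'I_(N ^ 2) by exists 0; rewrite expn_gt0 N0.
pose S w := \sum_i Z i w.
have HS : H S by exact: gs_sum (HZ i0) HZ.
have covS : cov P S S <= 2 * N%:R ^+ 2.
  rewrite /S cov_suml//.
  apply: (@le_trans _ _ (\sum_(i < N ^ 2) (2 : R))).
    apply: ler_sum => i _; rewrite covC cov_suml//.
    rewrite (bigD1 i)//= Z1.
    apply: (@le_trans _ _ (1 + \sum_(j < N ^ 2 | j != i) ((N ^ 2)%:R)^-1)).
      by rewrite lerD2l ler_sum// => j ji; exact: Zij.
    rewrite -[leRHS]/(1 + 1) lerD2l.
    apply: (@le_trans _ _ (\sum_(j < N ^ 2) ((N ^ 2)%:R)^-1)).
      by rewrite [leRHS](bigID (fun j => j != i))/= lerDl sumr_ge0.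
    rewrite sumr_const card_ord -[leLHS]mulr_natr mulVf// pnatr_eq0 -lt0n.
    by rewrite expn_gt0 N0.
  by rewrite sumr_const card_ord -[leLHS]mulr_natr natrX.
have S2 : mean P (fun w => S w ^+ 2) <= 2 * normal_var * N%:R ^+ 2.
  have -> : (fun w => S w ^+ 2) = (fun w => S w * S w) by [].
  rewrite -[mean _ _](divfK (lt0r_neq0 v0)) -/(cov P S S).
  by apply: (le_trans (ler_wpM2r (ltW v0) covS)); rewrite mulrAC.
have IG : integ P (fun w => (G w)%:R) by exact: integ_bool.
have p0 : 0 <= p by apply: Rintegral_ge0 => w _; rewrite ler0n.
have m2 : measurable [set x : R | `|x| <= p / 2].
  rewrite (_ : [set x | _] = `[- (p / 2), p / 2]%classic); first exact: measurable_itv.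
  by apply/seteqP; split => x /=; rewrite in_itv/= ler_norml.
have msmall i : measurable [set w | `|Z i w| <= p / 2].
  by have := mZ i measurableT _ m2; rewrite setTI.
have small i : mean P (fun w => (`|Z i w| <= p / 2)%R%:R) <= p / 2.
  rewrite -lee_fin mean_bool//.
  have [_ _ law] := gs_sd_law gs (HZ i).
  have := law _ m2; rewrite Z1 sqrtr1 oner_eq0 /preimage/= => ->.
  by apply: stdn_small; rewrite divr_ge0.
have Ismall i : integ P (fun w => (`|Z i w| <= p / 2)%R%:R) by exact: integ_bool.
pose D w := \sum_i ((G w)%:R - (`|Z i w| <= p / 2)%R%:R : R).
have ID : integ P D /\ mean P D = \sum_i (p - mean P (fun w => (`|Z i w| <= p / 2)%R%:R)).
  rewrite /D; elim: (index_enum _) => [|i s [IHi IHm]].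
    under eq_fun do rewrite big_nil.
    by rewrite big_nil mean_cst; split => //; exact: integ_cst.
  under eq_fun do rewrite big_cons.
  have Ii : integ P (fun w => (G w)%:R - (`|Z i w| <= p / 2)%R%:R).
    have := integ_lin (-1) (Ismall i) IG.
    by under eq_fun do rewrite mulN1r addrC.
  split; first exact: integD.
  rewrite big_cons meanD// IHm; congr (_ + _).
  rewrite (_ : (fun w => _) = (fun w => -1 * (`|Z i w| <= p / 2)%R%:R + (G w)%:R)).
    by rewrite mean_lin// mulN1r addrC.
  by apply/funext => w; rewrite mulN1r addrC.
have IS2 := gs_sqr_integ gs HS.
(* On the event all the [Z i] have the same sign, and each one exceeds [p / 2] in
   absolute value but on an event of probability at most [p / 2]; moreover
   [`|S| <= S ^ 2 / (2 N) + N / 2]. *)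
have : mean P (fun w => p / 2 * D w) <=
    mean P (fun w => (2 * N%:R)^-1 * S w ^+ 2 + N%:R / 2).
  apply: le_mean.
  - by apply: integZ; exact: (proj1 ID).
  - by apply: integ_lin => //; exact: integ_cst.
  move=> w; apply: (@le_trans _ _ (`|S w|)).
    have [/forallP g|ng] := boolP (G w); last first.
      apply: (@le_trans _ _ 0); last exact: normr_ge0.
      rewrite mulr_ge0_le0 ?divr_ge0// sumr_le0// => i _.
      by rewrite (negbTE ng) sub0r oppr_le0 ler0n.
    rewrite ler0_norm; last by rewrite sumr_le0// => i _; exact: g.
    rewrite /D (_ : G w = true); last exact/forallP.
    rewrite mulr_sumr /S -sumrN; apply: ler_sum => i _.
    have [h|h] := leP `|Z i w| (p / 2).
      by rewrite subrr mulr0 oppr_ge0 g.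
    by rewrite subr0 mulr1 (le_trans (ltW h))// ler0_norm// g.
  have h2 : 0 <= (`|S w| - N%:R) ^+ 2 by exact: sqr_ge0.
  rewrite -[S w ^+ 2]ger0_norm ?sqr_ge0// normrX -(ler_pM2l (x := 2 * N%:R)) ?mulr_gt0//.
  rewrite mulrDr mulrA divff ?mul1r ?mulf_neq0 ?gt_eqF//.
  by move: (`|S w|) h2 => x h2; nra.
rewrite meanZ; last exact: (proj1 ID).
rewrite mean_lin//; last exact: integ_cst.
rewrite (proj2 ID) mean_cst => le1.
have le2 : N%:R ^+ 2 * (p / 2) <= \sum_(i < N ^ 2) (p - mean P (fun w => (`|Z i w| <= p / 2)%R%:R)).
  rewrite -natrX mulrC mulr_natr.
  have -> : p / 2 *+ (N ^ 2) = \sum_(i < N ^ 2) (p / 2) by rewrite sumr_const card_ord.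
  by apply: ler_sum => i _; rewrite lerBrDr -lerBrDl (le_trans (small i))//; lra.
have le3 : p / 2 * (N%:R ^+ 2 * (p / 2)) <= N%:R * normal_var + N%:R / 2.
  apply: (le_trans (ler_wpM2l _ le2)); first by rewrite divr_ge0.
  apply: (le_trans le1); rewrite lerD2r.
  apply: (le_trans (ler_wpM2l _ S2)); first by rewrite invr_ge0 mulr_ge0.
  have Nn : N%:R != 0 :> R by rewrite gt_eqF.
  by rewrite le_eqVlt; apply/orP; left; apply/eqP; field.
rewrite -(ler_pM2l N0r).
have aux (n q v : R) : q / 2 * (n ^+ 2 * (q / 2)) <= n * v + n / 2 ->
  n * (n * q ^+ 2) <= n * (4 * v + 2) by lra.
exact: aux.
Qed.

End persistence.

Section fbm_positive.
Context d (T : measurableType d) (R : realType) (P : probability T R).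
Variables (alpha : R) (halpha : 0 < alpha < 1) (B : R -> {RV P >-> R}).
Hypothesis hB : fractional_brownian_motion `[0, 1] alpha B.

Let gs := fbm_gaussian_space halpha hB.
Let alpha0 : 0 < alpha. Proof. by case/andP: halpha. Qed.
Let alpha1 : alpha < 1. Proof. by case/andP: halpha. Qed.

Lemma unit_itvP x : 0 <= x <= 1 -> @unit_itv R x.
Proof. by rewrite /unit_itv/= in_itv. Qed.

Lemma fbm_cov s t : 0 <= s -> s <= t -> t <= 1 ->
  cov P (B s) (B t) =
  2^-1 * (s `^ (alpha *+ 2) + t `^ (alpha *+ 2) - (t - s) `^ (alpha *+ 2)).
Proof.
move=> s0 st t1.
have Hs : fbm_span B (B s) by apply/fbm_spanB/unit_itvP; rewrite s0 (le_trans st).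
have Ht : fbm_span B (B t) by apply/fbm_spanB/unit_itvP; rewrite t1 (le_trans s0).
have Hst := gsB gs Ht Hs.
have := fbm_var_incr halpha hB s0 st t1.
rewrite (covBB gs Ht Hs).
rewrite !(fbm_var halpha hB)//; last 2 first.
- by apply: unit_itvP; rewrite s0 (le_trans st).
- by apply: unit_itvP; rewrite t1 (le_trans s0).
by rewrite [cov P (B t) (B s)]covC => <-; field.
Qed.

(** With [rho = s / t], the correlation of [B s] and [B t] is
    [rho ^ - alpha * (rho ^ (2 alpha) + 1 - (1 - rho) ^ (2 alpha)) / 2], where
    [1 - (1 - rho) ^ (2 alpha) <= 2 rho] since [alpha < 1]. *)
Lemma fbm_cov_ratio (r s t : R) : 0 < r < 1 -> 0 < s -> s <= r * t -> 0 < t <= 1 ->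
  s `^ (- alpha) * t `^ (- alpha) * cov P (B s) (B t) <=
  2^-1 * r `^ alpha + r `^ (1 - alpha).
Proof.
move=> /andP[r0 r1] s0 srt /andP[t0 t1].
pose rho := s / t.
have rho0 : 0 < rho by rewrite divr_gt0.
have rhor : rho <= r by rewrite ler_pdivrMr.
have sE : s = rho * t by rewrite /rho divfK// gt_eqF.
have st : s <= t by rewrite sE ler_piMl ?ltW// (le_lt_trans rhor).
rewrite (fbm_cov (ltW s0))//.
have -> : t - s = (1 - rho) * t by rewrite sE; ring.
have rho1 : rho < 1 by exact: le_lt_trans rhor r1.
have omr : 0 <= 1 - rho by rewrite subr_ge0 ltW.
rewrite {2}sE (powRM _ (ltW rho0) (ltW t0)) (powRM _ omr (ltW t0)).
have -> : s `^ (- alpha) = rho `^ (- alpha) * t `^ (- alpha).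
  by rewrite sE powRM// ltW.
have tt : t `^ (- alpha) * t `^ (- alpha) * t `^ (alpha *+ 2) = 1.
  rewrite -!powRD; last 2 first.
  - by rewrite (gt_eqF t0) implybT.
  - by rewrite (gt_eqF t0) implybT.
  by rewrite (_ : _ + _ = 0) ?powRr0// mulr2n; ring.
have -> : rho `^ (- alpha) * t `^ (- alpha) * t `^ (- alpha) *
    (2^-1 * (rho `^ (alpha *+ 2) * t `^ (alpha *+ 2) + t `^ (alpha *+ 2) -
      (1 - rho) `^ (alpha *+ 2) * t `^ (alpha *+ 2))) =
  2^-1 * (rho `^ (- alpha) * rho `^ (alpha *+ 2) +
    rho `^ (- alpha) * (1 - (1 - rho) `^ (alpha *+ 2))).
  by rewrite -[RHS]mul1r -[X in _ = X * _]tt; ring.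
rewrite -powRD; last by rewrite (gt_eqF rho0) implybT.
have -> : - alpha + alpha *+ 2 = alpha by rewrite mulr2n; ring.
rewrite mulrDr lerD//.
  by rewrite ler_wpM2l// ge0_ler_powR// ?nnegrE ltW.
have h : 1 - (1 - rho) `^ (alpha *+ 2) <= 2 * rho.
  have : (1 - rho) `^ 2 <= (1 - rho) `^ (alpha *+ 2).
    apply: ger_powR; first by rewrite subr_gt0 (le_lt_trans rhor)//= gerBl ltW.
    by rewrite -[alpha *+ 2]mulr_natr; move: alpha1; lra.
  rewrite (powR_mulrn 2 omr); have := sqr_ge0 rho.
  by move: (_ `^ _) => X; lra.
apply: (@le_trans _ _ (2^-1 * (rho `^ (- alpha) * (2 * rho)))).
  by rewrite !ler_wpM2l// powR_ge0.
have -> : 2^-1 * (rho `^ (- alpha) * (2 * rho)) = rho `^ (- alpha) * rho by field.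
rewrite -{2}(powRr1 (ltW rho0)) -powRD; last by rewrite (gt_eqF rho0) implybT.
by rewrite addrC ge0_ler_powR ?nnegrE ?subr_ge0// ltW.
Qed.

(** For every [N], the normalised values at [N ^ 2] times of a geometric sequence
    of small enough ratio satisfy [all_nonpos_small]. *)
Lemma fbm_pos_ae : {ae P, forall w, exists t, 0 <= t <= 1 /\ 0 < B t w}.
Proof.
pose e (N : nat) : R := (2 * (N.+1 ^ 2)%:R)^-1.
(* a ratio for which both terms of [fbm_cov_ratio] are at most [e N] *)
pose r N := e N `^ alpha^-1 * e N `^ (1 - alpha)^-1.
have a1 : 0 < 1 - alpha by rewrite subr_gt0.
have e0 N : 0 < e N by rewrite invr_gt0 mulr_gt0// ltr0n expn_gt0.
have e1 N : e N <= 2^-1.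
  rewrite lef_pV2 ?posrE ?mulr_gt0 ?ltr0n ?expn_gt0// ler_peMr// ler1n.
  by rewrite expn_gt0.
have e1' N : e N <= 1 by rewrite (le_trans (e1 N))// invf_le1// ler1n.
have pe N x : 0 < x -> 0 < e N `^ x <= 1.
  move=> x0; rewrite powR_gt0//=.
  by rewrite -(powRr0 (e N)); apply: ger_powR; rewrite ?e0 ?e1' ?ltW.
have i1 : 0 < (1 - alpha)^-1 by rewrite invr_gt0.
have i2 : 0 < alpha^-1 by rewrite invr_gt0.
have r0 N : 0 < r N by rewrite mulr_gt0 ?powR_gt0.
have r1 N : r N < 1.
  apply: (@le_lt_trans _ _ (e N)); last by rewrite (le_lt_trans (e1 N))// invf_lt1// ltr1n.
  have /andP[p0 p1] := pe N _ i1.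
  rewrite /r -[leRHS]mulr1 ler_pM ?powR_ge0//.
  by apply: ge1r_powR; rewrite ?e0 ?e1'// invf_ge1// ltW.
have ra N : r N `^ alpha <= e N.
  rewrite /r powRM ?powR_ge0// -powRrM mulVf ?gt_eqF// (powRr1 (ltW (e0 N))).
  have /andP[p0 p1] := pe N _ (mulr_gt0 i1 alpha0).
  by rewrite -powRrM ler_piMr ?(ltW (e0 N)).
have rb N : r N `^ (1 - alpha) <= e N.
  rewrite /r powRM ?powR_ge0// -!powRrM mulVf ?gt_eqF// (powRr1 (ltW (e0 N))).
  have /andP[p0 p1] := pe N _ (mulr_gt0 i2 a1).
  by rewrite ler_piMl ?(ltW (e0 N)).
pose t N (i : nat) := r N ^+ i.
have t0 N i : 0 < t N i by rewrite exprn_gt0.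
have t1 N i : t N i <= 1 by rewrite exprn_ile1// ltW.
pose Z N i w := t N i `^ (- alpha) * B (t N i) w.
have HB N i : fbm_span B (B (t N i)).
  by apply/fbm_spanB/unit_itvP; rewrite t1 ltW.
have HZ N i : fbm_span B (Z N i) by exact: gsZ gs _ _ (HB N i).
have Zvar N i : cov P (Z N i) (Z N i) = 1.
  rewrite (covZl gs)// covC (covZl gs)//.
  rewrite (fbm_var halpha hB); last by apply: unit_itvP; rewrite t1 ltW.
  rewrite -!powRD ?(gt_eqF (t0 N i)) ?implybT//.
  by rewrite (_ : _ + _ = 0) ?powRr0// mulr2n; ring.
have Zlt N i j : (i < j)%N -> cov P (Z N j) (Z N i) <= (N.+1 ^ 2)%:R^-1.
  move=> ij; rewrite (covZl gs)// covC (covZl gs)// covC mulrA.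
  apply: (@le_trans _ _ (2^-1 * r N `^ alpha + r N `^ (1 - alpha))).
    apply: fbm_cov_ratio; rewrite ?r0 ?r1 ?t0 ?t1//.
    rewrite /t -exprS -(subnK ij) exprD ler_piMl// ?exprn_ge0 ?exprn_ile1// ltW//.
  have -> : (N.+1 ^ 2)%:R^-1 = 2 * e N.
    by rewrite /e invfM mulrA divff ?mul1r.
  by have := ra N; have := rb N; have := e0 N; lra.
have small N := @all_nonpos_small _ _ _ _ _ gs N.+1 (fun i => Z N i) isT
  (fun i => HZ N i) (fun i => Zvar N i).
pose A N := [set w | [forall i : 'I_(N.+1 ^ 2), Z N i w <= 0]].
have mA N : measurable (A N).
  have := @measurable_all_ge _ _ _ _ (fun (i : 'I_(N.+1 ^ 2)) w => - Z N i w) 0.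
  rewrite (_ : [set w | _] = A N).
    apply => i; apply: measurableT_comp => //.
    exact: gs_meas gs _ (HZ N i).
  by apply/seteqP; split => w /forallP h; apply/forallP => i; have := h i;
    rewrite oppr_ge0.
have mI : measurable (\bigcap_N A N) by exact: bigcapT_measurable.
exists (\bigcap_N A N); split => //.
- set q := P _.
  have qA N : (q <= P (A N))%E.
    by apply: le_measure; rewrite ?inE//; exact: bigcap_inf.
  have qfin : q \is a fin_num.
    exact: fin_num_measure.
  have q0 : 0 <= fine q by apply: fine_ge0; exact: measure_ge0.
  rewrite -(fineK qfin); congr EFin; apply/eqP; rewrite eq_le q0 andbT leNgt.
  apply/negP => qpos.
  have qN N : N.+1%:R * fine q ^+ 2 <= 4 * normal_var + 2.
    apply: le_trans (small N _); last first.
      move=> i j; rewrite -val_eqE/= neq_ltn => /orP[|] ij; last exact: Zlt.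
      by rewrite covC; exact: Zlt.
    rewrite ler_wpM2l// ler_sqr ?nnegrE//.
      rewrite -lee_fin fineK// mean_bool; [exact: qA|exact: mA].
    by apply: Rintegral_ge0 => w _; rewrite ler0n.
  pose N := Num.bound ((4 * normal_var + 2) / fine q ^+ 2).
  have := qN N; rewrite leNgt => /negP; apply.
  rewrite -ltr_pdivrMr ?exprn_gt0//.
  apply: (@lt_trans _ _ N%:R); last by rewrite ltr_nat.
  by apply: le_lt_trans (archi_boundP _); rewrite // divr_ge0 ?sqr_ge0// addr_ge0// mulr_ge0// ltW// normal_var_gt0.
- move=> w /= nw N _; apply/forallP => i.
  rewrite /Z mulr_ge0_le0 ?powR_ge0// leNgt; apply/negP => Bw; apply: nw.
  by exists (t N i); rewrite t1 ltW.
Qed.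

End fbm_positive.

(** * Grids and chaining *)

Section grid.
Context (R : realType) (M : nat) (hM : (2 <= M)%N).

Definition mesh m : R := (M%:R ^+ m)^-1.
Definition grid m j : R := j%:R * mesh m.
Definition grid_idx m (r : R) : nat := Num.truncn (r * M%:R ^+ m).

Let M0 : 0 < M%:R :> R. Proof. by rewrite ltr0n (leq_trans _ hM). Qed.

Lemma Mm_gt0 m : 0 < M%:R ^+ m :> R. Proof. by rewrite exprn_gt0. Qed.

Lemma mesh_gt0 m : 0 < mesh m. Proof. by rewrite invr_gt0 Mm_gt0. Qed.

Lemma mesh_ge0 m : 0 <= mesh m. Proof. exact/ltW/mesh_gt0. Qed.

Lemma meshS m : mesh m = M%:R * mesh m.+1.
Proof. by rewrite /mesh exprS invfM mulrA divff ?mul1r// gt_eqF. Qed.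

Lemma mesh_decr m n : (m <= n)%N -> mesh n <= mesh m.
Proof.
move=> mn; rewrite /mesh lef_pV2 ?posrE ?Mm_gt0//.
by apply: ler_weXn2l => //; rewrite ler1n (leq_trans _ hM).
Qed.

Lemma mesh_le_half m : mesh m <= (2 ^+ m)^-1.
Proof.
rewrite lef_pV2 ?posrE ?Mm_gt0 ?exprn_gt0//.
by rewrite lerXn2r ?nnegrE// ?ler_nat// ltW.
Qed.

Lemma mesh_small (e : R) : 0 < e -> exists m, mesh m < e.
Proof.
move=> e0; pose n := Num.bound e^-1; exists n.
rewrite (le_lt_trans (mesh_le_half n))// -[ltRHS]invrK ltf_pV2 ?posrE ?invr_gt0 ?exprn_gt0//.
apply: (@lt_trans _ _ n%:R).
  by apply: archi_boundP; rewrite invr_ge0 ltW.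
by rewrite -natrX ltr_nat ltn_expl.
Qed.

Lemma gridS m j : grid m.+1 (M * j) = grid m j.
Proof. by rewrite /grid (meshS m) natrM; ring. Qed.

Lemma gridX m k j : grid (m + k) (j * M ^ k) = grid m j.
Proof.
elim: k j => [|k IH] j; first by rewrite addn0 expn0 muln1.
by rewrite addnS expnS mulnCA gridS IH.
Qed.

Lemma grid_itv m j : (j <= M ^ m)%N -> 0 <= grid m j <= 1.
Proof.
move=> jM; rewrite /grid mulr_ge0 ?mesh_ge0//=.
by rewrite /mesh ler_pdivrMr ?Mm_gt0// mul1r -natrX ler_nat.
Qed.

Lemma grid_idx_itv m r : 0 <= r ->
  grid m (grid_idx m r) <= r < grid m (grid_idx m r) + mesh m.
Proof.
move=> r0; have := @truncn_itv R (r * M%:R ^+ m).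
rewrite mulr_ge0 ?(ltW (Mm_gt0 m))// => /(_ isT) /andP[h1 h2].
rewrite /grid/mesh ler_pdivrMr ?Mm_gt0// h1/=.
by rewrite -[X in _ + X]mul1r -mulrDl natr1 ltr_pdivlMr ?Mm_gt0.
Qed.

Lemma grid_idx_le m r : 0 <= r <= 1 -> (grid_idx m r <= M ^ m)%N.
Proof.
move=> /andP[r0 r1]; rewrite -(ler_nat R) natrX.
have /andP[h _] := grid_idx_itv m r0.
by have := le_trans h r1; rewrite /grid /mesh ler_pdivrMr ?Mm_gt0// mul1r.
Qed.

Lemma grid_idxS m r : 0 <= r ->
  (M * grid_idx m r <= grid_idx m.+1 r < M * grid_idx m r + M)%N.
Proof.
move=> r0; have /andP[h1 h2] := grid_idx_itv m r0.
have /andP[g1 g2] := grid_idx_itv m.+1 r0.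
rewrite -ltnS -!(ltr_nat R) -(ltr_pM2r (mesh_gt0 m.+1)).
rewrite -[X in _ && X](ltr_pM2r (mesh_gt0 m.+1)).
move: h1 h2 g1 g2; rewrite /grid (meshS m) -natr1 natrD natrM => h1 h2 g1 g2.
by apply/andP; split; lra.
Qed.

Lemma within_itv_continuous_eps (f : R -> R) r e :
  {within `[0, 1], continuous f} -> 0 <= r <= 1 -> 0 < e ->
  exists2 del : R, 0 < del &
    forall s, 0 <= s <= 1 -> `|r - s| < del -> `|f r - f s| < e.
Proof.
move=> /subspace_continuousP cf r01 e0.
have /cf/cvgrPdist_lt/(_ _ e0) : `[0, 1]%classic r by rewrite /= in_itv.
rewrite near_withinE => -[del /= del0 hdel]; exists del => // s s01 rs.
by apply: hdel => //=; rewrite in_itv.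
Qed.

Section chaining.
Variables (f : R -> R) (beta : R) (m0 : nat).
Hypotheses (beta0 : 0 < beta) (cf : {within `[0, 1], continuous f}).
Hypothesis incr : forall m j, (m0 <= m)%N -> (j < M ^ m)%N ->
  `|f (grid m j.+1) - f (grid m j)| <= mesh m `^ beta.

Let rho := M%:R `^ (- beta) : R.
(** The sum of [M * rho ^ k] over [k > 0]: refining the grid once moves the
    approximation of a point by at most [M] steps of the finer grid. *)
Definition chain_const : R := M%:R * rho / (1 - rho).

Let rho01 : 0 < rho < 1.
Proof.
rewrite /rho powR_gt0//= powRN invf_lt1 ?powR_gt0//.
have : 1 `^ beta < M%:R `^ beta by rewrite gt0_ltr_powR ?nnegrE ?ltr1n.
by rewrite powR1.
Qed.

Let meshSb m : mesh m.+1 `^ beta = rho * mesh m `^ beta.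
Proof.
rewrite (meshS m) powRM ?mesh_ge0// mulrA -powRD.
  by rewrite addNr powRr0 mul1r.
by rewrite addNr eqxx (gt_eqF M0).
Qed.

Lemma chain_const_ge0 : 0 <= chain_const.
Proof.
have /andP[h0 h1] := rho01.
by rewrite divr_ge0 ?subr_ge0 ?(ltW h1)// mulr_ge0// ltW.
Qed.

Lemma incr_many m j i : (m0 <= m)%N -> (j + i <= M ^ m)%N ->
  `|f (grid m (j + i)) - f (grid m j)| <= i%:R * mesh m `^ beta.
Proof.
move=> mm; elim: i => [|i IH] ji.
  by rewrite addn0 subrr normr0 mul0r.
have -> : f (grid m (j + i.+1)) - f (grid m j) =
  (f (grid m (j + i).+1) - f (grid m (j + i))) +
  (f (grid m (j + i)) - f (grid m j)) by rewrite addnS; ring.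
apply: (le_trans (ler_normD _ _)); rewrite -natr1 mulrDl mul1r addrC lerD//.
  by rewrite IH// ltnW// -addnS.
by apply: incr => //; rewrite -addnS.
Qed.

Lemma chain_step m r : (m0 <= m)%N -> 0 <= r <= 1 ->
  `|f (grid m.+1 (grid_idx m.+1 r)) - f (grid m (grid_idx m r))| <=
  M%:R * rho * mesh m `^ beta.
Proof.
move=> mm r01; have /andP[r0 r1] := r01.
have /andP[h1 h2] := grid_idxS m r0.
rewrite -(gridS m) -(subnKC h1) -mulrA -meshSb.
apply: (le_trans (incr_many _ _)).
- exact: leqW.
- by rewrite subnKC// grid_idx_le.
- rewrite ler_wpM2r ?powR_ge0// ler_nat leq_subLR ltnW//.
Qed.

Lemma chain_grid m k r : (m0 <= m)%N -> 0 <= r <= 1 ->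
  `|f (grid (m + k) (grid_idx (m + k) r)) - f (grid m (grid_idx m r))| <=
  chain_const * mesh m `^ beta.
Proof.
move=> + r01; elim: k m => [|k IH] m mm.
  by rewrite addn0 subrr normr0 mulr_ge0 ?powR_ge0// chain_const_ge0.
rewrite addnS -addSn.
set a := f _; set b := f _; set c := f (grid m.+1 (grid_idx m.+1 r)).
have -> : a - b = (a - c) + (c - b) by ring.
apply: (le_trans (ler_normD _ _)).
apply: (@le_trans _ _ (chain_const * mesh m.+1 `^ beta + M%:R * rho * mesh m `^ beta)).
  by rewrite lerD ?chain_step// IH// leqW.
rewrite meshSb mulrA -mulrDl ler_wpM2r ?powR_ge0//.
have /andP[h0 h1] := rho01.
rewrite /chain_const le_eqVlt; apply/orP; left; apply/eqP.
by field; rewrite subr_eq0 gt_eqF.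
Qed.

(** The telescoping sum of the increments over finer and finer grids. *)
Lemma chain_point m r : (m0 <= m)%N -> 0 <= r <= 1 ->
  `|f r - f (grid m (grid_idx m r))| <= chain_const * mesh m `^ beta.
Proof.
move=> mm r01; have /andP[r0 r1] := r01; apply/ler_addgt0Pr => e e0.
have [del del0 hdel] := within_itv_continuous_eps cf r01 e0.
have [k km] := mesh_small del0.
pose s := grid (m + k) (grid_idx (m + k) r).
have -> : f r - f (grid m (grid_idx m r)) =
    (f s - f (grid m (grid_idx m r))) + (f r - f s) by ring.
apply: (le_trans (ler_normD _ _)); rewrite lerD ?chain_grid//.
apply/ltW/hdel; first by rewrite grid_itv// grid_idx_le.
have /andP[h1 h2] := grid_idx_itv (m + k) r0.
rewrite ger0_norm ?subr_ge0// ltrBlDl (lt_le_trans h2)// lerD2l.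
by rewrite (le_trans _ (ltW km))// mesh_decr// leq_addl.
Qed.

(** At the last level whose mesh is at least [`|s - t|], the points [s] and [t]
    are in the same cell or in adjacent ones. *)
Lemma chain_hoelder : exists2 C : R, 0 <= C & forall s t : R,
  0 <= s <= 1 -> 0 <= t <= 1 -> `|s - t| <= mesh m0 ->
  `|f s - f t| <= C * `|s - t| `^ beta.
Proof.
pose C := (chain_const *+ 2 + 1) * M%:R `^ beta.
have C0 : 0 <= C by rewrite mulr_ge0 ?powR_ge0// addr_ge0// mulrn_wge0// chain_const_ge0.
exists C => // s t; wlog st : s t / s < t => [hw s01 t01 st|].
  have [st'|st'|->] := ltgtP s t; first exact: hw.
    by rewrite distrC [`|s - t|]distrC hw// distrC.
  by rewrite !subrr normr0 mulr_ge0 ?powR_ge0.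
move=> s01 t01; have /andP[s0 s1] := s01; have /andP[t0 t1] := t01.
rewrite distrC [`|f s - f t|]distrC gtr0_norm ?subr_gt0// => stm.
have ts0 : 0 < t - s by rewrite subr_gt0.
have ex : exists k, mesh k < t - s by exact: mesh_small.
case: (ex_minnP ex) => -[|m] hm mmin.
  have := lt_le_trans hm (lerB t1 s0); rewrite subr0 /mesh expr0 invr1 ltxx//.
have tsm : t - s <= mesh m.
  by rewrite leNgt; apply/negP => /mmin; rewrite ltnn.
have mm : (m0 <= m)%N.
  rewrite leqNgt; apply/negP => mm.
  by have := lt_le_trans hm (le_trans stm (mesh_decr mm)); rewrite ltxx.
apply: (@le_trans _ _ ((chain_const *+ 2 + 1) * mesh m `^ beta)); last first.
  rewrite /C -mulrA ler_wpM2l//.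
    by rewrite addr_ge0// mulrn_wge0// chain_const_ge0.
  rewrite -powRM ?(ltW ts0)// ge0_ler_powR ?nnegrE ?mesh_ge0 ?mulr_ge0 ?(ltW beta0) ?(ltW ts0)//.
  by rewrite (meshS m) ler_pM2l// ltW.
set i := grid_idx m s; set j := grid_idx m t.
have /andP[i1 i2] := grid_idx_itv m s0; have /andP[j1 j2] := grid_idx_itv m t0.
rewrite -/i in i1 i2; rewrite -/j in j1 j2.
have ij : (i <= j)%N.
  rewrite -ltnS -(ltr_nat R) -(ltr_pM2r (mesh_gt0 m)).
  by rewrite -natr1 mulrDl mul1r -/(grid m i) -/(grid m j); lra.
have ji : (j < i.+2)%N.
  rewrite -(ltr_nat R) -(ltr_pM2r (mesh_gt0 m)) -natr1 -natr1.
  by rewrite !mulrDl mul1r -/(grid m i) -/(grid m j); lra.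
have fij : `|f (grid m j) - f (grid m i)| <= mesh m `^ beta.
  move: ji; rewrite ltnS leq_eqVlt => /predU1P[jE|ji].
    rewrite jE; apply: incr => //; rewrite -jE.
    by apply: grid_idx_le; rewrite t0.
  have -> : j = i by apply/eqP; rewrite eqn_leq ij andbT -ltnS.
  by rewrite subrr normr0 powR_ge0.
have -> : f t - f s = (f t - f (grid m j)) + ((f (grid m j) - f (grid m i)) +
    (f (grid m i) - f s)) by ring.
have hs := chain_point mm s01; have ht := chain_point mm t01.
rewrite -/i distrC in hs; rewrite -/j in ht.
apply: (le_trans (ler_normD _ _)); rewrite mulrDl mul1r mulr2n mulrDl.
rewrite -[leRHS]addrA; apply: lerD => //.
apply: (le_trans (ler_normD _ _)); rewrite [leRHS]addrC. exact: (lerD fij hs).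
Qed.

End chaining.
End grid.

(** * Bounds on dimensions *)

Section dimension_bounds.
Context (R : realType).
Implicit Types (A U : set R).

Lemma diameter_le A x y : A x -> A y -> (`|x - y|%:E <= diameter A)%E.
Proof. by move=> Ax Ay; apply: ereal_sup_ubound; exists x => //; exists y. Qed.

Lemma diameter_ge0 A : A != set0 -> (0 <= diameter A)%E.
Proof.
move=> /set0P[x Ax]; apply: (le_trans _ (diameter_le Ax Ax)).
by rewrite lee_fin.
Qed.

Lemma diameter_ub A (e : R) :
  (forall x y, A x -> A y -> `|x - y| <= e) -> (diameter A <= e%:E)%E.
Proof.
by move=> h; apply: ge_ereal_sup => _ [x Ax [y Ay <-]]; rewrite lee_fin h.
Qed.

Lemma hausdorff_premeasure_ge0 s delta A : (0 <= hausdorff_premeasure s delta A)%E.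
Proof.
apply: le_ereal_inf_tmp => _ [U _ <-]; apply: nneseries_ge0 => n _ _.
exact: poweR_ge0.
Qed.

(** A cover of [A] by sets of diameter [D i] yields a cover of [[0, y0]] by
    intervals of length [2 C (D i) ^ beta]; their total length is at least [y0], so
    that the sum of the [(D i) ^ s] cannot be small for [s < beta]. *)
Lemma hausdorff_dim_ge A (f : R -> R) (C delta0 beta y0 : R) :
  0 <= C -> 0 < delta0 -> 0 < beta -> 0 < y0 ->
  (forall s t, A s -> A t -> `|s - t| <= delta0 ->
    `|f s - f t| <= C * `|s - t| `^ beta) ->
  `[0, y0] `<=` f @` A ->
  (beta%:E <= hausdorff_dim A)%E.
Proof.
move=> C0 d0 b0 y00 holder sur.
apply: le_ereal_inf_tmp => _ [s [s0 Hs] <-]; rewrite lee_fin leNgt.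
apply/negP => sb.
pose delta := Num.min delta0 1.
have delta_gt0 : 0 < delta by rewrite lt_min d0 ltr01.
have pre0 : (hausdorff_premeasure s delta A <= 0)%E.
  by rewrite -Hs; apply: ereal_sup_ubound; exists delta.
pose eps := y0 / (2 * C + 1).
have C1 : 0 < 2 * C + 1 by lra.
have eps0 : 0 < eps by rewrite divr_gt0.
have [_ [U [AU diamU] <-] sumU] : exists2 y,
    [set (\sum_(0 <= i <oo | U i != set0) (diameter (U i) `^ s))%E
      | U in [set U : nat -> set R | A `<=` \bigcup_i U i /\
                forall i, (diameter (U i) <= delta%:E)%E]] y & (y < eps%:E)%E.
  by apply: ereal_inf_lt; rewrite (le_lt_trans pre0)// lte_fin.
pose D i : R := fine (diameter (U i)).
have dfin i : U i != set0 -> diameter (U i) = (D i)%:E.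
  move=> /diameter_ge0 h; rewrite /D fineK//.
  by rewrite ge0_fin_numE// (le_lt_trans (diamU i))// ltry.
have D0 i : U i != set0 -> 0 <= D i.
  by move=> Ui; rewrite -lee_fin -dfin// diameter_ge0.
have Dd i : U i != set0 -> D i <= delta.
  by move=> Ui; rewrite -lee_fin -dfin.
pose J i := match pselect ((U i `&` A) !=set0) with
  | left h => let x := sval (cid h) in
      `[f x - C * D i `^ beta, f x + C * D i `^ beta]%classic
  | right _ => set0 end.
have mJ i : measurable (J i).
  by rewrite /J; case: pselect => // h; exact: measurable_itv.
have cov : `[0, y0]%classic `<=` \bigcup_i J i.
  move=> y /sur[a Aa <-]; have [i _ Ua] := AU _ Aa; exists i => //.
  rewrite /J; case: pselect => [h|h]; last by exfalso; apply: h; exists a.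
  case: (cid h) => x [Ux Ax] /=.
  have Ui : U i != set0 by apply/set0P; exists a.
  have ax : `|f x - f a| <= C * D i `^ beta.
    have xaD : `|x - a| <= D i by rewrite -lee_fin -dfin// diameter_le.
    apply: (le_trans (holder _ _ Ax Aa _)).
      by rewrite (le_trans xaD)// (le_trans (Dd _ Ui))// ge_min lexx.
    by rewrite ler_wpM2l// ge0_ler_powR ?nnegrE ?(ltW b0)// D0.
  by rewrite in_itv/=; move: ax; rewrite ler_norml => /andP[? ?]; apply/andP; split; lra.
have muJ i : (lebesgue_measure (J i) <=
    if U i != set0 then (2 * C)%:E * diameter (U i) `^ s else 0)%E.
  rewrite /J; case: pselect => [h|h]; last first.
    rewrite measure0; case: ifP => // _.
    by rewrite mule_ge0 ?poweR_ge0// lee_fin mulr_ge0.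
  have Ui : U i != set0 by case: h => x [Ux _]; apply/set0P; exists x.
  rewrite Ui dfin// poweR_EFin.
  case: (cid h) => x [Ux Ax] /=.
  have le : D i `^ beta <= D i `^ s.
    have := D0 _ Ui; rewrite le_eqVlt => /predU1P[<-|Di0].
      by rewrite powR0 ?gt_eqF// powR_ge0.
    apply: ger_powR; last exact: ltW.
    by rewrite Di0/= (le_trans (Dd _ Ui))// ge_min lexx orbT.
  have CD0 : 0 <= C * D i `^ beta by rewrite mulr_ge0 ?powR_ge0.
  rewrite lebesgue_measure_itv/= lte_fin; case: ifP => _; last first.
    by rewrite -EFinM lee_fin mulr_ge0 ?powR_ge0// mulr_ge0.
  rewrite -EFinB -EFinM lee_fin.
  by have := ler_wpM2l C0 le; lra.
have : (lebesgue_measure (`[0%R, y0]%classic : set R) <=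
    \sum_(i <oo) lebesgue_measure (J i))%E.
  by apply: measure_sigma_subadditive => //; exact: measurable_itv.
rewrite lebesgue_measure_itv/= lte_fin y00 oppr0 adde0 => le1.
have le2 : (\sum_(i <oo) lebesgue_measure (J i) <=
    (2 * C)%:E * \sum_(0 <= i <oo | U i != set0) (diameter (U i) `^ s))%E.
  rewrite -nneseriesZl; last by move=> i _; exact: poweR_ge0.
  by rewrite [leRHS]eseries_mkcond; apply: lee_nneseries => //.
have le3 : ((2 * C)%:E * \sum_(0 <= i <oo | U i != set0) (diameter (U i) `^ s) <=
    (2 * C)%:E * eps%:E)%E.
  by rewrite lee_wpmul2l ?lee_fin ?mulr_ge0// ltW.
have := le_trans le1 (le_trans le2 le3).
rewrite -EFinM lee_fin leNgt => /negP; apply.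
by rewrite /eps mulrA ltr_pdivrMr// mulrC ltr_pM2l// ltrDl.
Qed.

Variables (M : nat) (hM : (2 <= M)%N).

(** The cover by the boxes of level [n] costs at most
    [mesh n ^ (- s) * mesh n ^ t], which tends to [0]. *)
Lemma hausdorff_measure_eq0 A (s t : R) : A `<=` `[0, 1] -> s < t -> 0 < t ->
  (\forall n \near \oo, (box_count M n A)%:R <= mesh R M n `^ (- s)) ->
  hausdorff_measure t A = 0%E.
Proof.
move=> A01 st t0 [n0 _ cnt].
apply/eqP; rewrite eq_le; apply/andP; split; last first.
  apply: (le_trans (hausdorff_premeasure_ge0 t 1 A)).
  by apply: ereal_sup_ubound; exists 1 => /=.
apply: ge_ereal_sup => _ [delta /= delta0 <-].
apply/lee_addgt0Pr => e e0; rewrite add0e.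
(* a level at which the boxes are small and the cover is cheap *)
have ts : 0 < t - s by rewrite subr_gt0.
have e1 : 0 < e `^ (t - s)^-1 by rewrite powR_gt0.
have [k1 hk1] := mesh_small hM delta0; have [k2 hk2] := mesh_small hM e1.
pose n := (n0 + k1 + k2)%N.
have mn1 : mesh R M n <= delta.
  by rewrite (le_trans _ (ltW hk1))// mesh_decr// /n addnAC leq_addl.
have mn2 : mesh R M n `^ (t - s) <= e.
  rewrite -[leRHS](powRr1 (ltW e0)) -(mulVf (lt0r_neq0 ts)) powRrM.
  apply: ge0_ler_powR; rewrite ?nnegrE ?(ltW ts) ?mesh_ge0 ?powR_ge0//.
  by rewrite (le_trans _ (ltW hk2))// mesh_decr// leq_addl.
pose box p : set R := `[p%:R / M%:R ^+ n, p.+1%:R / M%:R ^+ n[%classic.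
(* the point [1] lies in no box, and costs nothing as a singleton *)
pose U i : set R := if (i < M ^ n)%N then A `&` box i
                    else if i == (M ^ n)%N then [set 1] else set0.
have M0 : 0 < M%:R ^+ n :> R by exact: Mm_gt0.
have boxd p x y : box p x -> box p y -> `|x - y| <= mesh R M n.
  rewrite /box/= !in_itv/= -natr1 mulrDl mul1r -/(mesh R M n).
  move=> /andP[x1 x2] /andP[y1 y2]; rewrite ler_norml; apply/andP; split; lra.
have AU : A `<=` \bigcup_i U i.
  move=> x Ax; have := A01 _ Ax; rewrite /= in_itv/= => /andP[x0 x1].
  move: x1; rewrite le_eqVlt => /predU1P[x1|x1].
    by exists (M ^ n)%N => //; rewrite /U ltnn eqxx.
  have /andP[g1 g2] := grid_idx_itv hM n x0.
  have pM : (grid_idx M n x < M ^ n)%N.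
    rewrite -(ltr_nat R) natrX -[ltRHS]mul1r -ltr_pdivrMr//.
    exact: le_lt_trans x1.
  exists (grid_idx M n x) => //; rewrite /U pM; split => //.
  by rewrite /box/= in_itv/= g1/= -natr1 mulrDl mul1r.
have Ud i : (diameter (U i) <= (mesh R M n)%:E)%E.
  apply: diameter_ub => x y; rewrite /U; case: ifP => _.
    by move=> [_ bx] [_ by_]; exact: boxd bx by_.
  case: ifP => _ // -> ->; by rewrite subrr normr0 mesh_ge0.
apply: (@le_trans _ _ (\sum_(0 <= i <oo | U i != set0) (diameter (U i) `^ t))%E).
  apply: ereal_inf_lbound; exists U => //; split => // i.
  by rewrite (le_trans (Ud i))// lee_fin.
rewrite (@nneseries_split_cond _ _ 0 (M ^ n).+1); last by move=> *; exact: poweR_ge0.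
rewrite add0n eseries0; last first.
  move=> i iM; rewrite {1}/U ifF; last by rewrite ltnNge (ltnW iM).
  by rewrite ifF ?eqxx// gtn_eqF.
rewrite adde0 big_mkcond/= big_mkord big_ord_recr/=.
have -> : (if U (M ^ n)%N != set0 then diameter (U (M ^ n)%N) `^ t else 0)%E = 0%E.
  case: ifP => // U1; suff -> : diameter (U (M ^ n)%N) = 0%E by rewrite poweR0r// gt_eqF.
  apply/eqP; rewrite eq_le diameter_ge0// andbT; apply: diameter_ub => x y.
  by rewrite /U ltnn eqxx => -> ->; rewrite subrr normr0.
rewrite adde0.
apply: (@le_trans _ _ (\sum_(i < M ^ n) (if `[< A `&` box i !=set0 >]
    then mesh R M n `^ t else 0)%:E)%E).
  apply: lee_sum => i _; case: ifP => Ui; last first.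
    by rewrite lee_fin; case: ifP => // _; exact: powR_ge0.
  have h : A `&` box i !=set0 by move/set0P: Ui; rewrite /U ltn_ord.
  rewrite asboolT// -poweR_EFin; apply: gt0_ler_poweR (Ud i).
  - exact: ltW.
  - by rewrite in_itv/= diameter_ge0//= leey.
  - by rewrite in_itv/= lee_fin mesh_ge0//= leey.
rewrite sumEFin lee_fin -big_mkcond/=.
have -> : \sum_(i < M ^ n | `[< A `&` box i !=set0 >]) mesh R M n `^ t =
    (box_count M n A)%:R * mesh R M n `^ t.
  rewrite sumr_const mulr_natl; congr (_ *+ _).
  by rewrite /box_count cardsE.
have nn0 : (n0 <= n)%N by rewrite /n -addnA leq_addr.
apply: (le_trans (ler_wpM2r (powR_ge0 _ _) (cnt _ nn0))).
rewrite -powRD; first by rewrite addrC.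
by rewrite (gt_eqF (mesh_gt0 R hM n)) implybT.
Qed.

Lemma hausdorff_dim_le A (s : R) : A `<=` `[0, 1] -> 0 <= s ->
  (forall t, s < t -> \forall n \near \oo,
    (box_count M n A)%:R <= mesh R M n `^ (- t)) ->
  (hausdorff_dim A <= s%:E)%E.
Proof.
move=> A01 s0 cnt; apply/lee_addgt0Pr => e e0; rewrite -EFinD.
apply: ereal_inf_lbound; exists (s + e) => //; split; first by rewrite addr_ge0// ltW.
apply: (@hausdorff_measure_eq0 A (s + e / 2)) => //; [lra..|].
by apply: cnt; rewrite ltrDl divr_gt0.
Qed.

Let lnM : 0 < ln M%:R :> R.
Proof. by rewrite ln_gt0// ltr1n. Qed.

Lemma mesh_powR n (t : R) : mesh R M n `^ (- t) = expR (t * (n%:R * ln M%:R)).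
Proof.
have M0 : 0 < M%:R ^+ n :> R by exact: Mm_gt0.
rewrite /mesh powRN -[in LHS](powR_inv1 (ltW M0)) -powRrM mulN1r powRN invrK.
rewrite /powR gt_eqF//; congr (expR (_ * _)).
by rewrite lnXn ?ltr0n ?(leq_trans _ hM)// mulr_natl.
Qed.

Lemma box_count_ln n A (t : R) : (0 < n)%N -> (0 < box_count M n A)%N ->
  (ln (box_count M n A)%:R / (n%:R * ln M%:R) <= t) =
  ((box_count M n A)%:R <= mesh R M n `^ (- t)).
Proof.
move=> n0 b0; have nl : 0 < n%:R * ln M%:R :> R by rewrite mulr_gt0// ltr0n.
rewrite ler_pdivrMr// mesh_powR -[in RHS](lnK (x := (box_count M n A)%:R)).
  by rewrite ler_expR.
by rewrite posrE ltr0n.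
Qed.

Lemma upper_minkowski_dim_le A (s : R) : 0 <= s ->
  (forall t, s < t -> \forall n \near \oo,
    (box_count M n A)%:R <= mesh R M n `^ (- t)) ->
  (upper_minkowski_dim M A <= s%:E)%E.
Proof.
move=> s0 cnt; apply/lee_addgt0Pr => e e0; rewrite -EFinD.
have [n0 _ hn0] : \forall n \near \oo, (box_count M n A)%:R <= mesh R M n `^ (- (s + e)).
  by apply: cnt; rewrite ltrDl.
rewrite /upper_minkowski_dim /limn_esup limf_esupE.
apply: (@le_trans _ _ (ereal_sup ((fun n =>
  (ln (box_count M n A)%:R / (n%:R * ln M%:R))%:E) @` [set n | (n0.+1 <= n)%N]))).
  apply: ereal_inf_lbound; exists [set n | (n0.+1 <= n)%N] => //.
  by exists n0.+1.
apply: ge_ereal_sup => _ [n /= nn0 <-]; rewrite lee_fin.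
have [b0|b0] := posnP (box_count M n A).
  by rewrite b0 ln0// mul0r addr_ge0// ltW.
rewrite box_count_ln//; last exact: leq_trans nn0.
by apply: hn0 => /=; exact: ltnW.
Qed.

Lemma hausdorff_dim_le_upper_minkowski A : A `<=` `[0, 1] ->
  (hausdorff_dim A <= upper_minkowski_dim M A)%E.
Proof.
move=> A01; set D := upper_minkowski_dim M A.
have D0 : (0 <= D)%E.
  rewrite /D /upper_minkowski_dim /limn_esup limf_esupE.
  apply: le_ereal_inf_tmp => _ [V [n _ nV] <-].
  apply: (@le_trans _ _ (ln (box_count M n A)%:R / (n%:R * ln M%:R))%:E).
    rewrite lee_fin divr_ge0//; last by rewrite mulr_ge0// ltW.
    have [->|b0] := posnP (box_count M n A); first by rewrite ln0.
    by rewrite ln_ge0// ler1n.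
  by apply: ereal_sup_ubound; exists n => //; apply: nV => /=.
have [/fineK DE|] := boolP (D \is a fin_num); last first.
  by rewrite ge0_fin_numE// -leNgt leye_eq => /eqP ->; exact: leey.
have fD0 : 0 <= fine D by rewrite fine_ge0.
rewrite -DE; apply: hausdorff_dim_le => // t Dt.
have : (D < t%:E)%E by rewrite -DE lte_fin.
rewrite /D /upper_minkowski_dim /limn_esup limf_esupE => /ereal_inf_lt.
move=> [_ [V [n0 _ hV] <-] supV]; exists n0.+1 => // n /= nn0.
have [->|b0] := posnP (box_count M n A); first exact: powR_ge0.
rewrite -box_count_ln//; last exact: leq_trans nn0.
rewrite -lee_fin; apply: (le_trans _ (ltW supV)).
by apply: ereal_sup_ubound; exists n => //; apply: hV => /=; exact: ltnW.
Qed.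

End dimension_bounds.

(** * Record times and near records of a path *)

Section record_times.
Context (R : realType).
Variables (f : R -> R) (cf : {within `[0, 1], continuous f}).

(** Every value between [f 0 = 0] and a value of [f] is taken at the first time
    it is reached, and this is a record time. *)
Lemma record_values t0 : f 0 = 0 -> 0 <= t0 <= 1 -> 0 < f t0 ->
  `[0, f t0] `<=` f @` record_times f.
Proof.
move=> f0 t01 ft0 y /=; rewrite in_itv/= => /andP[y0 yf].
pose S := [set u : R | 0 <= u <= 1 /\ y <= f u].
have St0 : S t0 by [].
have lbS : lbound S 0 by move=> u [/andP[]].
have infS : has_inf S by split; [exists t0|exists 0].
pose tau := inf S.
have tau0 : 0 <= tau by apply: lb_le_inf => //; exists t0.
have tau1 : tau <= 1.
  by rewrite (le_trans (ge_inf _ St0))//; [exists 0|case/andP: t01].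
have tau01 : 0 <= tau <= 1 by rewrite tau0.
have below u : 0 <= u -> u < tau -> f u < y.
  move=> u0 ut; rewrite ltNge; apply/negP => yu.
  have : tau <= u.
    apply: ge_inf; first by exists 0.
    by split => //; rewrite u0/= (le_trans (ltW ut)).
  by rewrite leNgt ut.
have fy : f tau = y.
  apply/eqP; rewrite eq_le; apply/andP; split; rewrite leNgt; apply/negP => fty.
    have e0 : 0 < f tau - y by rewrite subr_gt0.
    have [del del0 hdel] := within_itv_continuous_eps cf tau01 e0.
    have taupos : 0 < tau.
      rewrite lt_neqAle tau0 andbT; apply/eqP => tauE.
      by move: fty; rewrite -tauE f0 ltNge y0.
    pose u := Num.max 0 (tau - del / 2).
    have u0 : 0 <= u by rewrite le_max lexx.
    have ut : u < tau by rewrite gt_max taupos/= ltrBlDr ltrDl divr_gt0.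
    have := hdel u; rewrite u0 (le_trans (ltW ut) tau1) => /(_ isT).
    rewrite ger0_norm ?subr_ge0 ?(ltW ut)//.
    have -> : tau - u < del.
      have : tau - del / 2 <= u by rewrite le_max lexx orbT.
      by lra.
    move=> /(_ isT); have := below _ u0 ut.
    by rewrite ltr_norml => h /andP[_]; lra.
  have e0 : 0 < y - f tau by rewrite subr_gt0.
  have [del del0 hdel] := within_itv_continuous_eps cf tau01 e0.
  have [u [u01 yu] uS] := inf_adherent del0 infS.
  have tu : tau <= u by apply: ge_inf; [exists 0|split].
  have := hdel _ u01; rewrite ler0_norm ?subr_le0// opprB ltrBlDl uS => /(_ isT).
  by rewrite ltr_norml => /andP[h _]; lra.
exists tau => //; split; first by rewrite /= in_itv.
split; first by exists tau => //=; rewrite in_itv/= tau0 lexx.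
move=> _ [u /= + <-]; rewrite in_itv/= => /andP[u0].
rewrite le_eqVlt => /predU1P[->//|ut].
by rewrite fy ltW// below.
Qed.

Lemma record_times01 : record_times f `<=` `[0, 1].
Proof. by move=> t []. Qed.

Variables (M : nat) (hM : (2 <= M)%N).

(** Only the grid points at least [q] steps before the point of index [q + i] are
    compared with it.  This is a near record for [y < 0], a record by a margin for
    [y > 0]. *)
Definition near_record (q m : nat) (y : R) (i : nat) : bool :=
  [forall l : 'I_i.+1, y <= f (grid R M m (q + i)) - f (grid R M m l)].

(** The grid point just below a record time lies in the same box, and its value
    differs by at most [w] from a value that dominates the past. *)
Lemma box_count_records (n k : nat) (w : R) :
  (forall r, 0 <= r <= 1 -> `|f r - f (grid R M (n + k) (grid_idx M (n + k) r))| <= w) ->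
  (box_count M n (record_times f) <=
   1 + count (near_record (M ^ k) (n + k) (- w)) (iota 0 (M ^ (n + k) - M ^ k)))%N.
Proof.
move=> hw; set q := (M ^ k)%N; set m := (n + k)%N; set K := (_ - _)%N.
have q0 : (0 < q)%N by rewrite expn_gt0 (leq_trans _ hM).
have M0 : 0 < M%:R ^+ n :> R by exact: Mm_gt0.
rewrite /box_count cardE -(size_map val).
pose a := near_record q m (- w).
(* the box of index [0] is counted apart: its points have no room for a window of
   [q] steps to their left *)
pose s2 := 0%N :: [seq ((q + i) %/ q)%N | i <- seq.filter a (iota 0 K)].
have -> : (1 + count a (iota 0 K))%N = size s2 by rewrite /= size_map size_filter.
apply: uniq_leq_size; first by rewrite (map_inj_uniq val_inj) enum_uniq.
move=> _ /mapP[p + ->]; rewrite mem_enum inE => /asboolP[r [[/= r01 [_ rmax]] rbox]].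
rewrite in_itv/= in r01; have /andP[r0 r1] := r01.
move: rbox; rewrite /= in_itv/= => /andP[pr rp].
rewrite /s2 inE; have [//|p0] := eqVneq (val p) 0%N.
apply/orP; right.
pose j := grid_idx M m r.
have /andP[j1 j2] := grid_idx_itv hM m r0; rewrite -/j in j1 j2.
have gq l : grid R M m (l * q) = l%:R / M%:R ^+ n by rewrite gridX.
have pj : (p * q <= j)%N.
  rewrite -ltnS -(ltr_nat R) -(ltr_pM2r (mesh_gt0 R hM m)).
  rewrite -/(grid R M m _) gq (le_lt_trans pr)//.
  by rewrite -natr1 mulrDl mul1r.
have jp : (j < p.+1 * q)%N.
  rewrite -(ltr_nat R) -(ltr_pM2r (mesh_gt0 R hM m)).
  by rewrite -!/(grid R M m _) gq (le_lt_trans j1).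
have qj : (q <= j)%N.
  by rewrite (leq_trans _ pj)// leq_pmull// lt0n.
have jE : j = (q + (j - q))%N by rewrite subnKC.
apply/mapP; exists (j - q)%N; last first.
  rewrite -jE; apply/eqP; rewrite eq_sym eqn_leq.
  by rewrite -ltnS ltn_divLR// jp leq_divRL// pj.
rewrite mem_filter mem_iota/= add0n; apply/andP; split; last first.
  rewrite /K ltn_sub2r//.
    apply: (leq_ltn_trans qj); apply: (leq_trans jp).
    by rewrite /m expnD leq_mul2r ltn_ord orbT.
  apply: (leq_trans jp).
  by rewrite /m expnD leq_mul2r ltn_ord orbT.
apply/forallP => l; rewrite -jE.
have gl : grid R M m l <= r.
  rewrite (le_trans _ j1)// /grid ler_pM2r ?mesh_gt0// ler_nat.
  by rewrite (leq_trans _ (leq_subr q j))// -ltnS.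
have gl0 : 0 <= grid R M m l by rewrite /grid mulr_ge0// mesh_ge0.
have : f (grid R M m l) <= f r.
  by apply: rmax; exists (grid R M m l) => //=; rewrite in_itv/= gl0.
have := hw r r01; rewrite -/j ler_norml => /andP[_].
by lra.
Qed.

End record_times.

Section running_maximum.
Context (R : realType).

Fixpoint running_max (x : nat -> R) n : R :=
  if n is n'.+1 then Num.max (running_max x n') (x n' - x 0) else 0.

Lemma running_max_ge0 x n : 0 <= running_max x n.
Proof. by elim: n => //= n IH; rewrite le_max IH. Qed.

Lemma running_max_leS x n : running_max x n <= running_max x n.+1.
Proof. by rewrite /= le_max lexx. Qed.

Lemma running_max_le x n y : 0 <= y -> (forall l, (l < n)%N -> x l - x 0 <= y) ->
  running_max x n <= y.
Proof.
move=> y0; elim: n => //= n IH h; rewrite ge_max h// andbT.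
by apply: IH => l ln; apply: h; exact: leqW.
Qed.

(** The sum splits into [q] telescoping sums. *)
Lemma sum_shift_le (u : nat -> R) K q : (forall i, 0 <= u i) ->
  (forall i, u i <= u i.+1) ->
  \sum_(i < K) (u (i + q)%N - u i) <= q%:R * u (K + q)%N.
Proof.
move=> u0 uS; elim: q => [|q IH].
  by rewrite big1 ?mul0r// => i _; rewrite addn0 subrr.
have tel : \sum_(i < K) (u (i + q.+1)%N - u (i + q)%N) = u (K + q)%N - u q.
  elim: K {IH} => [|K IH]; first by rewrite big_ord0 add0n subrr.
  by rewrite big_ord_recr/= IH addnS addSn; ring.
rewrite (eq_bigr (fun i : 'I_K => (u (i + q)%N - u i) +
  (u (i + q.+1)%N - u (i + q)%N))); last by move=> i _; ring.
rewrite big_split/= tel -natr1 mulrDl mul1r addnS.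
apply: lerD; last by rewrite (le_trans _ (uS _))// gerBl.
by rewrite (le_trans IH)// ler_wpM2l.
Qed.

(** A point exceeding by [del] all the points at least [q] steps before it makes
    the running maximum grow by [del] over these [q] steps. *)
Lemma count_gap_records (x : nat -> R) (q K : nat) (del : R) :
  del * \sum_(i < K) [forall l : 'I_i.+1, del <= x (q + i)%N - x l]%:R <=
  q%:R * running_max x (K + q).+1.
Proof.
pose u i := running_max x i.+1.
have := @sum_shift_le u K q (fun i => running_max_ge0 _ _) (fun i => running_max_leS _ _).
apply: le_trans; rewrite mulr_sumr; apply: ler_sum => i _.
have [/forallP h|_] := boolP [forall l : 'I_i.+1, del <= x (q + i)%N - x l]; last first.
  rewrite mulr0 subr_ge0 /u; elim: q => [|q IH]; first by rewrite addn0.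
  by rewrite addnS (le_trans IH)// running_max_leS.
rewrite mulr1 lerBrDl -lerBrDr (@le_trans _ _ (x (q + i)%N - x 0 - del))//.
  apply: running_max_le => [|l li].
    by have := h ord0; rewrite subr_ge0.
  by have := h (Ordinal li) => /=; lra.
by rewrite lerD2r /u /= addnC le_max lexx orbT.
Qed.

End running_maximum.

(** * Near records of the sampled process *)

Section borel_cantelli.
Context d (T : measurableType d) (R : realType) (P : probability T R).

Lemma borel_cantelli_geometric (E : nat -> set T) (C q : R) :
  (forall n, measurable (E n)) -> 0 <= C -> 0 <= q < 1 ->
  (forall n, (P (E n) <= (C * q ^+ n)%:E)%E) ->
  {ae P, forall w, exists n0, forall n, (n0 <= n)%N -> ~ E n w}.
Proof.
move=> mE C0 /andP[q0 q1] PE.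
have sum : (\sum_(n <oo) P (E n) < +oo)%E.
  apply: (@le_lt_trans _ _ (\sum_(n <oo) (geometric C q n)%:E)%E).
    by apply: lee_nneseries => // n _; exact: measure_ge0.
  have h : series (geometric C q) @ \oo --> (C * (1 - q)^-1).
    by apply: cvg_geometric_series; rewrite ger0_norm.
  rewrite (_ : (fun n => _) = EFin \o series (geometric C q)); last first.
    by apply/funext => n; rewrite /= sumEFin.
  rewrite EFin_lim; last by apply/cvg_ex; exists (C * (1 - q)^-1).
  exact: ltry.
exists (lim_sup_set E); split.
- apply: bigcapT_measurable => n; exact: bigcup_measurable.
- exact: lim_sup_set_cvg0.
- move=> w /= nE n _; apply: contrapT => h; apply: nE; exists n => k nk Ek.
  by apply: h; exists k.
Qed.

Lemma markov_bool (f : T -> R) (y : R) : integ P f -> (forall w, 0 <= f w) ->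
  0 < y -> mean P (fun w => (y <= f w)%R%:R) <= y^-1 * mean P f.
Proof.
move=> If f0 y0; rewrite -meanZ//; apply: le_mean.
- by apply: integ_bool; apply: measurable_ge; exact: integ_meas If.
- exact: integZ.
- move=> w; have [yf|_] := leP y (f w).
    by rewrite mulrC ler_pdivlMr// mul1r.
  by rewrite mulr_ge0// invr_ge0 ltW.
Qed.

End borel_cantelli.

Section fbm_grid.
Context d (T : measurableType d) (R : realType) (P : probability T R).
Variables (alpha : R) (halpha : 0 < alpha < 1) (B : R -> {RV P >-> R}).
Hypothesis hB : fractional_brownian_motion `[0, 1] alpha B.
Variables (M : nat) (hM : (2 <= M)%N).

Let gs := fbm_gaussian_space halpha hB.
Let alpha0 : 0 < alpha. Proof. by case/andP: halpha. Qed.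

Lemma powR_sqrt2 (x : R) : 0 <= x -> Num.sqrt (x `^ (alpha *+ 2)) = x `^ alpha.
Proof.
move=> x0; rewrite mulr2n powRD ?(gt_eqF (addr_gt0 alpha0 alpha0))//.
by rewrite -expr2 sqrtr_sqr ger0_norm// powR_ge0.
Qed.

Lemma fbm_incr_law s t : 0 <= s -> s <= t -> t <= 1 ->
  normal_law P (fun w => B t w - B s w) 0 ((t - s) `^ alpha).
Proof.
move=> s0 st t1.
have us : unit_itv s by apply: unit_itvP; rewrite s0 (le_trans st).
have ut : unit_itv t by apply: unit_itvP; rewrite t1 (le_trans s0).
have := gs_sd_law gs (fbm_span_incr halpha hB us ut).
by rewrite (fbm_var_incr halpha hB s0 st t1) powR_sqrt2// subr_ge0.
Qed.

(** With the increment of the process over [[u, t]] as direction of the shift,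
    all the increments over larger intervals [[s, t]] move in the same sense. *)
Lemma fbm_cov_incr s u t : 0 <= s -> s <= u -> u <= t -> t <= 1 ->
  2^-1 * (t - u) `^ (alpha *+ 2) <=
  cov P (fun w => B t w - B s w) (fun w => B t w - B u w).
Proof.
move=> s0 su ut t1.
have st := le_trans su ut; have u0 := le_trans s0 su.
have U x : 0 <= x -> x <= t -> unit_itv x.
  by move=> x0 xt; apply: unit_itvP; rewrite x0 (le_trans xt).
have Hs := fbm_span_incr halpha hB (U _ s0 st) (U _ (le_trans u0 ut) (lexx t)).
have Hu := fbm_span_incr halpha hB (U _ u0 ut) (U _ (le_trans u0 ut) (lexx t)).
have := covBB gs Hs Hu.
rewrite (_ : (fun w => B t w - B s w - (B t w - B u w)) = (fun w => B u w - B s w)).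
  rewrite (fbm_var_incr halpha hB s0 st t1) (fbm_var_incr halpha hB u0 ut t1).
  rewrite (fbm_var_incr halpha hB s0 su (le_trans ut t1)).
  have : (u - s) `^ (alpha *+ 2) <= (t - s) `^ (alpha *+ 2).
    apply: ge0_ler_powR; rewrite ?nnegrE ?subr_ge0//.
    - by rewrite mulrn_wge0// ltW.
    - by rewrite lerD2r.
  by move: (cov _ _ _) => c; lra.
by apply/funext => w; ring.
Qed.

Lemma grid_le m i j : (i <= j)%N -> grid R M m i <= grid R M m j.
Proof. by move=> ij; rewrite /grid ler_pM2r ?mesh_gt0// ler_nat. Qed.

Let path w : R -> R := fun t => B t w.

Lemma measurable_near_record q m y i :
  measurable [set w | near_record (path w) M q m y i].
Proof.
apply: (@measurable_all_ge _ _ _ 'I_i.+1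
  (fun l w => B (grid R M m (q + i)) w - B (grid R M m l) w)) => l.
by apply: measurable_funB; exact: measurable_funPT.
Qed.

(** The shift of [gaussian_shift] in the direction of the normalised increment over
    the last [q] steps, the covariances of the differences with it being at least
    half of [(q * mesh) ^ alpha] by [fbm_cov_incr]. *)
Lemma near_record_shift (q m i kappa : nat) (theta del : R) : (0 < q)%N ->
  (q + i <= M ^ m)%N -> 0 <= theta ->
  del = (q%:R * mesh R M m) `^ alpha / 4 ->
  mean P (fun w => (near_record (path w) M q m (- del) i)%:R) <=
  expR (- theta * kappa%:R) * (2 * expR (theta ^+ 2 / 2)) +
  expR (3 * kappa%:R + 6) *
    mean P (fun w => (near_record (path w) M q m del i)%:R).
Proof.
move=> q0 qi theta0; set L := q%:R * mesh R M m => delE.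
have L0 : 0 < L by apply: mulr_gt0; [rewrite ltr0n|exact: mesh_gt0].
pose t := grid R M m (q + i); pose u := grid R M m i.
have tu : t - u = L by rewrite /t /u /L /grid natrD mulrDl addrK.
have /andP[t0 t1] := @grid_itv R M hM m _ qi.
have ut : u <= t by apply: grid_le; rewrite leq_addl.
have u0 : 0 <= u by rewrite mulr_ge0 ?mesh_ge0.
have ut1 : unit_itv t by apply: unit_itvP; rewrite t0.
have uu1 : unit_itv u by apply: unit_itvP; rewrite u0 (le_trans ut).
pose Z w := L `^ (- alpha) * (B t w - B u w).
have HD := fbm_span_incr halpha hB uu1 ut1.
have HZ : fbm_span B Z by exact: gsZ gs _ _ HD.
have La x : L `^ (- x) * L `^ x = 1.
  by rewrite -powRD ?addNr ?powRr0// eqxx (gt_eqF L0).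
have varZ : cov P Z Z = 1.
  rewrite (covZl gs)// covC (covZl gs)// (fbm_var_incr halpha hB)// tu mulrA.
  by rewrite -powRD ?(gt_eqF L0) ?implybT// -opprD -mulr2n La.
have lawZ : normal_law P Z 0 1.
  by have := gs_sd_law gs HZ; rewrite varZ sqrtr1.
pose Y (l : 'I_i.+1) w := B t w - B (grid R M m l) w.
have gl0 (l : 'I_i.+1) : 0 <= grid R M m l by rewrite mulr_ge0 ?mesh_ge0.
have glu (l : 'I_i.+1) : grid R M m l <= u by apply: grid_le; rewrite -ltnS.
have HY l : fbm_span B (Y l).
  apply: (fbm_span_incr halpha hB) => //; apply: unit_itvP.
  by rewrite gl0 (le_trans (glu l) (le_trans ut t1)).
have rho0 : 0 < L `^ alpha / 2 by rewrite divr_gt0// powR_gt0.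
have covY l : L `^ alpha / 2 <= cov P (Y l) Z.
  rewrite covC (covZl gs)// covC.
  have := fbm_cov_incr (gl0 l) (glu l) ut t1; rewrite tu => h.
  apply: le_trans (ler_wpM2l (powR_ge0 L (- alpha)) h).
  rewrite (mulr2n alpha) powRD ?(gt_eqF (addr_gt0 alpha0 alpha0))//.
  rewrite [leRHS](_ : _ = (L `^ (- alpha) * L `^ alpha) * L `^ alpha / 2).
    by rewrite La mul1r.
  by move: (L `^ _) (L `^ alpha) => a b; field.
have := gaussian_shift gs HZ varZ HY rho0 covY kappa.
rewrite (_ : L `^ alpha / 2 / 2 = del); last by rewrite delE; field.
move=> h; apply: (le_trans h); rewrite lerD2r.
by have := normal_law_tail kappa%:R lawZ theta0; rewrite mulr1.
Qed.

(** Each difference [x] satisfies [x <= y + expR (x - y)], hence the maximum is at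
    most [y] plus a sum of exponentials. *)
Lemma mean_running_max m n (y : R) : (n <= (M ^ m).+1)%N ->  0 <= y ->
  integ P (fun w => running_max (fun j => B (grid R M m j) w) n) /\
  mean P (fun w => running_max (fun j => B (grid R M m j) w) n) <=
  y + n%:R * (expR (- y) * expR 2^-1).
Proof.
move=> nM y0.
have law j : (j <= M ^ m)%N ->
    normal_law P (fun w => B (grid R M m j) w - B (grid R M m 0) w) 0 (grid R M m j `^ alpha).
  move=> jM; have /andP[g0 g1] := @grid_itv R M hM m _ jM.
  have g00 : grid R M m 0 = 0 by rewrite /grid mul0r.
  rewrite (_ : grid R M m j `^ alpha = (grid R M m j - grid R M m 0) `^ alpha).
    by apply: fbm_incr_law; rewrite ?g00.
  by rewrite g00 subr0.
pose e j w := expR (- y) * expR (1 * (B (grid R M m j) w - B (grid R M m 0) w)).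
have Ie j : (j <= M ^ m)%N -> integ P (e j) /\ mean P (e j) <= expR (- y) * expR 2^-1.
  move=> jM; have [I E] := normal_law_expR 1 (law j jM).
  split; first exact: integZ.
  rewrite meanZ// E ler_wpM2l ?expR_ge0// ler_expR mul1r.
  have /andP[g0 g1] := @grid_itv R M hM m _ jM.
  rewrite ler_piMl// exprn_ile1 ?powR_ge0//.
  have : grid R M m j `^ alpha <= 1 `^ alpha.
    by apply: ge0_ler_powR; rewrite ?nnegrE ?(ltW alpha0).
  by rewrite powR1.
pose e' j := if (j <= M ^ m)%N then e j else cst 0.
have Ie' j : integ P (e' j).
  by rewrite /e'; case: ifP => [/Ie[]|_] //; exact: integ_cst.
have [IS ES] := mean_sum (index_iota 0 n) Ie'.
have mrm k : measurable_fun [set: T] (fun w => running_max (fun j => B (grid R M m j) w) k).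
  elim: k => [|k IH] /=; first exact: measurable_cst.
  apply: measurable_maxr => //.
  by apply: measurable_funB; exact: measurable_funPT.
pose g w := y + \sum_(j <- index_iota 0 n) e' j w.
have Ig : integ P g by apply: integD => //; exact: integ_cst.
have rmg w : running_max (fun j => B (grid R M m j) w) n <= g w.
  have e0 j : 0 <= e' j w.
    by rewrite /e'; case: ifP => // _; rewrite mulr_ge0// expR_ge0.
  apply: running_max_le => [|l ln].
    by rewrite addr_ge0// sumr_ge0.
  have lM : (l <= M ^ m)%N by rewrite -ltnS (leq_trans ln).
  rewrite /g (big_rem l)/=; last by rewrite mem_index_iota.
  rewrite {1}/e' lM addrA; apply: (@le_trans _ _ (y + e l w)).
    rewrite -lerBlDl; have -> : e l w = expR (B (grid R M m l) w - B (grid R M m 0) w - y).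
      by rewrite /e -expRD mul1r addrC.
    by have := expR_ge1Dx (B (grid R M m l) w - B (grid R M m 0) w - y); lra.
  by rewrite lerDl sumr_ge0.
have Irm : integ P (fun w => running_max (fun j => B (grid R M m j) w) n).
  apply: integ_le Ig _ => // w.
  by rewrite ger0_norm// running_max_ge0.
split => //; apply: (le_trans (le_mean Irm Ig rmg)).
rewrite meanD//; last exact: integ_cst.
rewrite mean_cst lerD2l ES.
apply: (@le_trans _ _ (\sum_(j <- index_iota 0 n) (expR (- y) * expR 2^-1))).
  apply: ler_sum => j _; rewrite /e'; case: ifP => [/Ie[]//|_].
  by rewrite mean_cst mulr_ge0// expR_ge0.
by rewrite sumr_const_nat subn0 mulr_natl.
Qed.

End fbm_grid.

(** * Hoelder exponent and number of near records *)

Section asymptotics.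
Context (R : realType).
Implicit Types x a A : R.

Lemma le_expR x : x <= expR x.
Proof. by have := expR_ge1Dx x; lra. Qed.

Lemma expRN_le_pow p x : 0 < x -> expR (- x) <= (p.+1%:R / x) ^+ p.+1.
Proof.
move=> x0; have y0 : 0 < x / p.+1%:R by rewrite divr_gt0.
rewrite expRN -[leRHS]invrK lef_pV2 ?posrE ?expR_gt0 ?invr_gt0 ?exprn_gt0 ?divr_gt0//.
rewrite -exprVn invf_div -[in leRHS](@divfK _ p.+1%:R _ x)// expRM_natr.
rewrite lerXn2r ?nnegrE ?expR_ge0// ?(ltW y0)//.
exact: le_expR.
Qed.

Lemma near_le_mul a A : 0 < a -> \forall n \near \oo, A <= n%:R * a.
Proof.
move=> a0; exists (Num.bound `|A / a|) => // n /= hn.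
rewrite -ler_pdivrMr// (le_trans (ler_norm _))//.
by apply: (le_trans (ltW (archi_boundP (normr_ge0 _)))); rewrite ler_nat.
Qed.

Lemma natr_pow_expR M n : (2 <= M)%N -> (M ^ n)%:R = expR (n%:R * ln M%:R) :> R.
Proof.
move=> hM; rewrite expRM_natl lnK ?natrX// posrE ltr0n; exact: leq_trans hM.
Qed.

End asymptotics.

Section fbm_asymptotics.
Context d (T : measurableType d) (R : realType) (P : probability T R).
Variables (alpha : R) (halpha : 0 < alpha < 1) (B : R -> {RV P >-> R}).
Hypothesis hB : fractional_brownian_motion `[0, 1] alpha B.
Variables (M : nat) (hM : (2 <= M)%N).

Let gs := fbm_gaussian_space halpha hB.
Let alpha0 : 0 < alpha. Proof. by case/andP: halpha. Qed.
Let l : R := ln M%:R.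
Let l0 : 0 < l. Proof. by rewrite ln_gt0// ltr1n. Qed.

Let meshE n t : mesh R M n `^ (- t) = expR (t * (n%:R * l)).
Proof. exact: mesh_powR. Qed.

Lemma fbm_incr_tail m j beta : (j < M ^ m)%N ->
  mean P (fun w => (mesh R M m `^ beta <=
    `|B (grid R M m j.+1) w - B (grid R M m j) w|)%R%:R) <=
  expR (- expR ((alpha - beta) * (m%:R * l))) * (2 * expR 2^-1).
Proof.
move=> jM; have /andP[t0 t1] := @grid_itv R M hM m _ jM.
have /andP[s0 s1] := @grid_itv R M hM m _ (ltnW jM).
have st : grid R M m j <= grid R M m j.+1 by exact: grid_le.
have := fbm_incr_law halpha hB s0 st t1.
rewrite (_ : grid R M m j.+1 - grid R M m j = mesh R M m); last first.
  by rewrite /grid -natr1 mulrDl mul1r addrAC subrr add0r.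
move=> /(normal_law_tail (mesh R M m `^ beta)) h.
have /h : 0 <= mesh R M m `^ (- alpha) by exact: powR_ge0.
have mp : (mesh R M m == 0) = false by rewrite gt_eqF// mesh_gt0.
rewrite mulNr -!powRD ?mp ?implybT// addNr powRr0 expr1n div1r.
by rewrite -[- alpha + beta]opprK meshE opprD opprK.
Qed.

(** The normal tail at [mesh m ^ beta], which is a power of [M ^ m] times the standard
    deviation, is smaller than any power of [mesh m], whereas level [m] has only
    [M ^ m] increments. *)
Lemma fbm_grid_incr_ae beta : beta < alpha ->
  {ae P, forall w, exists m0, forall m j, (m0 <= m)%N -> (j < M ^ m)%N ->
    `|B (grid R M m j.+1) w - B (grid R M m j) w| <= mesh R M m `^ beta}.
Proof.
move=> ba; pose g := alpha - beta; have g0 : 0 < g by rewrite subr_gt0.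
(* with this exponent, [expRN_le_pow] beats the square of [M ^ m] *)
pose p := Num.bound (2 / g).
have pg : 2 <= p.+1%:R * g.
  rewrite -ler_pdivrMr// (le_trans (ltW (archi_boundP _)))// ?ler_nat//.
  by rewrite divr_ge0// ltW.
pose b m j := [set w | mesh R M m `^ beta <=
    `|B (grid R M m j.+1) w - B (grid R M m j) w|].
have mb m j : measurable (b m j).
  apply: measurable_ge; apply: measurableT_comp => //.
  by apply: measurable_funB; exact: measurable_funPT.
pose E m := \big[setU/set0]_(j < M ^ m) b m j.
pose C : R := p.+1%:R ^+ p.+1 * (2 * expR 2^-1).
have tail m : (M ^ m)%:R * (expR (- expR (g * (m%:R * l))) * (2 * expR 2^-1)) <=
    C * expR (- l) ^+ m.
  rewrite /C mulrA [leRHS]mulrAC ler_wpM2r ?mulr_ge0 ?expR_ge0//.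
  rewrite natr_pow_expR// -/l -expRM_natl.
  apply: (le_trans (ler_wpM2l (expR_ge0 _) (expRN_le_pow p (expR_gt0 _)))).
  rewrite expr_div_n mulrCA ler_wpM2l ?exprn_ge0//.
  rewrite -expRM_natl -expRN -expRD ler_expR mulrN.
  have : 0 <= m%:R * l by rewrite mulr_ge0// ltW.
  move: (m%:R * l) pg => z pg z0.
  have : 2 * z <= p.+1%:R * g * z by rewrite ler_wpM2r.
  by rewrite -mulrA; lra.
have PE m : (P (E m) <= (C * expR (- l) ^+ m)%:E)%E.
  apply: (le_trans (Boole_inequality _ _)) => //.
  apply: (@le_trans _ _ (\sum_(j < M ^ m)
    (expR (- expR (g * (m%:R * l))) * (2 * expR 2^-1))%:E)%E).
    apply: lee_sum => j _.
    have := fbm_incr_tail beta (ltn_ord j).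
    by rewrite -lee_fin; apply: le_trans; rewrite (mean_bool P (mb m j)).
  by rewrite sumEFin lee_fin sumr_const card_ord -[leLHS]mulr_natl; exact: tail.
have := @borel_cantelli_geometric _ _ _ P E C (expR (- l)).
case=> [m|||m|N [mN N0 hN]].
- exact: bigsetU_measurable.
- by rewrite /C mulr_ge0 ?exprn_ge0 ?mulr_ge0 ?expR_ge0.
- by rewrite expR_ge0 expR_lt1 oppr_lt0.
- exact: PE.
exists N; split => // w /= h; apply: hN => /= -[n0 hn]; apply: h.
exists n0 => m j nm jM; rewrite leNgt; apply/negP => /ltW bj.
by apply: (hn m nm); rewrite /E -bigcup_mkord; exists j.
Qed.

Definition near_record_count n k w : R :=
  \sum_(i < M ^ (n + k) - M ^ k)
    (near_record (fun t => B t w) M (M ^ k) (n + k) (- (mesh R M n `^ alpha / 4)) i)%:R.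

Lemma near_record_count_ge0 n k w : 0 <= near_record_count n k w.
Proof. exact: sumr_ge0. Qed.

Lemma integ_near_record_count n k : integ P (near_record_count n k).
Proof.
apply: proj1 (mean_sum _ _) => i.
by apply: integ_bool; exact: measurable_near_record.
Qed.

(** Each near record is traded for a record by the margin, and the latter are counted
    by [count_gap_records]. *)
Lemma mean_near_record_count n k kappa theta : 0 <= theta ->
  mean P (near_record_count n k) <=
  (M ^ (n + k))%:R * (expR (- theta * kappa%:R) * (2 * expR (theta ^+ 2 / 2))) +
  expR (3 * kappa%:R + 6) * ((M ^ k)%:R * (mesh R M n `^ alpha / 4)^-1 *
    ((n + k)%:R * l + 2 * expR 2^-1)).
Proof.
move=> theta0; set del := mesh R M n `^ alpha / 4.
set m := (n + k)%N; set q := (M ^ k)%N; set K := (M ^ m - q)%N.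
set tail := (X in _ * X + _).
have M0 : (0 < M)%N by exact: leq_trans hM.
have q0 : (0 < q)%N by rewrite expn_gt0 M0.
have qM : (q <= M ^ m)%N by rewrite leq_exp2l// leq_addl.
have KM : (K + q = M ^ m)%N by rewrite subnK.
have del0 : 0 < del by apply: divr_gt0 => //; exact/powR_gt0/mesh_gt0.
have delE : del = (q%:R * mesh R M m) `^ alpha / 4.
  congr (_ `^ _ / _); rewrite /mesh /m /q natrX exprD invfM mulrCA divff ?mulr1//.
  by rewrite expf_neq0// pnatr_eq0 -lt0n.
pose F (i : 'I_K) w := near_record (fun t => B t w) M q m del i.
have IA (i : 'I_K) : integ P (fun w => (near_record (fun t => B t w) M q m (- del) i)%:R : R).
  by apply: integ_bool; exact: measurable_near_record.
have IF (i : 'I_K) : integ P (fun w => (F i w)%:R).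
  by apply: integ_bool; exact: measurable_near_record.
have [_ EA] := mean_sum (index_enum 'I_K) IA.
have [ISF EF] := mean_sum (index_enum 'I_K) IF.
rewrite [leLHS]EA.
apply: (@le_trans _ _ (\sum_(i < K) (tail + expR (3 * kappa%:R + 6) * mean P (fun w => (F i w)%:R)))).
  apply: ler_sum => i _; apply: (near_record_shift halpha hB hM kappa) => //.
  by rewrite -KM addnC leq_add2r ltnW.
rewrite big_split/= -[X in _ + X <= _]mulr_sumr -EF sumr_const card_ord -[tail *+ K]mulr_natl.
have tail0 : 0 <= tail by rewrite !mulr_ge0 ?expR_ge0.
apply: lerD; first by rewrite ler_wpM2r// ler_nat leq_subr.
rewrite ler_wpM2l ?expR_ge0// -mulrA mulrCA ler_pdivlMl//.
rewrite -meanZ//.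
have y0 : 0 <= m%:R * l by rewrite mulr_ge0// ltW.
have [Irm Erm] := mean_running_max halpha hB hM (leqnn (M ^ m).+1) y0.
have IqR := integZ q%:R Irm.
apply: (@le_trans _ _ (mean P (fun w => q%:R * running_max (fun j => B (grid R M m j) w) (M ^ m).+1))).
  apply: le_mean => //; first exact: integZ.
  by move=> w; rewrite -KM; exact: count_gap_records.
rewrite meanZ// ler_wpM2l//; apply: (le_trans Erm); rewrite lerD2l mulrA.
rewrite ler_wpM2r ?expR_ge0// expRN ler_pdivrMr ?expR_gt0// -natr_pow_expR//.
by rewrite -natr1 mulr_natl mulr2n lerD2l ler1n expn_gt0 M0.
Qed.

Section exponent.
Variables (eps : R) (eps01 : 0 < eps < 1).

Let eps0 : 0 < eps. Proof. by case/andP: eps01. Qed.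
Let eps1 : eps < 1. Proof. by case/andP: eps01. Qed.

(** Refining the boxes of level [n] by a factor about [M ^ (eps n)] costs as much in
    the counting, and makes the oscillation of the path between grid points smaller
    than the margin of near records. *)
Definition fine_level (n : nat) : nat := (Num.truncn (eps * n%:R)).+1.

Lemma fine_level_itv n : eps * n%:R <= (fine_level n)%:R <= eps * n%:R + 1.
Proof.
have e0 : 0 <= eps * n%:R by rewrite mulr_ge0// ltW.
have /andP[h1 h2] := truncn_itv e0.
by rewrite (ltW h2)/= /fine_level -natr1 lerD2r.
Qed.

Lemma near_record_count_bound : exists2 C : R, 0 <= C & forall n,
  mean P (near_record_count n (fine_level n)) <=
  C * expR ((alpha + 3 * eps) * (n%:R * l)).
Proof.
(* with [z] the logarithm of [M ^ n], the choice of [kappa] below makes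
   [expR (3 * kappa)] at most [expR (eps * z)], and this [theta] then makes the
   tail of order [expR (- 2 * z)], against [expR ((1 + eps) * z)] grid points *)
pose theta := 6 / eps; have theta0 : 0 <= theta by rewrite divr_ge0// ltW.
pose D := 2 * expR (theta ^+ 2 / 2); have D0 : 0 <= D by rewrite mulr_ge0// expR_ge0.
pose C2 : R := 2 / eps + l + 2 * expR 2^-1.
have C20 : 0 <= C2.
  by rewrite !addr_ge0 ?divr_ge0 ?mulr_ge0 ?expR_ge0// ltW.
exists (expR (l + theta) * D + 4 * expR (6 + l) * C2).
  by rewrite addr_ge0// !mulr_ge0 ?expR_ge0.
move=> n; set k := fine_level n; set z := n%:R * l.
have z0 : 0 <= z by rewrite mulr_ge0// ltW.
have ez0 : 0 <= eps * z by rewrite mulr_ge0// ltW.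
have ez1 : eps * z <= z by rewrite ler_piMl// ltW.
have az0 : 0 <= alpha * z by rewrite mulr_ge0// ltW.
have kl : k%:R * l <= eps * z + l.
  have /andP[_ h] := fine_level_itv n.
  apply: (le_trans (ler_wpM2r (ltW l0) h)).
  by rewrite mulrDl mul1r -mulrA.
have ml : (n + k)%:R * l <= z + eps * z + l.
  by rewrite natrD mulrDl -addrA lerD2l.
pose kappa := Num.truncn (eps * z / 3).
have /andP[kap1 kap2] : kappa%:R <= eps * z / 3 < kappa.+1%:R.
  by apply: truncn_itv; rewrite divr_ge0.
have thk : - theta * kappa%:R <= theta - 2 * z.
  rewrite mulNr lerNl opprB lerBlDr.
  rewrite -[X in _ <= _ + X]mulr1 -mulrDr natr1.
  apply: (le_trans _ (ler_wpM2l theta0 (ltW kap2))).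
  rewrite /theta [leRHS](_ : _ = 2 * z)//.
  have en : eps != 0 by rewrite gt_eqF.
  by move: (z) => zz; field.
apply: (le_trans (mean_near_record_count n k kappa theta0)).
rewrite [leRHS]mulrDl -/D; apply: lerD.
  rewrite mulrA [leRHS]mulrAC ler_wpM2r// natr_pow_expR// -!expRD ler_expR -/l.
  have : 0 <= 3 * eps * z by rewrite mulr_ge0// mulr_ge0// ltW.
  move: az0 ez1 ml thk; rewrite [(alpha + _) * z]mulrDl.
  by move: (_ * kappa%:R) ((n + k)%:R * l) (eps * z) (alpha * z) => a b c e; lra.
have e1 : expR (3 * kappa%:R + 6) <= expR (eps * z) * expR 6.
  by rewrite -expRD ler_expR lerD2r; move: kap1; lra.
have e2 : (M ^ k)%:R <= expR (eps * z) * expR l :> R.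
  by rewrite natr_pow_expR// -expRD ler_expR.
have e3 : (mesh R M n `^ alpha / 4)^-1 = 4 * expR (alpha * z).
  by rewrite invfM invrK mulrC -powRN meshE.
have e4 : (n + k)%:R * l + 2 * expR 2^-1 <= C2 * expR (eps * z).
  have h1 : 1 <= expR (eps * z) by rewrite -expR0 ler_expR.
  rewrite /C2 (mulrDl _ (2 * _)) (mulrDl _ l); apply: lerD; last by rewrite ler_peMr// mulr_ge0// expR_ge0.
  have : z <= eps^-1 * expR (eps * z) by rewrite ler_pdivlMl// le_expR.
  have : l <= l * expR (eps * z) by rewrite ler_peMr// ltW.
  rewrite -(mulrA 2 eps^-1); move: (eps^-1 * expR _) (l * expR _) => a b h2 h3.
  by move: ml ez1 h2 h3; lra.
rewrite e3.
apply: (@le_trans _ _ (expR (eps * z) * expR 6 * (expR (eps * z) * expR l *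
    (4 * expR (alpha * z)) * (C2 * expR (eps * z))))).
  have r0 : 0 <= (n + k)%:R * l + 2 * expR 2^-1.
    by rewrite addr_ge0 ?mulr_ge0 ?expR_ge0//; exact: ltW.
  apply: ler_pM; [exact: expR_ge0| |exact: e1|].
    by rewrite mulr_ge0// !mulr_ge0 ?expR_ge0.
  apply: ler_pM; [by rewrite !mulr_ge0 ?expR_ge0|by []| |exact: e4].
  by rewrite ler_wpM2r// mulr_ge0// expR_ge0.
rewrite [(alpha + _) * z]mulrDl (_ : 3 * eps * z = eps * z + eps * z + eps * z); last first.
  by rewrite -mulrA; move: (eps * z) => ?; ring.
rewrite (expRD 6) (expRD (alpha * z)) !(expRD _ (eps * z)).
move: (expR (eps * z)) (expR (alpha * z)) (expR 6) (expR l) => a b c e.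
by rewrite le_eqVlt; apply/orP; left; apply/eqP; ring.
Qed.

Lemma near_record_count_ae : {ae P, forall w, \forall n \near \oo,
  near_record_count n (fine_level n) w < expR ((alpha + 4 * eps) * (n%:R * l))}.
Proof.
have [C C0 hC] := near_record_count_bound.
pose b n w := expR ((alpha + 4 * eps) * (n%:R * l)) <= near_record_count n (fine_level n) w.
have mb n : measurable [set w | b n w].
  by apply: measurable_ge; exact: integ_meas (integ_near_record_count _ _).
have Pb n : (P [set w | b n w] <= (C * expR (- (eps * l)) ^+ n)%:E)%E.
  rewrite -(mean_bool P (mb n)) lee_fin.
  apply: (le_trans (markov_bool (integ_near_record_count _ _) (near_record_count_ge0 _ _) (expR_gt0 _))).
  rewrite ler_pdivrMl ?expR_gt0//; apply: (le_trans (hC n)).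
  rewrite -expRM_natl [leRHS]mulrCA ler_wpM2l// -expRD ler_expR.
  by rewrite le_eqVlt; apply/orP; left; apply/eqP; ring.
have el : 0 < eps * l by rewrite mulr_gt0.
have [|N [mN N0 hN]] := borel_cantelli_geometric mb C0 _ Pb.
  by rewrite expR_ge0 expR_lt1 oppr_lt0.
exists N; split => // w /= h; apply: hN => /= -[n0 hn]; apply: h.
exists n0 => // n /= n0n; rewrite ltNge; apply/negP; exact: hn.
Qed.

Lemma fbm_box_count_ae : {ae P, forall w, \forall n \near \oo,
  (box_count M n (record_times (fun t => B t w)))%:R <= mesh R M n `^ (- (alpha + 5 * eps))}.
Proof.
(* since [(1 + eps) * (1 - eps / 2) > 1], the oscillation [mesh (n + k) ^ beta] of
   the path is negligible compared with [mesh n ^ alpha] *)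
pose beta := alpha * (1 - eps / 2).
have ba : beta < alpha.
  by rewrite /beta mulrBr mulr1 gtrDl oppr_lt0 mulr_gt0// divr_gt0.
have b0 : 0 < beta by rewrite mulr_gt0//; move: eps1; lra.
have h1 := near_record_count_ae; have h2 := fbm_grid_incr_ae ba.
have h3 := fbm_continuous hB.
apply: filterS3 h1 h2 h3 => w hX [m0 incr] cf.
pose c : R := chain_const M beta.
have a0 : 0 < alpha * (eps * (1 - eps) / 2) * l.
  by rewrite !mulr_gt0 ?divr_gt0 ?mulr_gt0 ?subr_gt0.
have near1 := near_le_mul (4 * c) a0.
have near2 := near_le_mul 1 (mulr_gt0 eps0 l0).
have near3 : \forall n \near \oo, (m0 <= n)%N by exact: nbhs_infty_ge.
apply: filterS3 hX near1 (filterI near2 near3) => n Xn n1 [n2 n3].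
set k := fine_level n; pose del := mesh R M n `^ alpha / 4.
set z := n%:R * l; have z0 : 0 <= z by rewrite mulr_ge0// ltW.
have mE N t : mesh R M N `^ t = expR (- (t * (N%:R * l))).
  by rewrite -[in LHS](opprK t) meshE mulNr.
have mesh_le : c * mesh R M (n + k) `^ beta <= del.
  rewrite /del !mE.
  rewrite ler_pdivlMr// mulrAC [c * 4]mulrC -ler_pdivlMr ?expR_gt0// -expRN opprK -expRD.
  apply: (le_trans n1); apply: (le_trans _ (le_expR _)).
  have /andP[kn _] := fine_level_itv n.
  have : beta * (eps * z) <= beta * (k%:R * l).
    by rewrite ler_wpM2l ?(ltW b0)// mulrA ler_wpM2r// ltW.
  rewrite natrD /beta /z; move: (n%:R) (k%:R) => x y h.
  apply: (@le_trans _ _ (- (alpha * (x * l)) + (beta * (x * l) + beta * (eps * (x * l))))).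
    by rewrite /beta le_eqVlt; apply/orP; left; apply/eqP; field.
  by move: h; rewrite /beta; lra.
have cnt : (box_count M n (record_times (fun t => B t w)) <=
   1 + count (near_record (fun t => B t w) M (M ^ k) (n + k) (- del))
     (iota 0 (M ^ (n + k) - M ^ k)))%N.
  apply: box_count_records => // r r01.
  apply: (le_trans (chain_point hM b0 cf incr _ r01)) => //.
  by rewrite (leq_trans n3)// leq_addr.
rewrite meshE -/z.
apply: (@le_trans _ _ (1 + near_record_count n k w)).
  move: cnt; rewrite -(ler_nat R) natrD => /le_trans; apply; rewrite lerD2l.
  rewrite -sum1_count natr_sum big_mkcond/= -[X in iota 0 X]subn0.
  rewrite (big_mkord xpredT) /near_record_count.
  by apply: ler_sum => i _; case: ifP.
apply: (@le_trans _ _ (2 * expR ((alpha + 4 * eps) * z))).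
  rewrite mulr_natl mulr2n; apply: lerD; last exact: ltW.
  by rewrite -expR0 ler_expR mulr_ge0// addr_ge0 ?mulr_ge0// ltW.
have e2 : 2 <= expR (eps * z).
  by have := expR_ge1Dx (eps * z); rewrite /z mulrCA; move: n2; lra.
apply: (le_trans (ler_wpM2r (expR_ge0 _) e2)); rewrite -expRD ler_expR.
by rewrite le_eqVlt; apply/orP; left; apply/eqP; ring.
Qed.

End exponent.

End fbm_asymptotics.

(** * Dimensions of the record times *)

Section fbm_dimension.
Context d (T : measurableType d) (R : realType) (P : probability T R).
Variables (alpha : R) (halpha : 0 < alpha < 1) (B : R -> {RV P >-> R}).
Hypothesis hB : fractional_brownian_motion `[0, 1] alpha B.
Variables (M : nat) (hM : (2 <= M)%N).

Let alpha0 : 0 < alpha. Proof. by case/andP: halpha. Qed.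

(** The path is Hoelder of exponent [beta] and maps the record times onto an
    interval. *)
Lemma fbm_hausdorff_dim_ge_ae beta : 0 < beta < alpha ->
  {ae P, forall w, (beta%:E <= hausdorff_dim (record_times (fun t => B t w)))%E}.
Proof.
move=> /andP[b0 ba].
have h1 := fbm_grid_incr_ae halpha hB hM ba.
apply: filterS3 h1 (fbm_continuous hB) (filterI (fbm_zero hB) (fbm_pos_ae halpha hB)).
move=> w [m0 incr] cf [f0 [t0 [t01 ft0]]].
have [C C0 hC] := chain_hoelder hM b0 cf incr.
apply: (hausdorff_dim_ge C0 (mesh_gt0 R hM m0) b0 ft0).
  move=> s t /record_times01/=; rewrite in_itv/= => s01.
  by move=> /record_times01/=; rewrite in_itv/= => t01'; exact: hC.
exact: (@record_values _ (fun t => B t w)).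
Qed.

Lemma fbm_upper_minkowski_dim_le_ae : {ae P, forall w,
  (upper_minkowski_dim M (record_times (fun t => B t w)) <= alpha%:E)%E}.
Proof.
pose e (j : nat) : R := j.+2%:R^-1.
have e01 j : 0 < e j < 1 by rewrite invr_gt0 ltr0n/= invf_lt1 ?ltr1n ?ltr0n.
have h := ae_foralln (fun j => fbm_box_count_ae halpha hB hM (e01 j)).
apply: filterS h => w hw; apply: (upper_minkowski_dim_le hM (ltW alpha0)) => t at0.
have ta : 0 < (t - alpha) / 5 by rewrite divr_gt0// subr_gt0.
pose j := Num.bound ((t - alpha) / 5)^-1.
have ej : e j <= (t - alpha) / 5.
  rewrite /e -[leRHS]invrK lef_pV2 ?posrE ?invr_gt0 ?ltr0n//.
  apply: (le_trans (ltW (archi_boundP _))); first by rewrite invr_ge0 ltW.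
  by rewrite ler_nat -/j leqW.
apply: filterS (hw j) => n /le_trans; apply.
rewrite !mesh_powR// ler_expR; apply: ler_wpM2r; last by move: ej; lra.
by rewrite mulr_ge0// ln_ge0// ler1n (leq_trans _ hM).
Qed.

End fbm_dimension.

Theorem proposition1p5 (d : measure_display) (T : measurableType d)
    (R : realType) (P : probability T R) (alpha : R)
    (halpha : 0 < alpha < 1) (B : R -> {RV P >-> R})
    (hB : fractional_brownian_motion `[0, 1] alpha B)
    (M : nat) (hM : (2 <= M)%N) :
  {ae P, forall w : T,
    hausdorff_dim (record_times (fun t => B t w)) = alpha%:E /\
    upper_minkowski_dim M (record_times (fun t => B t w)) = alpha%:E}.
Proof.
have /andP[alpha0 _] := halpha.
pose beta (j : nat) := alpha * (1 - j.+2%:R^-1).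
have hbeta j : 0 < beta j < alpha.
  rewrite mulr_gt0 ?subr_gt0 ?invf_lt1 ?ltr1n ?ltr0n//=.
  by rewrite gtr_pMr// gtrBl invr_gt0 ltr0n.
have lower := ae_foralln (fun j => fbm_hausdorff_dim_ge_ae halpha hB hM (hbeta j)).
have upper := fbm_upper_minkowski_dim_le_ae halpha hB hM.
apply: filterS2 lower upper => w hlow hup.
set A := record_times _.
have le1 : (hausdorff_dim A <= upper_minkowski_dim M A)%E.
  by apply: (hausdorff_dim_le_upper_minkowski hM); exact: record_times01.
have le2 : (alpha%:E <= hausdorff_dim A)%E.
  apply/lee_addgt0Pr => e e0.
  pose j := Num.bound (alpha / e).
  apply: (@le_trans _ _ ((beta j)%:E + e%:E)%E); last by rewrite leeD2r// hlow.
  rewrite -EFinD lee_fin /beta mulrBr mulr1 -addrA lerDl addrC subr_ge0.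
  rewrite ler_pdivrMr ?ltr0n// mulrC -ler_pdivrMr//.
  apply: (le_trans (ltW (archi_boundP _))); first by rewrite divr_ge0// ltW.
  by rewrite ler_nat -/j leqW.
split; apply/eqP; rewrite eq_le.
  by rewrite le2 (le_trans le1 hup).
by rewrite hup (le_trans le2 le1).
Qed.
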